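(* Let $n\ge 3$ and let $I\subseteq \mathcal{K}_{\infty}$ be a bounded measurable subset. For every $\frac12<\delta<1$ and for almost every non-degenerate isotropic quadratic form $Q$ on $\mathcal{K}_\infty^n$, there exists $C_Q>0$ depending only on $Q$ (not on $I$ or $\delta$) such that, for integers $t\to\infty$, $$\#\left\{\mathbf{v}\in \mathcal{R}^n: Q(\mathbf{v})\in I,\ \Vert \mathbf{v}\Vert\leq q^t\right\}=C_Q\,q^{(n-2)t}\,m_{\mathcal{K}_{\infty}}(I)+O_{Q,I}\left(q^{\delta t(n-2)}\right).$$
   Context: Let $q$ be a power of an odd prime, $\mathcal{R}=\mathbb{F}_q[x]$, $\mathcal{K}=\mathbb{F}_q(x)$ with absolute value $|f/g|=q^{\deg f-\deg g}$, and $\mathcal{K}_\infty=\mathbb{F}_q((x^{-1}))$ its completion. Let $\mathcal{O}_\infty=\mathbb{F}_q[[x^{-1}]]$. $m_{\mathcal{K}_\infty}$ is the Haar measure on $\mathcal{K}_\infty$ with $m_{\mathcal{K}_\infty}(\mathcal{O}_\infty)=1$. For $\mathbf{v}=(v_1,\dots,v_n)\in\mathcal{K}_\infty^n$, $\Vert\mathbf{v}\Vert=\max_i|v_i|$. A quadratic form $Q$ on $\mathcal{K}_\infty^n$ is isotropic if $Q(\mathbf{v})=0$ for some $\mathbf{v}\neq0$. Let $\mathrm{G}=\{g\in \mathrm{GL}_n(\mathcal{K}_\infty): |\det g|=1\}$ with Haar measure $m_{\mathrm{G}}$. ''Almost every non-degenerate isotropic quadratic form'' means: for every non-degenerate isotropic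 quadratic form $Q_0$, the property holds for $Q=Q_0\circ g$ for $m_{\mathrm{G}}$-almost every $g\in \mathrm{G}$. The subscripts in $O_{Q,I}$ indicate that the implied constant may depend on $Q$ and $I$ ($n,q,\delta$ being fixed). *)

(* Defs.v *)
From HB Require Import structures.
From mathcomp Require Import all_boot all_order all_algebra finmap.
From mathcomp Require Import all_classical all_reals all_analysis.
From mathcomp Require Import ring lra zify.

Set Implicit Arguments.
Unset Strict Implicit.
Unset Printing Implicit Defensive.
Import Order.TTheory GRing.Theory Num.Theory.
Import numFieldNormedType.Exports.

Local Open Scope classical_set_scope.
Local Open Scope ring_scope.

(* The field F((1/x)): [lcoef f n] is the coefficient of x^n, and only finitely
   many coefficients with n > 0 are nonzero. *)
Record laurent (F : finFieldType) := Laurent {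
  lcoef :> int -> F;
  _ : `[< exists N : int, forall n, N < n -> lcoef n = 0 >] }.

HB.instance Definition _ (F : finFieldType) := [isSub for @lcoef F].
HB.instance Definition _ (F : finFieldType) := [Choice of laurent F by <:].

Section LaurentField.
Variable F : finFieldType.
Implicit Types f g h : laurent F.

Lemma laurentP f g : (forall n, f n = g n) -> f = g.
Proof. by move=> fg; apply/val_inj/funext. Qed.

Definition lbounded (u : int -> F) (a : int) := forall n, a < n -> u n = 0.

Lemma laurent_bounded f : exists a, lbounded f a.
Proof. by case: f => u /= /asboolP. Qed.

Lemma lboundedW (u : int -> F) a b : a <= b -> lbounded u a -> lbounded u b.
Proof. by move=> ab ua n bn; apply: ua; lia. Qed.

Definition mk_laurent (u : int -> F) (ub : exists a, lbounded u a) :=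
  Laurent (asboolT ub).

Lemma lzero_subproof : exists a, lbounded (fun=> 0) a.
Proof. by exists 0. Qed.
Definition lzero := mk_laurent lzero_subproof.

Lemma ladd_subproof f g : exists a, lbounded (fun n => f n + g n) a.
Proof.
have [a fa] := laurent_bounded f; have [b gb] := laurent_bounded g.
by exists (Num.max a b) => n; rewrite gt_max => /andP[/fa-> /gb->]; rewrite addr0.
Qed.
Definition ladd f g := mk_laurent (ladd_subproof f g).

Lemma lopp_subproof f : exists a, lbounded (fun n => - f n) a.
Proof. by have [a fa] := laurent_bounded f; exists a => n /fa->; rewrite oppr0. Qed.
Definition lopp f := mk_laurent (lopp_subproof f).

Lemma laddA : associative ladd.
Proof. by move=> f g h; apply: laurentP => n /=; rewrite addrA. Qed.
Lemma laddC : commutative ladd.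
Proof. by move=> f g; apply: laurentP => n /=; rewrite addrC. Qed.
Lemma ladd0 : left_id lzero ladd.
Proof. by move=> f; apply: laurentP => n /=; rewrite add0r. Qed.
Lemma laddN : left_inverse lzero lopp ladd.
Proof. by move=> f; apply: laurentP => n /=; rewrite addNr. Qed.

HB.instance Definition _ :=
  GRing.isZmodule.Build (laurent F) laddA laddC ladd0 laddN.

(* Cauchy product; the sum has finite support for Laurent series. *)
Definition lconv (u v : int -> F) (n : int) : F :=
  \sum_(i \in [set: int]) u i * v (n - i).

(* First [N] coefficients of [u], counted downwards from x^a. *)
Definition ltrunc (a : int) (N : nat) (u : int -> F) : {poly F} :=
  \poly_(k < N) u (a - k%:Z).

Lemma lconv_out u v a b : lbounded u a -> lbounded v b -> lbounded (lconv u v) (a + b).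
Proof.
move=> ua vb n abn; rewrite /lconv fsbig1// => i _.
have [ai|ia] := ltP a i; first by rewrite ua// mul0r.
by rewrite [v _]vb ?mulr0//; lia.
Qed.

Lemma lconvE u v a b k N : lbounded u a -> lbounded v b -> (k < N)%N ->
  lconv u v (a + b - k%:Z) = (ltrunc a N u * ltrunc b N v)`_k.
Proof.
move=> ua vb kN; rewrite coefM /lconv.
pose s := [seq a - (i : nat)%:Z | i <- iota 0 k.+1].
have sE : s = [seq a - (i : nat)%:Z | i <- iota 0 k.+1] by [].
have us : uniq s by rewrite map_inj_uniq ?iota_uniq// => i j /= ; lia.
clearbody s.
rewrite (@fsbigE _ _ _ _ _ s)// => [|i _ si]; last first.
  have [ai|ia] := ltP a i; first by rewrite ua// mul0r.
  rewrite [v _]vb ?mulr0//; case: (ltP i (a - k%:Z)) => ki; first by lia.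
  suff : i \in s by rewrite (negbTE si).
  by rewrite sE; apply/mapP; exists `|a - i|%N; [rewrite mem_iota; lia|lia].
rewrite (eq_bigl xpredT) => [|i]; last exact: classical_sets.in_setT.
rewrite sE big_map -[X in iota _ X]subn0 -/(index_iota 0 k.+1) big_mkord.
apply: eq_bigr => i _; rewrite !coef_poly.
have ik := ltn_ord i.
rewrite !ifT; [|lia|lia]; congr (u _ * v _); lia.
Qed.

Lemma lmul_subproof f g : exists a, lbounded (lconv f g) a.
Proof.
have [a fa] := laurent_bounded f; have [b gb] := laurent_bounded g.
by exists (a + b); exact: lconv_out.
Qed.
Definition lmul f g := mk_laurent (lmul_subproof f g).

Lemma lone_subproof : exists a, lbounded (fun n => (n == 0)%:R) a.
Proof. by exists 0 => n n0; rewrite gt_eqF. Qed.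
Definition lone := mk_laurent lone_subproof.

Lemma lbounded_eq (u v : int -> F) a : lbounded u a -> lbounded v a ->
  (forall k : nat, u (a - k%:Z) = v (a - k%:Z)) -> u =1 v.
Proof.
move=> ua va uv n; have [an|na] := ltP a n; first by rewrite ua// va.
by have -> : n = a - `|a - n|%N%:Z by lia.
Qed.

Lemma ltrunc_conv u v a b k N : lbounded u a -> lbounded v b -> (k < N)%N ->
  (ltrunc (a + b) N (lconv u v))`_k = (ltrunc a N u * ltrunc b N v)`_k.
Proof. by move=> ua vb kN; rewrite coef_poly kN; exact: lconvE. Qed.

Lemma lmulC : commutative lmul.
Proof.
move=> f g; apply: laurentP => /=.
have [a fa] := laurent_bounded f; have [b gb] := laurent_bounded g.
apply: (@lbounded_eq _ _ (a + b)); first exact: lconv_out.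
  by rewrite addrC; exact: lconv_out.
move=> k; rewrite (lconvE fa gb (ltnSn k)) mulrC [a + b]addrC.
by rewrite (lconvE gb fa (ltnSn k)).
Qed.

Lemma lmulA : associative lmul.
Proof.
move=> f g h; apply: laurentP => /=.
have [a fa] := laurent_bounded f; have [b gb] := laurent_bounded g.
have [c hc] := laurent_bounded h.
have fgb := lconv_out fa gb; have ghb := lconv_out gb hc.
apply: (@lbounded_eq _ _ (a + b + c)); last 1 first.
- move=> k; rewrite (lconvE fgb hc (ltnSn k)) -(addrA a b c) (lconvE fa ghb (ltnSn k)).
  transitivity (ltrunc a k.+1 f * (ltrunc b k.+1 g * ltrunc c k.+1 h))`_k.
    rewrite !(coefM (ltrunc a _ _)); apply: eq_bigr => i _; congr (_ * _).
    by apply: ltrunc_conv => //; rewrite ltnS leq_subr.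
  rewrite mulrA !(coefM _ (ltrunc c _ _)); apply: eq_bigr => i _; congr (_ * _).
  by apply/esym/ltrunc_conv => //.
- by rewrite -addrA; exact: lconv_out.
- exact: lconv_out.
Qed.

Lemma lmul1 : left_id lone lmul.
Proof.
move=> f; apply: laurentP => /=.
have [a fa] := laurent_bounded f.
have o0 : lbounded (fun n : int => (n == 0)%:R) 0 by move=> n n0; rewrite gt_eqF.
apply: (@lbounded_eq _ _ a) => //; first by rewrite -[a]add0r; exact: lconv_out.
move=> k; rewrite -{1}[a]add0r (lconvE o0 fa (ltnSn k)).
suff -> : ltrunc 0 k.+1 (fun n : int => (n == 0)%:R : F) = 1.
  by rewrite mul1r coef_poly ltnSn.
apply/polyP => i; rewrite coef_poly coef1.
by case: i => [|i] //=; case: ifP.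
Qed.

Lemma lmulDl : left_distributive lmul +%R.
Proof.
move=> f g h; apply: laurentP => /=.
have [a' fa'] := laurent_bounded f; have [b' gb'] := laurent_bounded g.
have [c hc] := laurent_bounded h.
pose a := Num.max a' b'.
have fa : lbounded f a by apply: lboundedW fa'; rewrite le_max lexx.
have ga : lbounded g a by apply: lboundedW gb'; rewrite le_max lexx orbT.
have fga : lbounded (ladd f g) a by move=> n an /=; rewrite fa// ga// addr0.
apply: (@lbounded_eq _ _ (a + c)); first exact: lconv_out.
  by move=> n acn; rewrite !(lconv_out _ hc acn)// addr0.
move=> k; rewrite (lconvE fga hc (ltnSn k)) (lconvE fa hc (ltnSn k)).
rewrite (lconvE ga hc (ltnSn k)) -coefD -mulrDl.
suff -> : ltrunc a k.+1 (ladd f g) = ltrunc a k.+1 f + ltrunc a k.+1 g by [].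
by apply/polyP => i; rewrite coefD !coef_poly; case: ifP => //; rewrite addr0.
Qed.

Lemma lone_neq0 : lone != 0.
Proof. by apply/eqP => /(congr1 (fun f : laurent F => f 0)) /= /eqP; rewrite oner_eq0. Qed.

HB.instance Definition _ := GRing.Zmodule_isComNzRing.Build (laurent F)
  lmulA lmulC lmul1 lmulDl lone_neq0.

Definition is_ldeg f (n : int) := f n != 0 /\ lbounded f n.

Lemma is_ldeg_ex f : f != 0 -> exists n, is_ldeg f n.
Proof.
move=> f0; have [a fa] := laurent_bounded f.
have ex : exists k : nat, f (a - k%:Z) != 0.
  apply: contrapT => /forallNP nf; move/eqP: f0; apply; apply: laurentP => n /=.
  have [/fa//|na] := ltP a n.
  by have := nf `|a - n|%N; rewrite (_ : a - _ = n); [move=> /negP/negPn/eqP|lia].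
exists (a - (ex_minn ex)%:Z); case: ex_minnP => k fk kmin; split=> // n kn.
have [/fa//|na] := ltP a n; apply/eqP/negPn/negP => fn.
have := kmin `|a - n|%N; rewrite (_ : a - _ = n); last by lia.
by move=> /(_ fn); lia.
Qed.

Lemma is_ldeg_uniq f m n : is_ldeg f m -> is_ldeg f n -> m = n.
Proof.
move=> [fm um] [fn un]; case: (ltgtP m n) => // /[dup] mn.
- by move=> /um; move/eqP: fn.
- by move=> /un; move/eqP: fm.
Qed.

Lemma is_ldegM f g m n : is_ldeg f m -> is_ldeg g n -> is_ldeg (f * g) (m + n).
Proof.
move=> [fm um] [gn un]; split; last exact: lconv_out.
have := lconvE um un (ltnSn 0); rewrite subr0 => /= ->.
by rewrite coefM big_ord1 !coef_poly /= !subr0 mulf_neq0.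
Qed.

Fixpoint linv_seq (w : nat -> F) (k : nat) : seq F :=
  if k is k'.+1 then
    let s := linv_seq w k' in
    rcons s ((w 0%N)^-1 * ((k' == 0%N)%:R - \sum_(i < k') s`_i * w (k' - i)%N))
  else [::].

Lemma size_linv_seq w k : size (linv_seq w k) = k.
Proof. by elim: k => //= k IH; rewrite size_rcons IH. Qed.

Lemma nth_linv_seq w i k : (i < k)%N -> (linv_seq w k)`_i = (linv_seq w i.+1)`_i.
Proof.
elim: k => // k IH; rewrite ltnS leq_eqVlt => /predU1P[->//|ik].
by rewrite /= nth_rcons size_linv_seq ik IH.
Qed.

Lemma linv_ex f : f != 0 -> exists g, g * f = 1.
Proof.
move=> /is_ldeg_ex[d [fd ud]].
pose c (k : nat) := f (d - k%:Z).
pose u (n : int) : F := if n <= - d then (linv_seq c `|- d - n|%N.+1)`_`|- d - n|%N else 0.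
have ub : lbounded u (- d) by move=> n dn; rewrite /u leNgt dn.
have ub' : exists a, lbounded u a by exists (- d).
exists (mk_laurent ub'); apply: laurentP.
apply: (@lbounded_eq _ _ 0).
- by rewrite -(addNr d); exact: lconv_out.
- by move=> n n0; rewrite /= gt_eqF.
move=> k; have := lconvE ub ud (ltnSn k); rewrite addNr => H; apply: (etrans H).
rewrite coefM big_ord_recr /=.
rewrite !coef_poly ltnSn subnn /= subr0.
have uE (j : nat) : u (- d - j%:Z) = (linv_seq c j.+1)`_j.
  by rewrite /u ifT; [rewrite (_ : `|_|%N = j)//; lia|lia].
rewrite uE /= nth_rcons size_linv_seq ltnn eqxx /c subr0 mulrAC mulVf// mul1r.
have -> : (0 - k%:Z == 0) = (k == 0%N) by lia.
rewrite -/c addrC -addrA [X in _ + X](_ : _ = 0) ?addr0//.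
apply/eqP; rewrite addrC subr_eq0; apply/eqP/eq_bigr => i _.
have ik := ltn_ord i; rewrite !coef_poly !ifT; [|lia|lia].
by rewrite uE (nth_linv_seq _ ik).
Qed.


Definition linv f : laurent F := xget 0 [set g | g * f = 1].

Lemma lmulVf f : f != 0 -> linv f * f = 1.
Proof. by move=> /linv_ex fV; exact: (xgetPex 0 fV). Qed.

Lemma linv0 : linv 0 = 0.
Proof.
apply: xgetPN => g /= /eqP.
by rewrite mulr0 eq_sym oner_eq0.
Qed.

HB.instance Definition _ :=
  GRing.ComNzRing_isField.Build (laurent F) lmulVf linv0.

Definition ldeg f : int := xget 0 [set n | is_ldeg f n].

Lemma ldegP f : f != 0 -> is_ldeg f (ldeg f).
Proof. by move=> /is_ldeg_ex; exact: (xgetPex 0). Qed.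

Lemma ldegE f n : is_ldeg f n -> ldeg f = n.
Proof.
move=> fn; apply: (is_ldeg_uniq _ fn); apply: ldegP.
by apply: contraNneq fn.1 => ->.
Qed.

(* The absolute value only takes the values 0 and q^n, hence the codomain. *)
Definition labs f : rat := if f == 0 then 0 else #|F|%:R ^ ldeg f.

Lemma card_gt1 : 1 < #|F|%:R :> rat.
Proof. by rewrite ltr1n; exact: card_finNzRing_gt1. Qed.

Lemma card_gt0 : 0 < #|F|%:R :> rat.
Proof. exact: lt_trans card_gt1. Qed.

Lemma labs0 : labs 0 = 0. Proof. by rewrite /labs eqxx. Qed.

Lemma labs_ge0 f : 0 <= labs f.
Proof. by rewrite /labs; case: ifP => // _; rewrite exprz_ge0// ltW// card_gt0. Qed.

Lemma labs_eq0 f : (labs f == 0) = (f == 0).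
Proof.
rewrite /labs; have [_|f0] := eqVneq f 0; first by rewrite eqxx.
by apply/negbTE/expfz_neq0; rewrite gt_eqF ?card_gt0.
Qed.

Lemma labsM f g : labs (f * g) = labs f * labs g.
Proof.
rewrite /labs mulf_eq0; have [_|f0] := eqVneq f 0; first by rewrite mul0r.
have [_|g0] := eqVneq g 0; first by rewrite mulr0.
rewrite (ldegE (is_ldegM (ldegP f0) (ldegP g0))) /= expfzDr//.
by rewrite gt_eqF ?card_gt0.
Qed.

Lemma labsN f : labs (- f) = labs f.
Proof.
rewrite /labs oppr_eq0; case: eqVneq => // f0; congr (_ ^ _).
have [fn uf] := ldegP f0; apply: ldegE; split; first by rewrite oppr_eq0.
by move=> n nf /=; rewrite uf// oppr0.
Qed.

Lemma labs_le f n : (labs f <= #|F|%:R ^ n) <-> lbounded f n.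
Proof.
rewrite /labs; have [->|f0] := eqVneq f 0.
  by split=> // _; rewrite exprz_ge0// ltW// card_gt0.
have [fn uf] := ldegP f0; rewrite ler_eXz2l ?card_gt1//; split=> [fn'|un].
  exact: lboundedW uf.
by rewrite leNgt; apply/negP => /un; move/eqP: fn.
Qed.

Lemma labs_ultra f g : labs (f + g) <= Num.max (labs f) (labs g).
Proof.
wlog fg : f g / labs f <= labs g => [H|].
  by case/orP: (le_total (labs f) (labs g)) => /H//; rewrite maxC addrC.
rewrite (max_r fg); have [g0|g0] := eqVneq g 0.
  by move: fg; rewrite g0 labs0 addr0.
have gE : labs g = #|F|%:R ^ ldeg g by rewrite /labs (negbTE g0).
have gn : lbounded g (ldeg g) by apply/labs_le; rewrite gE.
have fn : lbounded f (ldeg g) by apply/labs_le; rewrite -gE.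
by rewrite gE; apply/labs_le => n ng /=; rewrite fn// gn// addr0.
Qed.

Definition ldist f g := labs (f - g).

Lemma ldistxx f : ldist f f = 0. Proof. by rewrite /ldist subrr labs0. Qed.

Lemma ldist_eq0 f g : ldist f g = 0 -> f = g.
Proof. by move/eqP; rewrite labs_eq0 subr_eq0 => /eqP. Qed.

Lemma ldistC f g : ldist f g = ldist g f.
Proof. by rewrite /ldist -labsN opprB. Qed.

Lemma ldist_triangle g f h : ldist f h <= ldist f g + ldist g h.
Proof.
rewrite /ldist -(subrKA g); apply: le_trans (labs_ultra _ _) _.
by rewrite ge_max lerDl lerDr !labs_ge0.
Qed.

HB.instance Definition _ := isPointed.Build (laurent F) 0.
HB.instance Definition _ :=
  isMetric.Build rat (laurent F) ldistxx ldist_eq0 ldistC ldist_triangle.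

Definition laurent_integers : set (laurent F) := [set f | labs f <= 1].

Lemma lpoly_subproof (p : {poly F}) :
  exists a, lbounded (fun n => if n is Posz k then p`_k else 0) a.
Proof.
by exists (size p)%:Z => -[k|k] // pk; rewrite nth_default// ltnW.
Qed.

Definition lpoly (p : {poly F}) := mk_laurent (lpoly_subproof p).

Lemma labs_poly p : p != 0 -> labs (lpoly p) = #|F|%:R ^+ (size p).-1.
Proof.
move=> p0; have pd : is_ldeg (lpoly p) (size p).-1.
  split=> [|[k|k] pk] //=; first by rewrite -lead_coefE lead_coef_eq0.
  by rewrite nth_default// (polySpred p0).
rewrite /labs (ldegE pd) ifF//; apply: contraNF pd.1 => /eqP ->.
by [].
Qed.

End LaurentField.
Arguments laurent_integers F : clear implicits.

Definition laurent_bounded_set (F : finFieldType) (I : set (laurent F)) :=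
  exists M : rat, forall x, I x -> labs x <= M.

Section VectorsAndForms.
Variables (F : finFieldType) (n : nat).
Local Notation K := (laurent F).
Implicit Types (Q : 'cV[K]_n -> K) (v : 'cV[K]_n).

Definition vnorm v : rat := \big[Num.max/0]_(i < n) labs (v i ord0).

(* No division by 2: [polar_form Q u v] is twice the usual bilinear form. *)
Definition polar_form Q u v := Q (u + v) - Q u - Q v.

Definition quadratic_form Q :=
  (forall a v, Q (a *: v) = a ^+ 2 * Q v) /\ (forall u, scalar (polar_form Q u)).

Definition qf_nondegenerate Q :=
  forall u, (forall v, polar_form Q u v = 0) -> u = 0.

Definition qf_isotropic Q := exists2 v, v != 0 & Q v = 0.

Definition lattice_points Q (I : set K) (t : nat) : set 'cV[{poly F}]_n :=
  [set v | let w := map_mx (@lpoly F) v in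
    I (Q w) /\ vnorm w <= #|F|%:R ^+ t].

Lemma finite_lattice_points Q I t : finite_set (lattice_points Q I t).
Proof.
pose e (A : 'M[F]_(n, t.+1)) : 'cV[{poly F}]_n :=
  \col_i \poly_(j < t.+1) A i (inord j).
apply: (@sub_finite_set _ _ (e @` [set: 'M[F]_(n, t.+1)])); last first.
  exact/finite_image/finite_finset.
move=> v [_ vt]; exists (\matrix_(i, j) (v i ord0)`_j) => //.
apply/matrixP => i j; rewrite !ord1 mxE; apply/polyP => k; rewrite coef_poly.
case: ltnP => kt; first by rewrite mxE inordK.
have : labs (lpoly (v i ord0)) <= #|F|%:R ^ t%:Z.
  apply: le_trans vt; rewrite /vnorm (bigD1 i)//= le_max.
  by rewrite mxE lexx.
by move/labs_le => /(_ k%:Z); rewrite /= ltz_nat => /(_ kt).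
Qed.

End VectorsAndForms.

Definition borel (T : ptopologicalType) := g_sigma_algebraType (@open T).

(* Left Haar measures on a group with product [op].  The groups below are
   locally compact and second countable, so that finiteness on compact sets
   implies regularity. *)
Definition haar_measure (R : realType) (T : ptopologicalType) (op : T -> T -> T)
    (mu : {measure set (borel T) -> \bar R}) :=
  [/\ forall (x : T) (A : set (borel T)), measurable A -> mu (op x @` A) = mu A,
      forall A : set T, compact A -> (mu A < +oo)%E
    & mu setT != 0%E].
Arguments haar_measure {R} T op mu.

Section UnimodularGroup.
Variables (F : finFieldType) (n : nat).
Local Notation K := (laurent F).

Definition absdet1 : set 'M[K]_n := [set A | labs (\det A) = 1].

Definition absdet1_group : Type := set_type absdet1.

HB.instance Definition _ := Topological.on absdet1_group.

Lemma absdet1_one_subproof : (1%:M : 'M[K]_n) \in absdet1.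
Proof.
apply/mem_set; rewrite /absdet1 /= det1 /labs oner_eq0 (@ldegE _ _ 0)//; split; last first.
  by move=> m m0; rewrite /= gt_eqF.
exact: oner_neq0.
Qed.
Definition absdet1_one : absdet1_group := @exist 'M[K]_n (fun A => A \in absdet1) _ absdet1_one_subproof.

Lemma absdet1_mul_subproof (g h : absdet1_group) :
  (val g *m val h) \in absdet1.
Proof.
by apply/mem_set; rewrite /absdet1 /= det_mulmx labsM (set_mem (valP g)) (set_mem (valP h)) mulr1.
Qed.
Definition absdet1_mul (g h : absdet1_group) : absdet1_group := @exist 'M[K]_n (fun A => A \in absdet1) _ (absdet1_mul_subproof g h).

HB.instance Definition _ := isPointed.Build absdet1_group absdet1_one.

End UnimodularGroup.

(* Main.v *)
Require Import Defs.
From mathcomp Require Import all_boot all_order all_algebra finmap fingroup perm.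
From mathcomp Require Import all_classical all_reals all_analysis measurable_realfun.
From mathcomp Require Import ring lra zify.
Import Order.TTheory GRing.Theory Num.Theory.
Import numFieldNormedType.Exports.
Local Open Scope classical_set_scope.
Local Open Scope ring_scope.

Set Implicit Arguments.
Unset Strict Implicit.
Unset Printing Implicit Defensive.

(** Every g in G lies in a coset g0 (1 + E), with g0 from a countable set and E an
    n x n matrix over the maximal ideal m of O_oo, and u = 1 + E acts isometrically
    on K_oo^n.  So it is enough to fix Q and to study, for E distributed according
    to the additive Haar measure, the number N_k of polynomial vectors v of norm q^k
    with Q(uv) in I.  If I is a finite union of balls, all averages over E are finite
    averages.  Translating E by a matrix of small rank moves uv by an arbitrary
    vector of m^n; hence the mean of N_k is the volume of the set of z of norm q^k
    with Q(z) in I (normalised so that m^n has volume 1).  By a change of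
    variable on lines along which Q has a large derivative, this volume is exactly
    c q^((n-2)k) m(I) for large k.

    The same argument applied to pairs (uv, uw) shows that their contribution to the
    variance is at most that of independent vectors, unless the component e of w
    orthogonal to v satisfies |e| < 1.  For such a bad pair with |e| = q^-j the
    probability that Q(uv) and Q(uw) are bounded is O(q^(j-3k)), and a count of
    2 x 2 matrices over F_q[x] with small determinant shows that there are
    O(k q^(nk+k-j)) bad pairs with |e| <= q^-j.  Thus N_k has variance
    O(k^2 q^((n-2)k)), and Chebyshev's inequality and the Borel-Cantelli lemma
    conclude.  A general I is first replaced, for each k, by a finite union of balls
    up to an open set of measure at most q^(-nk). *)

(** * Ultrametric balls and truncations *)

Section LaurentBalls.
Variable F : finFieldType.
Local Notation K := (laurent F).
Implicit Types (f g : K) (a b r s : int).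

(** The threshold |e| < 1 comes from the unit cells: translating E moves ue by all vectors of norm
    below |e|, and decorrelating uv and uw requires covering m^n. For a bad pair, w = th v + e with
    |th| = 1 (or e = 0), so bounds on Q(uv) and Q(uw) together bound the polar form of uv and ue.
    This second condition is linear in ue and has probability O(q^(j-k)), next to O(q^(-2k)) for the
    first.

    Spheres are used instead of balls because there the gradient of Q has size comparable to q^k
    everywhere. Summing over the spheres afterwards produces the factor a / (a - 1) with a =
    q^(n-2).

    Averages are taken at a finite resolution N, chosen after k and the approximating set; hence all
    bounds are uniform in N. The approximating sets change with k, so the thresholds on k must not
    depend on them either.

    The condition delta > 1/2 makes k^2 q^((n-2)k) / q^(2 delta (n-2)k) summable. The precision
    q^(-nk) is chosen because an open set of measure eps receives on average about q^((n-2)k) eps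
    values of Q on the sphere. *)

Lemma lboundedD f g r : lbounded f r -> lbounded g r -> lbounded (f + g) r.
Proof. by move=> fr gr n rn; rewrite /= fr// gr// addr0. Qed.

Lemma lboundedN f r : lbounded f r -> lbounded (- f) r.
Proof. by move=> fr n rn; rewrite /= fr// oppr0. Qed.

Lemma lboundedB f g r : lbounded f r -> lbounded g r -> lbounded (f - g) r.
Proof. by move=> fr gr; apply: lboundedD => //; exact: lboundedN. Qed.

Lemma lboundedM f g a b : lbounded f a -> lbounded g b -> lbounded (f * g) (a + b).
Proof. exact: lconv_out. Qed.

Lemma lbounded_sum (I : Type) (s : seq I) (P : pred I) (f : I -> K) r :
  (forall i, P i -> lbounded (f i) r) -> lbounded (\sum_(i <- s | P i) f i) r.
Proof.
move=> fr; apply: (big_ind (fun f : K => lbounded f r)) => //.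
- by move=> ? ?; exact: lboundedD.
Qed.

Lemma is_ldeg_neq0 f a : is_ldeg f a -> f != 0.
Proof. by move=> [+ _]; apply: contraNneq => ->. Qed.

Lemma is_ldeg1 : is_ldeg (1 : K) 0.
Proof. by split=> [|n n0] /=; [rewrite oner_neq0|rewrite gt_eqF]. Qed.

Lemma is_ldegV f a : is_ldeg f a -> is_ldeg f^-1 (- a).
Proof.
move=> fa; have f0 := is_ldeg_neq0 fa.
have fV := ldegP (invr_neq0 f0).
have := is_ldegM fV fa; rewrite mulVf// => /is_ldeg_uniq /(_ is_ldeg1) H.
by rewrite (_ : - a = ldeg f^-1)//; lia.
Qed.

Lemma lbounded_div f g a b : lbounded f a -> is_ldeg g b -> lbounded (f / g) (a - b).
Proof. by move=> fa gb; apply: lboundedM => //; exact: (is_ldegV gb).2. Qed.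

Lemma is_ldegD f g a : is_ldeg f a -> lbounded g (a - 1) -> is_ldeg (f + g) a.
Proof.
move=> [fa uf] gb; split; first by rewrite /= (gb a) ?addr0//; lia.
by apply: lboundedD => //; apply: lboundedW gb; lia.
Qed.

Lemma lbounded_lead f a : lbounded f a -> f a = 0 -> lbounded f (a - 1).
Proof.
move=> fa f0 n an; have [->//|na] := eqVneq n a.
by apply: fa; lia.
Qed.

Lemma lbounded_ldeg f a b : is_ldeg f a -> lbounded f b -> a <= b.
Proof. by move=> [fa _] fb; rewrite leNgt; apply/negP => /fb; apply/eqP. Qed.

Lemma lboundedMK f g a b : is_ldeg f a -> lbounded (f * g) (a + b) -> lbounded g b.
Proof.
move=> fa fg; have := lbounded_div fg fa.
by rewrite mulrAC mulfV ?mul1r ?(is_ldeg_neq0 fa)// addrAC subrr add0r.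
Qed.

Lemma ldeg_le_ex f : exists c : nat, lbounded f c%:Z.
Proof.
by have [a fa] := laurent_bounded f; exists `|a|%N; apply: lboundedW fa; lia.
Qed.

Section Matrices.
Variables m p : nat.
Implicit Types A B : 'M[K]_(m, p).

Definition mball r A := forall i j, lbounded (A i j) r.

Lemma mball0 r : mball r 0.
Proof. by move=> i j; rewrite mxE. Qed.

Lemma mballD r A B : mball r A -> mball r B -> mball r (A + B).
Proof. by move=> Ar Br i j; rewrite mxE; apply: lboundedD. Qed.

Lemma mballN r A : mball r A -> mball r (- A).
Proof. by move=> Ar i j; rewrite mxE; apply: lboundedN. Qed.

Lemma mballB r A B : mball r A -> mball r B -> mball r (A - B).
Proof. by move=> Ar Br; apply: mballD => //; exact: mballN. Qed.

Lemma mballW r s A : r <= s -> mball r A -> mball s A.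
Proof. by move=> rs Ar i j; exact: lboundedW rs (Ar i j). Qed.

Lemma mballZ r s (c : K) A : lbounded c r -> mball s A -> mball (r + s) (c *: A).
Proof. by move=> cr As i j; rewrite mxE; exact: lboundedM. Qed.

Lemma mball_ex A : exists c : nat, mball c%:Z A.
Proof.
have /choice[c cA] : forall ij : 'I_m * 'I_p, exists c : nat, lbounded (A ij.1 ij.2) c%:Z.
  by move=> ij; exact: ldeg_le_ex.
exists (\max_(ij : _) c ij)%N => i j; apply: lboundedW (cA (i, j)).
by rewrite lez_nat; exact: (leq_bigmax (i, j)).
Qed.

Lemma mballBC r A B : mball r (A - B) -> mball r (B - A).
Proof. by move=> /mballN; rewrite opprB. Qed.

Lemma mball_trans r A B C : mball r (A - B) -> mball r (B - C) -> mball r (A - C).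
Proof. by move=> AB BC; rewrite -(subrKA B); exact: mballD. Qed.

End Matrices.

Lemma mballM m p q (A : 'M[K]_(m, p)) (B : 'M[K]_(p, q)) r s :
  mball r A -> mball s B -> mball (r + s) (A *m B).
Proof.
move=> Ar Bs i j; rewrite mxE; apply: lbounded_sum => l _.
exact: lboundedM.
Qed.

Lemma mball_delta m p i j (c : K) r : lbounded c r ->
  mball r (c *: delta_mx i j : 'M[K]_(m, p)).
Proof.
move=> cr i' j'; rewrite !mxE; case: (_ && _); rewrite ?mulr1 ?mulr0//.
Qed.

(** Descent on the degree of [A]: since [A] is [(A + E *m A) - E *m A] and [E] has degree at most
    -1, any bound above [r] improves by one. *)
Lemma mball_isometry n p (E : 'M[K]_n) (A : 'M[K]_(n, p)) r :
  mball (-1) E -> mball r (A + E *m A) -> mball r A.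
Proof.
move=> E1 EA; have [c Ac] := mball_ex A.
pose d := `|c%:Z - r|%N.
have : mball (r + d%:Z) A by apply: mballW Ac; lia.
elim: d => [|d IH] Ad; first by rewrite addr0 in Ad.
apply: IH; rewrite -[A](addrK (E *m A)); apply: mballB.
  by apply: mballW EA; lia.
by apply: mballW (mballM E1 Ad); lia.
Qed.

Lemma mball_1E n p (E : 'M[K]_n) (A : 'M[K]_(n, p)) r :
  mball (-1) E -> mball r A -> mball r (A + E *m A).
Proof.
move=> E1 Ar; apply: mballD => //; apply: mballW (mballM E1 Ar); lia.
Qed.

Section Truncation.
Variable N : nat.

(* The partial sums over exponents in (r - N, r]. *)
Lemma lpart_subproof r (c : 'rV[F]_N) :
  exists a, lbounded (fun n => lpoly (rVpoly c) (n + (N%:Z - r - 1))) a.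
Proof.
have [a ha] := laurent_bounded (lpoly (rVpoly c)).
by exists (a - (N%:Z - r - 1)) => n an; apply: ha; lia.
Qed.

Definition lpart r (c : 'rV[F]_N) : K := mk_laurent (lpart_subproof r c).

Definition ltail r f : 'rV[F]_N := \row_l f (r - N%:Z + 1 + l%:Z).

Lemma lpart_coef r c (l : 'I_N) : lpart r c (r - N%:Z + 1 + l%:Z) = c 0 l.
Proof.
rewrite /= (_ : _ + _ = l%:Z); last by lia.
by rewrite coef_rVpoly_ord.
Qed.

Lemma lpart_bounded r c : lbounded (lpart r c) r.
Proof.
move=> n rn /=; case E: (_ + _) => [l|l] //.
by rewrite nth_default// (leq_trans (size_poly _ _))//; lia.
Qed.

Lemma lpartK r : cancel (lpart r) (ltail r).
Proof. by move=> c; apply/rowP => l; rewrite mxE lpart_coef. Qed.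

Lemma ltailK r f : lbounded f r -> lbounded (f - lpart r (ltail r f)) (r - N%:Z).
Proof.
move=> fr.
suff H (n : int) : r - N%:Z < n -> f n - lpart r (ltail r f) n = 0 by exact: H.
move=> rn.
have [nr|nr] := ltP r n; first by rewrite fr// (lpart_bounded (ltail r f))// subrr.
pose l : nat := absz (n - (r - N%:Z + 1))%R.
have l1 : (l < N)%N by rewrite /l; lia.
have nE : r - N%:Z + 1 + (Ordinal l1)%:Z = n :> int by rewrite /= /l; lia.
by rewrite -nE lpart_coef mxE subrr.
Qed.

Lemma ltail_eq r f g : lbounded (f - g) (r - N%:Z) -> ltail r f = ltail r g.
Proof.
move=> fg; apply/rowP => l; rewrite !mxE; apply/eqP; rewrite -subr_eq0.
by apply/eqP/fg; lia.
Qed.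

Lemma ltail_inj r f g : lbounded f r -> lbounded g r -> ltail r f = ltail r g ->
  lbounded (f - g) (r - N%:Z).
Proof.
move=> fr gr fg; rewrite -(subrKA (lpart r (ltail r f))) {2}fg.
apply: lboundedD; first exact: ltailK.
by rewrite -opprB; apply: lboundedN; exact: ltailK.
Qed.

Section MatrixTruncation.
Variables m p : nat.
Implicit Types (A B : 'M[K]_(m, p)) (x : 'M['rV[F]_N]_(m, p)).

Definition mpart r x : 'M[K]_(m, p) := map_mx (lpart r) x.
Definition mtail r A : 'M['rV[F]_N]_(m, p) := map_mx (ltail r) A.

Lemma mpartK r : cancel (mpart r) (mtail r).
Proof. by move=> x; apply/matrixP => i j; rewrite !mxE lpartK. Qed.

Lemma mpart_ball r x : mball r (mpart r x).
Proof. by move=> i j; rewrite mxE; exact: lpart_bounded. Qed.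

Lemma mtailK r A : mball r A -> mball (r - N%:Z) (A - mpart r (mtail r A)).
Proof. by move=> Ar i j; rewrite !mxE; exact: ltailK. Qed.

Lemma mtail_eq r A B : mball (r - N%:Z) (A - B) -> mtail r A = mtail r B.
Proof.
move=> AB; apply/matrixP => i j; rewrite !mxE; apply: ltail_eq.
by have := AB i j; rewrite !mxE.
Qed.

Lemma mtail_inj r A B : mball r A -> mball r B -> mtail r A = mtail r B ->
  mball (r - N%:Z) (A - B).
Proof.
move=> Ar Br /matrixP AB i j; rewrite !mxE; apply: ltail_inj => //.
by have := AB i j; rewrite !mxE.
Qed.

End MatrixTruncation.
End Truncation.
End LaurentBalls.
Arguments mball {F m p}.

(** * Averages over balls *)

Section Averages.
Variables (R : realType) (F : finFieldType).
Local Notation K := (laurent F).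
Local Notation q := (#|F|%:R : R).

Lemma q_gt1 : 1 < q.
Proof. by rewrite ltr1n; exact: card_finNzRing_gt1. Qed.

Lemma q_gt0 : 0 < q.
Proof. exact: lt_trans q_gt1. Qed.

Lemma q_neq0 : q != 0.
Proof. by rewrite gt_eqF// q_gt0. Qed.

Lemma card_mx_rV m p N : #|{: 'M['rV[F]_N]_(m, p)}|%:R = q ^+ (N * (m * p)).
Proof. by rewrite !card_mx mul1n -expnM natrX. Qed.

Section AverageTheory.
Variables m p N : nat.
Implicit Types (phi psi : 'M[K]_(m, p) -> R) (A B D : 'M[K]_(m, p)) (r s : int).

(* The average of phi over the ball of degree r, computed at the resolution
   r - N; it is meaningful when phi is invariant under the ball of degree r - N. *)
Definition avg r phi : R :=
  (\sum_(x : 'M['rV[F]_N]_(m, p)) phi (mpart r x)) / q ^+ (N * (m * p)).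

(** Invariance is asked only at points of the ball of degree [r]: quadratic forms are uniformly
    continuous on bounded sets only. *)
Definition ball_invariant (s r : int) (T : Type) (phi : 'M[K]_(m, p) -> T) :=
  forall A D, mball r A -> mball s D -> phi (A + D) = phi A.

Lemma qX_gt0 n : 0 < q ^+ n.
Proof. by rewrite exprn_gt0// q_gt0. Qed.

Lemma qX_neq0 n : q ^+ n != 0.
Proof. by rewrite gt_eqF// qX_gt0. Qed.

Lemma eq_avg r phi psi : (forall A, mball r A -> phi A = psi A) ->
  avg r phi = avg r psi.
Proof.
move=> e; congr (_ / _); apply: eq_bigr => x _; apply: e; exact: mpart_ball.
Qed.

Lemma avg_cst r (c : R) : avg r (fun=> c) = c.
Proof.
rewrite /avg sumr_const -(mulr_natr c).
by rewrite [X in _ * X / _](card_mx_rV m p N) mulfK ?qX_neq0.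
Qed.

Lemma le_avg r phi psi : (forall A, mball r A -> phi A <= psi A) ->
  avg r phi <= avg r psi.
Proof.
move=> e; rewrite ler_pM2r ?invr_gt0 ?qX_gt0//; apply: ler_sum => x _.
by apply: e; exact: mpart_ball.
Qed.

Lemma avg_ge0 r phi : (forall A, mball r A -> 0 <= phi A) -> 0 <= avg r phi.
Proof. by move=> e; rewrite -(avg_cst r 0); exact: le_avg. Qed.

Lemma avg_sum (I : Type) (s : seq I) (P : pred I) r (phi : I -> 'M[K]_(m, p) -> R) :
  avg r (fun A => \sum_(i <- s | P i) phi i A) = \sum_(i <- s | P i) avg r (phi i).
Proof. by rewrite /avg exchange_big mulr_suml. Qed.

Lemma avgD r phi psi : avg r (fun A => phi A + psi A) = avg r phi + avg r psi.
Proof. by rewrite /avg big_split mulrDl. Qed.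

Lemma avgB r phi psi : avg r (fun A => phi A - psi A) = avg r phi - avg r psi.
Proof. by rewrite /avg sumrB mulrBl. Qed.

Lemma avgZl r c phi : avg r (fun A => c * phi A) = c * avg r phi.
Proof. by rewrite /avg -mulr_sumr mulrA. Qed.

Lemma avgZr r c phi : avg r (fun A => phi A * c) = avg r phi * c.
Proof. by rewrite /avg -mulr_suml mulrAC. Qed.

(** By the second hypothesis [h] sends distinct cells of the finest resolution to distinct cells.
    Both balls have the same number of cells, so [h] induces a bijection between them, even when it
    rescales from degree [r] to degree [s]. *)
Lemma avg_isometry r s phi (h : 'M[K]_(m, p) -> 'M[K]_(m, p)) :
  (forall A, mball r A -> mball s (h A)) ->
  (forall A B, mball r A -> mball r B -> mball (s - N%:Z) (h A - h B) ->
     mball (r - N%:Z) (A - B)) ->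
  ball_invariant (s - N%:Z) s phi ->
  avg r (fun A => phi (h A)) = avg s phi.
Proof.
move=> hs hi phis; congr (_ / _).
pose sg (x : 'M['rV[F]_N]_(m, p)) := mtail N s (h (mpart r x)).
have sgi : injective sg.
  move=> x y xy; rewrite -(mpartK r x) -(mpartK r y); apply: mtail_eq.
  by apply: hi; do ?exact: mpart_ball; apply: mtail_inj xy; apply/hs/mpart_ball.
rewrite [RHS](reindex_inj sgi); apply: eq_bigr => x _ /=.
rewrite -[in LHS](subrK (mpart s (sg x)) (h _)) addrC.
by rewrite phis//; [exact: mpart_ball|apply/mtailK/hs/mpart_ball].
Qed.

Lemma avg_translate r phi D : mball r D -> ball_invariant (r - N%:Z) r phi ->
  avg r (fun A => phi (A + D)) = avg r phi.
Proof.
move=> Dr phir; apply: avg_isometry => // [A Ar|A B _ _].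
  exact: mballD.
by rewrite opprD addrACA subrr addr0.
Qed.

Lemma ball_invariantW s s' r r' (T : Type) (phi : 'M[K]_(m, p) -> T) :
  s' <= s -> r' <= r -> ball_invariant s r phi -> ball_invariant s' r' phi.
Proof.
by move=> ss rr phir A D Ar Ds; apply: phir; [exact: mballW Ar|exact: mballW Ds].
Qed.

End AverageTheory.

Lemma avg_exchange m p m' p' N N' r r' (phi : 'M[K]_(m, p) -> 'M[K]_(m', p') -> R) :
  avg N r (fun A => avg N' r' (phi A)) = avg N' r' (fun B => avg N r (phi^~ B)).
Proof.
rewrite /avg -!mulr_suml exchange_big /= mulrAC; congr (_ / _).
Qed.

(** For [s < r], two elements of [S] agree in all digits above [x^s], so the [N - d] lower digits
    determine an element; dividing by the [q ^ N] cells gives the bound. *)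
Lemma avg_diam N (r s : int) (S : pred K) : r - N%:Z <= s ->
  (forall f g : K, lbounded f r -> lbounded g r -> S f -> S g -> lbounded (f - g) s) ->
  avg N r (fun A : 'M[K]_1 => (S (A 0 0))%:R) <= q ^ (s - r).
Proof.
move=> rNs Sd; have [rs|sr] := leP r s.
  apply: (@le_trans _ _ 1); last by rewrite -(expr0z q) ler_eXz2l ?q_gt1//; lia.
  by rewrite -[leRHS](avg_cst 1 1 N r); apply: le_avg => A _; case: (S _).
pose d := absz (r - s)%R.
have dN : (d <= N)%N by rewrite /d; lia.
rewrite /avg ler_pdivrMr ?qX_gt0// mul1n muln1.
have -> : q ^ (s - r) * q ^+ N = q ^+ (N - d).
  by rewrite !exprnP -expfzDr ?q_neq0//; congr (_ ^ _); rewrite /d; lia.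
pose T := [set x : 'M['rV[F]_N]_1 | S (mpart r x 0 0)]%SET.
have -> : \sum_(x : 'M['rV[F]_N]_1) (S (mpart r x 0 0))%:R = #|T|%:R :> R.
  rewrite -natr_sum -sum1_card [in RHS]big_mkcond; congr (_%:R).
  by apply: eq_bigr => x _; rewrite inE; case: (S _).
pose h (x : 'M['rV[F]_N]_1) : 'rV[F]_(N - d) :=
  \row_l x 0 0 0 (widen_ord (leq_subr d N) l).
have hi : {in T &, injective h}.
  move=> x y; rewrite !inE => Sx Sy /rowP hxy.
  have xys := Sd _ _ (mpart_ball x 0 0) (mpart_ball y 0 0) Sx Sy.
  apply/matrixP => i j; rewrite !ord1; apply/rowP => l.
  have [lNd|Ndl] := ltnP l (N - d)%N.
    have := hxy (Ordinal lNd); rewrite !mxE.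
    by rewrite (_ : widen_ord _ _ = l)//; exact: val_inj.
  have := xys (r - N%:Z + 1 + l%:Z); rewrite !mxE => H.
  rewrite -(lpart_coef r (x 0 0)) -(lpart_coef r (y 0 0)).
  by apply/eqP; rewrite -subr_eq0; apply/eqP/H; rewrite /d; lia.
rewrite -natrX ler_nat -(card_in_imset hi) (leq_trans (max_card _))//.
by rewrite card_mx mul1n.
Qed.

End Averages.

(** * Quadratic forms *)

Section QuadraticForms.
Variables (F : finFieldType) (n : nat).
Local Notation K := (laurent F).
Variable Q : 'cV[K]_n -> K.
Hypothesis Qf : quadratic_form Q.
Local Notation B := (polar_form Q).
Local Notation e i := (delta_mx i 0 : 'cV[K]_n).
Implicit Types u v w : 'cV[K]_n.

Lemma qfD u v : Q (u + v) = Q u + Q v + B u v.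
Proof. by rewrite /polar_form; ring. Qed.

Lemma qfZ a v : Q (a *: v) = a ^+ 2 * Q v.
Proof. exact: Qf.1. Qed.

Lemma polarC u v : B u v = B v u.
Proof. by rewrite /polar_form (addrC v u); ring. Qed.

Lemma polar0r u : B u 0 = 0.
Proof.
have := Qf.2 u 1 0 0; rewrite scaler0 addr0 mul1r => /eqP.
by rewrite -subr_eq0 opprD addrA subrr add0r oppr_eq0 => /eqP.
Qed.

Lemma polarDr u v w : B u (v + w) = B u v + B u w.
Proof. by have := Qf.2 u 1 v w; rewrite scale1r mul1r. Qed.

Lemma polarZr u a v : B u (a *: v) = a * B u v.
Proof. by have := Qf.2 u a v 0; rewrite !addr0 polar0r addr0. Qed.

Lemma polarDl u v w : B (v + w) u = B v u + B w u.
Proof. by rewrite !(polarC _ u) polarDr. Qed.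

Lemma polarZl u a v : B (a *: v) u = a * B v u.
Proof. by rewrite !(polarC _ u) polarZr. Qed.

Lemma polar_sumr u (I : Type) (s : seq I) (f : I -> 'cV[K]_n) :
  B u (\sum_(i <- s) f i) = \sum_(i <- s) B u (f i).
Proof.
by elim: s => [|i s IH]; rewrite ?big_nil ?polar0r// !big_cons polarDr IH.
Qed.

Lemma col_delta_sum v : v = \sum_i v i 0 *: e i.
Proof.
rewrite {1}[v]matrix_sum_delta; apply: eq_bigr => i _.
by rewrite big_ord1.
Qed.

Lemma polar_delta u v : B u v = \sum_i v i 0 * B u (e i).
Proof.
rewrite {1}(col_delta_sum v) polar_sumr; apply: eq_bigr => i _.
exact: polarZr.
Qed.

Lemma qf_bounded : exists c : nat,
  (forall k v, mball k v -> lbounded (Q v) (k + k + c%:Z)) /\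
  (forall k l u v, mball k u -> mball l v -> lbounded (B u v) (k + l + c%:Z)).
Proof.
pose G : 'M[K]_n := \matrix_(i, j) B (e i) (e j).
pose D : 'cV[K]_n := \col_i Q (e i).
have [c1 Gc] := mball_ex G; have [c2 Dc] := mball_ex D.
have Bb k l u v : mball k u -> mball l v -> lbounded (B u v) (k + l + (c1 + c2)%:Z).
  move=> uk vl; rewrite polar_delta; apply: lbounded_sum => j _.
  rewrite polarC polar_delta mulr_sumr; apply: lbounded_sum => i _.
  have := Gc j i; rewrite mxE => Gij.
  by apply: lboundedW (lboundedM (vl j 0) (lboundedM (uk i 0) Gij)); lia.
exists (c1 + c2)%N; split=> // k v vk.
rewrite (col_delta_sum v).
pose P (w : 'cV[K]_n) := mball k w /\ lbounded (Q w) (k + k + (c1 + c2)%:Z).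
suff [] : P (\sum_i v i 0 *: e i) by [].
apply: (big_ind P) => [|u w [u1 u2] [w1 w2]|i _]; split.
- exact: mball0.
- by rewrite -[0](scale0r 0) qfZ expr0n mul0r.
- exact: mballD.
- rewrite qfD; apply: lboundedD; first exact: lboundedD.
  exact: Bb.
- exact: mball_delta.
- have := Dc i 0; rewrite mxE qfZ expr2 => Di.
  by apply: lboundedW (lboundedM (lboundedM (vk i 0) (vk i 0)) Di); lia.
Qed.

Definition mdeg k v := mball k v /\ exists i, v i 0 k != 0.

(** Nondegeneracy makes the Gram matrix invertible, and [c] bounds the degrees of the entries of its
    inverse: if every [B v (e i)] were smaller, [v] itself would have degree below [k]. *)
Lemma qf_lower : qf_nondegenerate Q -> exists c : nat, forall k v, mdeg k v ->
  exists i, exists2 d, k - c%:Z <= d & is_ldeg (B v (e i)) d.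
Proof.
move=> Qn; pose G : 'M[K]_n := \matrix_(i, j) B (e j) (e i).
have GE v i : (G *m v) i 0 = B v (e i).
  rewrite mxE polarC polar_delta; apply: eq_bigr => j _.
  by rewrite !mxE mulrC polarC.
have Gu : G \in unitmx.
  rewrite -unitmx_tr -row_free_unit -kermx_eq0; apply/eqP.
  apply/row_matrixP => i; rewrite row0; set x := row i _.
  have xG : x *m G^T = 0 by rewrite /x -row_mul mulmx_ker row0.
  suff : x^T = 0 by move/(congr1 trmx); rewrite trmxK trmx0.
  apply: Qn => v; rewrite polar_delta big1// => j _.
  by rewrite -GE -[G]trmxK -trmx_mul xG !mxE mulr0.
have [c Gc] := mball_ex (invmx G); exists c => k v [vk [i0 vi0]].
have [H|/existsNP[i Hi]] := pselect (forall i, lbounded (B v (e i)) (k - c%:Z - 1)).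
  have : mball (k - 1) v.
    rewrite -(mulKmx Gu v).
    have Gv : mball (k - c%:Z - 1) (G *m v) by move=> i j; rewrite ord1 GE.
    by apply: mballW (mballM Gc Gv); lia.
  by move=> /(_ i0 0 k); move/eqP: vi0 => /[swap] ->//; lia.
have B0 : B v (e i) != 0 by apply/eqP => B0; apply: Hi; rewrite B0.
have [B1 B2] := ldegP B0.
exists i; exists (ldeg (B v (e i))); last exact: ldegP.
rewrite leNgt; apply/negP => dk; apply: Hi; apply: lboundedW B2; lia.
Qed.

End QuadraticForms.

(** * Topology and Haar measure of the local field *)

Section LaurentTopology.
Variable F : finFieldType.
Local Notation K := (laurent F).

Lemma nbhs_lbounded (x : K) (U : set K) :
  nbhs x U <-> exists L : int, forall y : K, lbounded (y - x) L -> U y.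
Proof.
split=> [/nbhs_ballP[e /= e0 eU]|[L LU]].
  pose N := Num.bound e^-1; exists (- N%:Z) => y yx; apply: eU.
  rewrite /ball /= -/(ldist x y) ldistC /ldist.
  apply: (@le_lt_trans _ _ (#|F|%:R ^ (- N%:Z))); first exact/labs_le.
  rewrite -invr_expz invf_plt ?posrE ?exprz_gt0 ?Defs.card_gt0 //.
  apply: (@lt_le_trans _ _ N%:R).
    by apply: archi_boundP; rewrite invr_ge0 ltW.
  by rewrite -exprnP -natrX ler_nat ltnW// ltn_expl// card_finNzRing_gt1.
apply/nbhs_ballP; exists (#|F|%:R ^ L) => /=; first by rewrite exprz_gt0// Defs.card_gt0.
move=> y; rewrite /ball /= -/(ldist x y) ldistC => /ltW/labs_le; exact: LU.
Qed.

Lemma nbhs_mball m p (A : 'M[K]_(m, p)) (U : set 'M[K]_(m, p)) :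
  nbhs A U <-> exists L : int, forall B, mball L (B - A) -> U B.
Proof.
split=> [[P AP PU]|[L LU]].
  have /choice[L HL] : forall ij : 'I_m * 'I_p, exists L : int,
      forall y : K, lbounded (y - A ij.1 ij.2) L -> P ij.1 ij.2 y.
    by move=> ij; apply/nbhs_lbounded.
  pose c := (\max_(ij : _) absz (L ij))%N.
  exists (- c%:Z) => B BA; apply: PU => i j; apply: (HL (i, j)) => /=.
  have := BA i j; rewrite !mxE; apply: lboundedW.
  have : (absz (L (i, j)) <= c)%N by exact: (leq_bigmax (i, j)).
  by lia.
exists (fun i j => [set y | lbounded (y - A i j) L]).
  by move=> i j; apply/nbhs_lbounded; exists L.
by move=> B BA; apply: LU => i j; rewrite !mxE; exact: BA.
Qed.

Definition linvariant (L : int) (J : set K) :=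
  forall y d : K, J y -> lbounded d L -> J (y + d).

Lemma linvariant_open L J : linvariant L J -> open J.
Proof.
move=> JL; rewrite openE => x Jx; apply/nbhs_lbounded; exists L => y yx.
by rewrite -(subrK x y) addrC; exact: JL.
Qed.

Lemma open_borel (T : ptopologicalType) (J : set T) :
  open J -> measurable (J : set (borel T)).
Proof. exact: sub_sigma_algebra. Qed.

Lemma linvariant_borel L J : linvariant L J -> measurable (J : set (borel K)).
Proof. by move=> /linvariant_open; exact: open_borel. Qed.

Lemma linvariantC L J : linvariant L J -> linvariant L (~` J).
Proof.
move=> JL y d Jy dL Jyd; apply: Jy; rewrite -(addrK d y); apply: JL => //.
exact: lboundedN.
Qed.

Lemma linvariantI L J J' : linvariant L J -> linvariant L J' ->
  linvariant L (J `&` J').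
Proof. by move=> JL JL' y d [? ?] dL; split; [exact: JL|exact: JL']. Qed.

Lemma linvariantU L J J' : linvariant L J -> linvariant L J' ->
  linvariant L (J `|` J').
Proof. by move=> JL JL' y d [Jy|Jy] dL; [left; exact: JL|right; exact: JL']. Qed.

Lemma linvariantW L L' J : L' <= L -> linvariant L J -> linvariant L' J.
Proof. by move=> LL JL y d Jy dL; apply: JL => //; exact: lboundedW dL. Qed.

Definition lball (r : int) : set K := [set y | lbounded y r].

Lemma linvariant_lball L r : L <= r -> linvariant L (lball r).
Proof.
by move=> Lr y d yr dL; apply: lboundedD => //; exact: lboundedW dL.
Qed.

Lemma linvariantE L J (y d : K) : linvariant L J -> lbounded d L -> (J (y + d)) = J y.
Proof.
move=> JL dL; apply/propext; split=> [Jyd|Jy]; last exact: JL.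
by rewrite -(addrK d y); apply: JL => //; exact: lboundedN.
Qed.

End LaurentTopology.
Arguments lball : clear implicits.

Lemma measure_equal_pieces (R : realType) (d : measure_display) (T : measurableType d)
    (mu : {measure set T -> \bar R}) (I : finType) (P : pred I) (C : I -> set T)
    (c : \bar R) :
  (forall i, P i -> measurable (C i)) -> (forall i, P i -> mu (C i) = c) ->
  trivIset [set i | P i] C ->
  mu (\bigcup_(i in [set i | P i]) C i) = ((\sum_i (P i)%:R : R)%:E * c)%E.
Proof.
move=> mC muC tC; rewrite measure_fin_bigcup//; last exact: finite_finset.
rewrite (@fsbigE _ _ _ _ _ (enum P)) ?enum_uniq//; last 2 first.
- by move=> i /=; rewrite mem_enum.
- by move=> i Pi; rewrite mem_enum /in_mem /= Pi.
rewrite big_filter_cond big_mkcond /= -sumEFin ge0_sume_distrl; last first.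
  by move=> i _; rewrite lee_fin.
apply: eq_bigr => i _; rewrite -topredE /=.
have -> : (i \in [set i0 | P i0]) = P i by apply/idP/idP => [/set_mem|Pi]//; exact/mem_set.
by case: ifP => [/andP[Pi _]|]; rewrite ?muC ?Pi ?mul1e// andbb => ->; rewrite mul0e.
Qed.

Section HaarLaurent.
Variables (R : realType) (F : finFieldType).
Local Notation K := (laurent F).
Local Notation q := (#|F|%:R : R).
Variable mK : {measure set (borel K) -> \bar R}.
Hypothesis mK_haar : haar_measure K +%R mK.
Hypothesis mK1 : mK (laurent_integers F) = 1%E.

Lemma laurent_integersE : laurent_integers F = lball F 0.
Proof.
apply/seteqP; split=> y /=; rewrite /laurent_integers /lball /= => H.
  by apply/labs_le; rewrite expr0z.
by rewrite -(expr0z #|F|%:R); apply/labs_le.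
Qed.

Lemma mK_translate x (A : set (borel K)) : measurable A ->
  mK [set y : K | A (y - x)] = mK A.
Proof.
case: mK_haar => inv _ _ mA; rewrite -(inv x A mA); congr (mK _).
apply/seteqP; split=> [y Ay|_ [y Ay <-]] /=.
  by exists (y - x) => //; rewrite addrC subrK.
by rewrite addrC addKr.
Qed.

Lemma mK_partition N (r : int) (J : set K) : J `<=` lball F r ->
  linvariant (r - N%:Z) J ->
  mK J = ((\sum_(x : 'M['rV[F]_N]_1) (mpart r x 0 0 \in J)%:R : R)%:E
          * mK (lball F (r - N%:Z)))%E.
Proof.
move=> Jr JL.
pose C (x : 'M['rV[F]_N]_1) : set (borel K) :=
  [set y : K | lball F (r - N%:Z) (y - mpart r x 0 0)].
have mC x : measurable (C x).
  apply: (@linvariant_borel _ (r - N%:Z)) => y d Cy dL.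
  by rewrite /C /= addrAC; apply: lboundedD.
have JE : J = \bigcup_(x in [set x | mpart r x 0 0 \in J]) C x.
  apply/seteqP; split=> [y Jy|y [x /= /set_mem Jx]].
    pose x : 'M['rV[F]_N]_1 := \matrix_(i, j) ltail N r y.
    have yx : lbounded (y - mpart r x 0 0) (r - N%:Z).
      by rewrite !mxE; apply/ltailK/Jr.
    exists x => //=; apply/mem_set.
    by rewrite -(linvariantE _ JL yx) addrC subrK.
  by rewrite /C /= => yx; rewrite -(subrK (mpart r x 0 0) y) addrC; exact: JL.
rewrite {1}JE (measure_equal_pieces (P := fun x => mpart r x 0 0 \in J)
  (c := mK (lball F (r - N%:Z))))//.
- by move=> x _; apply: mK_translate; apply: linvariant_borel (linvariant_lball _).
move=> x y _ _ [z [zx zy]]; rewrite -(mpartK r x) -(mpartK r y).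
apply: mtail_eq => i j; rewrite !ord1 !mxE -(subrKA z).
apply: lboundedD.
  by rewrite -opprB; apply: lboundedN; move: zx; rewrite /C /lball /= mxE.
by move: zy; rewrite /C /lball /= mxE.
Qed.

(** A ball of degree [s] splits into [q ^ N] translates of the ball of degree [s - N]. For negative
    [r] it is the unit ball that is split, and an infinite value is excluded by [mK1]. *)
Lemma mK_lball r : mK (lball F r) = (q ^ r)%:E.
Proof.
have step (N : nat) (s : int) : mK (lball F s) = ((q ^+ N)%:E * mK (lball F (s - N%:Z)))%E.
  rewrite (@mK_partition N s)//; last by apply: linvariant_lball; lia.
  congr (_%:E * _)%E; rewrite -[in RHS](muln1 N) -(card_mx_rV R F 1 1 N).
  rewrite (eq_bigr (fun=> 1)) => [|x _]; first by rewrite sumr_const.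
  by rewrite mem_set//; exact: mpart_ball.
have [r0|r0] := leP 0 r.
  rewrite (step (absz r)) (_ : r - _ = 0); last by lia.
  by rewrite -laurent_integersE mK1 mule1 exprnP gez0_abs.
have := step (absz r) 0; rewrite -laurent_integersE mK1 (_ : 0 - _ = r); last by lia.
have : (0 <= mK (lball F r))%E by exact: measure_ge0.
have -> : q ^ r = (q ^+ absz r)^-1 by rewrite exprnP invr_expz; congr (_ ^ _); lia.
case: (mK _) => [x _|_|//].
  move=> /esym/eqP; rewrite -EFinM eqe => /eqP qx; congr EFin.
  by rewrite -[LHS](mulKf (qX_neq0 R F (absz r))) qx mulr1.
by rewrite gt0_muley// lte_fin qX_gt0.
Qed.

Lemma avg_measure N (r : int) (J : set K) : J `<=` lball F r ->
  linvariant (r - N%:Z) J ->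
  mK J = (avg N r (fun A : 'M[K]_1 => (A 0 0 \in J)%:R : R) * q ^ r)%:E.
Proof.
move=> Jr JL; rewrite (mK_partition Jr JL) mK_lball -EFinM; congr EFin.
rewrite /avg mul1n muln1 -mulrA; congr (_ * _).
by rewrite mulrC exprnP invr_expz -expfzDr ?q_neq0.
Qed.

End HaarLaurent.

(** * Sums over spheres of polynomial vectors *)

Section AverageMore.
Variables (R : realType) (F : finFieldType).
Local Notation K := (laurent F).
Local Notation q := (#|F|%:R : R).
Variables m p : nat.
Implicit Types (phi : 'M[K]_(m, p) -> R).

(** Both sides equal the double average of [phi (A + B)], with [A] at the fine and [B] at the coarse
    resolution, because each inner average is translation invariant. *)
Lemma avg_resolution N N' r phi : (N <= N')%N -> ball_invariant (r - N%:Z) r phi ->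
  avg N' r phi = avg N r phi.
Proof.
move=> NN' phir.
have phir' : ball_invariant (r - N'%:Z) r phi by apply: ball_invariantW phir; lia.
transitivity (avg N' r (fun A => avg N r (fun B => phi (A + B)))).
  rewrite avg_exchange -[LHS](avg_cst F m p N r); apply: eq_avg => A Ar.
  by rewrite (avg_translate Ar phir').
rewrite -[RHS](avg_cst F m p N' r); apply: eq_avg => A Ar.
rewrite -(avg_translate Ar phir); apply: eq_avg => B _.
by rewrite addrC.
Qed.

End AverageMore.

Section SphereSums.
Variables (R : realType) (F : finFieldType) (n : nat).
Local Notation K := (laurent F).
Local Notation q := (#|F|%:R : R).
Implicit Types (phi : 'cV[K]_n -> R).

(* The exponents in (-1, k] are those of polynomials of degree at most k. *)
Definition pvec (k : nat) (x : 'M['rV[F]_k.+1]_(n, 1)) : 'cV[K]_n := mpart k%:Z x.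

Definition onsphere (k : nat) (x : 'M['rV[F]_k.+1]_(n, 1)) :=
  [exists i, x i 0 0 ord_max != 0].

Lemma pvec_lead k (x : 'M['rV[F]_k.+1]_(n, 1)) i : pvec x i 0 k = x i 0 0 ord_max.
Proof.
rewrite /pvec mxE -(lpart_coef k%:Z (x i 0) ord_max); congr (lpart _ _ _).
by rewrite /=; lia.
Qed.

Lemma pvec_ball k (x : 'M['rV[F]_k.+1]_(n, 1)) : mball k (pvec x).
Proof. exact: mpart_ball. Qed.

Lemma onsphereP k (x : 'M['rV[F]_k.+1]_(n, 1)) : reflect (mdeg k%:Z (pvec x)) (onsphere x).
Proof.
apply: (iffP existsP) => [[i xi]|[_ [i xi]]].
  by split; [exact: pvec_ball|exists i; rewrite pvec_lead].
by exists i; rewrite -pvec_lead.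
Qed.

Lemma mdegD (k : int) (z w : 'cV[K]_n) : mdeg k z -> mball (k - 1) w -> mdeg k (z + w).
Proof.
move=> [zk [i zi]] wk; split; first by apply: mballD => //; apply: mballW wk; lia.
by exists i; rewrite mxE /= (wk i 0 k) ?addr0//; lia.
Qed.

Lemma mdeg_1E (k : int) (E : 'M[K]_n) (z : 'cV[K]_n) :
  mball (-1) E -> mdeg k z -> mdeg k (z + E *m z).
Proof.
move=> E1 zk; apply: mdegD => //; apply: mballW (mballM E1 zk.1); lia.
Qed.

(** The cells [pvec x + m^n] tile the sphere of radius q^k. Once [N] resolves [phi], this is
    therefore the integral of [phi] over the sphere, for the measure giving m^n volume 1. *)
Definition sphere_sum N k phi : R :=
  \sum_(x : 'M['rV[F]_k.+1]_(n, 1) | onsphere x) avg N (-1) (fun h => phi (pvec x + h)).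

(** Modulo m^n, [g] permutes the cells of the sphere; the inner average absorbs the difference
    between [g (pvec x)] and the polynomial vector of its cell. *)
Lemma sphere_sum_isometry N (k : nat) (g : 'cV[K]_n -> 'cV[K]_n) phi :
  (forall z, mdeg k%:Z z -> mdeg k%:Z (g z)) ->
  (forall z z', mball k%:Z z -> mball k%:Z z' -> mball (-1) (g z - g z') ->
     mball (-1) (z - z')) ->
  ball_invariant (-1 - N%:Z) k%:Z phi ->
  \sum_(x : 'M['rV[F]_k.+1]_(n, 1) | onsphere x) avg N (-1) (fun h => phi (g (pvec x) + h))
  = sphere_sum N k phi.
Proof.
move=> gk gi phik; pose P x := onsphere (k := k) x.
(* The identity off the sphere makes this a permutation of the whole finite type. *)
pose sg (x : 'M['rV[F]_k.+1]_(n, 1)) := if P x then mtail k.+1 k%:Z (g (pvec x)) else x.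
have kk : k%:Z - k.+1%:Z = -1 by lia.
have sgb x : P x -> mball (-1) (g (pvec x) - pvec (sg x)).
  move=> Px; rewrite /sg Px. rewrite -kk; apply: mtailK.
  by apply: (gk _ _).1; exact/onsphereP.
have sgP x : P (sg x) = P x.
  case: (boolP (P x)) => Px; last by rewrite /sg (negbTE Px) (negbTE Px).
  apply/onsphereP; rewrite -(subKr (g (pvec x)) (pvec (sg x))).
  apply: mdegD; first by apply: gk; exact/onsphereP.
  by apply: mballN; apply: mballW (sgb _ Px); lia.
have sgi : injective sg.
  move=> x y xy; have Pxy : P x = P y by rewrite -sgP xy sgP.
  case: (boolP (P x)) => Px; last first.
    by move: xy; rewrite /sg -Pxy (negbTE Px) => ->.
  have Py : P y by rewrite -Pxy.
  rewrite -(mpartK k%:Z x) -(mpartK k%:Z y); apply: mtail_eq; rewrite kk.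
  apply: gi; do ?exact: mpart_ball.
  apply: mball_trans (sgb _ Px) _; rewrite xy.
  by apply: mballBC; exact: sgb.
rewrite /sphere_sum [RHS](reindex_inj sgi) /=.
apply: eq_big => [x|x Px]; first exact: esym (sgP x).
have phix (z : 'cV[K]_n) : mball k%:Z z ->
    ball_invariant (-1 - N%:Z) (-1) (fun h => phi (z + h)).
  move=> zk A D A1 D1; rewrite addrA; apply: phik => //.
  by apply: mballD => //; apply: mballW A1; lia.
rewrite -[RHS](avg_translate (sgb x Px)); last by apply: phix; exact: pvec_ball.
by apply: eq_avg => h _; rewrite addrCA subrKC addrC.
Qed.

Lemma sphere_sum_translate N (k : nat) phi w : mball (k%:Z - 1) w ->
  ball_invariant (-1 - N%:Z) k%:Z phi ->
  sphere_sum N k (fun z => phi (z + w)) = sphere_sum N k phi.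
Proof.
move=> wk phik; rewrite -(sphere_sum_isometry (g := fun z => z + w) _ _ phik).
- by apply: eq_bigr => x _; apply: eq_avg => h _; rewrite addrAC.
- by move=> z zk; apply: mdegD.
- by move=> z z' _ _; rewrite opprD addrACA subrr addr0.
Qed.

Lemma sphere_sum_1E N (k : nat) (E : 'M[K]_n) phi : mball (-1) E ->
  ball_invariant (-1 - N%:Z) k%:Z phi ->
  \sum_(x : 'M['rV[F]_k.+1]_(n, 1) | onsphere x)
     avg N (-1) (fun h => phi (pvec x + E *m pvec x + h)) = sphere_sum N k phi.
Proof.
move=> E1 phik; apply: (sphere_sum_isometry (g := fun z => z + E *m z)) => //.
- by move=> z; exact: mdeg_1E.
- move=> z z' _ _; rewrite opprD addrACA -mulmxBr; exact: mball_isometry.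
Qed.

(** The sphere is stable under translation by any [w] of degree below [k], so an average over [w] is
    free, and the average over [h] then disappears into it. The larger balls have radius
    proportional to q^k, as [local_mean] needs. *)
Lemma sphere_sum_fine N N' (k r : nat) phi : (0 < r <= k)%N ->
  ball_invariant (-1 - N%:Z) k%:Z phi -> ball_invariant (k%:Z - r%:Z - N'%:Z) k%:Z phi ->
  sphere_sum N k phi = \sum_(x : 'M['rV[F]_k.+1]_(n, 1) | onsphere x)
    avg N' (k%:Z - r%:Z) (fun w => phi (pvec x + w)).
Proof.
move=> /andP[r0 rk] phiN phiN'.
transitivity (avg N' (k%:Z - r%:Z) (fun w => sphere_sum N k (fun z => phi (z + w)))).
  rewrite -[LHS](avg_cst F n 1 N' (k%:Z - r%:Z)); apply: eq_avg => w wr.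
  by rewrite sphere_sum_translate//; apply: mballW wr; lia.
rewrite avg_sum; apply: eq_bigr => x _; rewrite avg_exchange.
rewrite -[RHS](avg_cst F n 1 N (-1)); apply: eq_avg => h h1.
have hr : mball (k%:Z - r%:Z) h by apply: mballW h1; lia.
rewrite -[RHS](avg_translate hr); last first.
  move=> A D Ar Dr; rewrite addrA; apply: phiN' => //.
  by apply: mballD; [exact: pvec_ball|apply: mballW Ar; lia].
by apply: eq_avg => w _; rewrite addrAC addrA.
Qed.

End SphereSums.

(** * Density of the values of a quadratic form *)

Section VectorDegree.
Variables (F : finFieldType) (n : nat).
Local Notation K := (laurent F).
Implicit Types v w : 'cV[K]_n.

Lemma is_ldeg_ex_deg (k : int) : exists f : K, is_ldeg f k.
Proof.
have fb : exists a, lbounded (fun m : int => (m == k)%:R : F) a.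
  by exists k => m km; rewrite gt_eqF.
exists (mk_laurent fb); split; first by rewrite /= eqxx oner_neq0.
by move=> m km /=; rewrite gt_eqF.
Qed.

Lemma mdeg_uniq v (a b : int) : mdeg a v -> mdeg b v -> a = b.
Proof.
move=> [va [i vi]] [vb [j vj]]; case: (ltgtP a b) => // ab.
- by move/eqP: vj; rewrite (va j 0).
- by move/eqP: vi; rewrite (vb i 0).
Qed.

Lemma mdeg_exP v : v != 0 -> exists d, mdeg d v /\ exists i, is_ldeg (v i 0) d.
Proof.
move=> v0; have [i0 vi0] : exists i, v i 0 != 0.
  apply: contrapT => /forallNP H; move/eqP: v0; apply; apply/colP => i.
  by rewrite mxE; have /negP/negPn/eqP := H i.
case: (@arg_maxP _ _ _ i0 (fun i => v i 0 != 0) (fun i => ldeg (v i 0)) vi0) => i vi imax.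
have [li ui] := ldegP vi.
exists (ldeg (v i 0)); split; last by exists i; exact: ldegP.
split; last by exists i.
move=> j j0; rewrite ord1; have [->//|vj] := eqVneq (v j 0) 0.
by apply: lboundedW (imax j vj) (ldegP vj).2.
Qed.

Lemma mdeg_is_ldeg v d : mdeg d v -> exists i, is_ldeg (v i 0) d.
Proof. by move=> [vd [i vi]]; exists i; split; [exact: vi|exact: vd]. Qed.

Lemma mdegZ (f : K) v a d : is_ldeg f a -> mdeg d v -> mdeg (a + d) (f *: v).
Proof.
move=> fa vd; have [i vi] := mdeg_is_ldeg vd.
split; first by apply: mballZ fa.2 vd.1.
by exists i; rewrite mxE; exact: (is_ldegM fa vi).1.
Qed.

Definition vdeg v : int := xget 0 [set d | mdeg d v].

Lemma vdegE v d : mdeg d v -> vdeg v = d.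
Proof.
move=> vd; apply: mdeg_uniq (vd).
exact: (@xgetPex _ 0 [set d | mdeg d v] (ex_intro _ d vd)).
Qed.

End VectorDegree.

Lemma linvariant_mem (F : finFieldType) L (J : set (laurent F)) (y d : laurent F) :
  linvariant L J -> lbounded d L -> (y + d \in J) = (y \in J).
Proof.
move=> JL dL; apply/idP/idP => /set_mem H; apply/mem_set; move: H;
  by rewrite (linvariantE _ JL dL).
Qed.

(** * Local averages of a quadratic form near a point *)

Section MeanFormula.
Variables (R : realType) (F : finFieldType).
Local Notation K := (laurent F).
Local Notation q := (#|F|%:R : R).
Variable mK : {measure set (borel K) -> \bar R}.
Hypothesis mK_haar : haar_measure K +%R mK.
Hypothesis mK1 : mK (laurent_integers F) = 1%E.
Variables (n : nat) (Q : 'cV[K]_n -> K).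
Hypothesis Qf : quadratic_form Q.
Local Notation B := (polar_form Q).
Local Notation e i := (delta_mx i 0 : 'cV[K]_n).

Definition grad (z : 'cV[K]_n) : 'cV[K]_n := \col_i B z (e i).

Lemma gradD z w : grad (z + w) = grad z + grad w.
Proof. by apply/colP => i; rewrite !mxE polarDl. Qed.

Lemma gradZ a z : grad (a *: z) = a *: grad z.
Proof. by apply/colP => i; rewrite !mxE polarZl. Qed.

Variable c : nat.
Hypothesis Qc : forall k v, mball k v -> lbounded (Q v) (k + k + c%:Z).
Hypothesis Bc : forall k l u v, mball k u -> mball l v -> lbounded (B u v) (k + l + c%:Z).
Lemma qf_ball_invariant (k s L : int) (J : set K) : linvariant L J ->
  k + s + c%:Z <= L -> s <= k ->
  ball_invariant s k (fun z => (Q z \in J)%:R : R).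
Proof.
move=> JL sL sk w d wk dk; rewrite qfD -addrA (linvariant_mem _ JL)//.
apply: lboundedD; first by apply: lboundedW (Qc dk); lia.
by apply: lboundedW (Bc wk dk); lia.
Qed.

Variable c0 : nat.
Hypothesis Bc0 : forall k v, mdeg k v ->
  exists i, exists2 d, k - c0%:Z <= d & is_ldeg (B v (e i)) d.
(** A displacement of degree at most [k - r] changes the gradient in degree at most [k - c0 - 1],
    strictly below the degree of the gradient at a vector of degree [k]. *)
Let r : nat := (c + c0).+1.

Lemma e_ball i : mball 0 (e i).
Proof. rewrite -[delta_mx _ _]scale1r; apply: mball_delta; exact: (is_ldeg1 F).2. Qed.

Lemma grad_ball k z : mball k z -> mball (k + c%:Z) (grad z).
Proof.
by move=> zk i j; rewrite mxE -[k]addr0; apply: Bc => //; exact: e_ball.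
Qed.

Lemma grad_mdeg (k : int) z : mdeg k z ->
  exists2 D, mdeg D (grad z) & k - c0%:Z <= D <= k + c%:Z.
Proof.
move=> zk; have [i [d kd Bd]] := Bc0 zk.
have g0 : grad z != 0.
  apply/eqP => /colP /(_ i); rewrite !mxE => B0.
  by move/is_ldeg_neq0: Bd; rewrite B0 eqxx.
have [D [gD [j Dj]]] := mdeg_exP g0; exists D => //; apply/andP; split.
  apply: le_trans kd _; apply: lbounded_ldeg Bd _.
  by have := gD.1 i 0; rewrite mxE.
by apply: lbounded_ldeg Dj _; apply: (grad_ball zk.1).
Qed.

Lemma grad_mdeg_shift (k : int) z w D : mdeg k z -> mball (k - r%:Z) w ->
  mdeg D (grad z) -> mdeg D (grad (z + w)).
Proof.
move=> zk wk zD; rewrite gradD; apply: mdegD => //.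
have [D' D'z /andP[kD _]] := grad_mdeg zk; rewrite -(mdeg_uniq D'z zD).
by apply: mballW (grad_ball wk); rewrite /r; lia.
Qed.

(** Over the ball of degree [k - r] around [z] the values of [Q] stay in one ball of degree
    [D + k - r]: either all of them are this small or none is. *)
Lemma qf_shift_equiv (k D : int) z w : mdeg k z -> mball (k - r%:Z) w ->
  mdeg D (grad z) -> lbounded (Q (z + w)) (D + k - r%:Z) <-> lbounded (Q z) (D + k - r%:Z).
Proof.
move=> zk wk zD.
have [D' D'z /andP[kD Dk]] := grad_mdeg zk; move: kD Dk; rewrite (mdeg_uniq D'z zD) => kD Dk.
have H : lbounded (Q w + B z w) (D + k - r%:Z).
  apply: lboundedD.
    by apply: lboundedW (Qc wk); rewrite /r; lia.
  rewrite polar_delta//; apply: lbounded_sum => i _.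
  have := zD.1 i 0; rewrite mxE => zi.
  by apply: lboundedW (lboundedM (wk i 0) zi); lia.
rewrite qfD -addrA; split=> [H1|]; last by move=> H1; exact: lboundedD.
by rewrite -(addrK (Q w + B z w) (Q z)); exact: lboundedB.
Qed.

(** Along a direction [e i] of largest derivative, the values of [Q] at parameters [s] and [s']
    differ by [(b + (s + s') Q (e i)) (s - s')], whose first factor has degree exactly [D]. The
    parameters of degree at most [k - r] thus fill a ball of degree [D + k - r], with distances
    multiplied by q^D, and this ball contains [J] or is disjoint from it. *)
Lemma local_mean N (k D M L : int) (J : set K) z : mdeg k z -> mdeg D (grad z) ->
  M + r%:Z <= D + k -> J `<=` lball F M -> linvariant L J -> k + k + c%:Z <= L + N%:Z ->
  avg N (k - r%:Z) (fun w => (Q (z + w) \in J)%:R : R)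
  = if `[< lbounded (Q z) (D + k - r%:Z) >] then fine (mK J) * q ^ (r%:Z - k - D) else 0.
Proof.
move=> zk zD MD JM JL kL.
have [D' D'z /andP[kD Dk]] := grad_mdeg zk; move: kD Dk; rewrite (mdeg_uniq D'z zD) => kD Dk.
have [i gi] := mdeg_is_ldeg zD; rewrite mxE in gi.
pose phi (w : 'cV[K]_n) : R := (Q (z + w) \in J)%:R.
have hsub w (d : 'cV[K]_n) : mball (k - r%:Z) w -> mball (k - r%:Z - N%:Z) d ->
    lbounded (Q (z + w + d) - Q (z + w)) L.
  move=> wk dk; rewrite (_ : _ - _ = Q d + B (z + w) d); last by rewrite qfD; ring.
  have zwk : mball k (z + w).
    by apply: mballD zk.1 _; apply: mballW wk; rewrite /r; lia.
  apply: lboundedD; first by apply: lboundedW (Qc dk); rewrite /r; lia.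
  by apply: lboundedW (Bc zwk dk); rewrite /r; lia.
have phi_inv : ball_invariant (k - r%:Z - N%:Z) (k - r%:Z) phi.
  move=> w d wk dk; rewrite /phi addrA -(subrKC (Q (z + w)) (Q _)).
  by rewrite (linvariant_mem _ JL) ?subrKC//; exact: hsub.
have shift_e (s : 'M[K]_1) w : mball (k - r%:Z) s -> mball (k - r%:Z) w ->
    mball (k - r%:Z) (w + s 0 0 *: e i).
  by move=> sk wk; apply: mballD => //; exact: mball_delta.
have Ntk w : mball (k - r%:Z) w -> lbounded (Q (z + w)) (D + k - r%:Z) <-> lbounded (Q z) (D + k - r%:Z).
  by move=> wk; exact: qf_shift_equiv.
(* An extra average along [e i] is free, since the ball over which [w] ranges is stable under these
   translations. *)
have -> : avg N (k - r%:Z) (fun w => phi w) =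
    avg N (k - r%:Z) (fun w => avg N (k - r%:Z) (fun s : 'M[K]_1 => phi (w + s 0 0 *: e i))).
  rewrite avg_exchange -[LHS](avg_cst F 1 1 N (k - r%:Z)); apply: eq_avg => s sk.
  by rewrite avg_translate//; exact: mball_delta.
rewrite -[RHS](avg_cst F n 1 N (k - r%:Z)); apply: eq_avg => w wk.
case: asboolP => [Qz|Qz]; last first.
  rewrite -[RHS](avg_cst F 1 1 N (k - r%:Z)); apply: eq_avg => s sk.
  rewrite /phi memNset//= => /JM Qzs; apply/Qz/(Ntk _ (shift_e _ _ sk wk)).
  by apply: lboundedW Qzs; lia.
pose psi (y : 'M[K]_1) : R := (y 0 0 \in J)%:R.
pose h (s : 'M[K]_1) : 'M[K]_1 := (Q (z + w + s 0 0 *: e i))%:M.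
have psi_inv : ball_invariant (D + k - r%:Z - N%:Z) (D + k - r%:Z) psi.
  move=> y d _ dD; rewrite /psi mxE (linvariant_mem _ JL)//.
  by apply: lboundedW (dD 0 0); lia.
have -> : avg N (k - r%:Z) (fun s : 'M[K]_1 => phi (w + s 0 0 *: e i)) =
          avg N (k - r%:Z) (fun s => psi (h s)).
  by apply: eq_avg => s _; rewrite /psi /phi mxE eqxx mulr1n addrA.
rewrite (@avg_isometry _ _ _ _ _ (k - r%:Z) (D + k - r%:Z))//; last 2 first.
- move=> s sk i' j'; rewrite !ord1 mxE eqxx mulr1n -addrA.
  by apply/Ntk => //; exact: shift_e.
- move=> s s' sk s'k hh i' j'; rewrite !ord1 !mxE.
  have zwD := grad_mdeg_shift zk wk zD.
  have Bd : is_ldeg (B (z + w) (e i) + (s 0 0 + s' 0 0) * Q (e i)) D.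
    apply: is_ldegD.
      have Bzi : lbounded (B w (e i)) (D - 1).
        by apply: lboundedW (Bc wk (@e_ball i)); rewrite /r; lia.
      by rewrite polarDl//; exact: is_ldegD.
    have := lboundedM (lboundedD (sk 0 0) (s'k 0 0)) (Qc (@e_ball i)).
    by apply: lboundedW; rewrite /r; lia.
  apply: (lboundedMK Bd); have := hh 0 0; rewrite !mxE eqxx !mulr1n.
  rewrite !(qfD _ (z + w)) !(qfZ Qf) !(polarZr Qf).
  set x := s 0 0; set y := s' 0 0; set b := B _ _; set qq := Q (e i); set q0 := Q (z + w).
  rewrite (_ : q0 + x ^+ 2 * qq + x * b - (q0 + y ^+ 2 * qq + y * b) = (b + (x + y) * qq) * (x - y)); last by ring.
  by apply: lboundedW; lia.
have := avg_measure mK_haar mK1 (N := N) (r := D + k - r%:Z) (J := J).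
rewrite -/psi => -> /=; last 2 first.
- by move=> y /JM; apply: lboundedW; lia.
- by apply: linvariantW JL; lia.
rewrite -mulrA -expfzDr ?q_neq0// (_ : D + k - r%:Z + (r%:Z - k - D) = 0) ?expr0z ?mulr1//; lia.
Qed.

(** The coefficient of m(J) in [local_mean], extended by 0 off the sphere: the contribution of the
    neighbourhood of [z] to the density of the values of [Q] near 0. *)
Definition psi (k : int) (z : 'cV[K]_n) : R :=
  if `[< mdeg k z /\ lbounded (Q z) (vdeg (grad z) + k - r%:Z) >]
  then q ^ (r%:Z - k - vdeg (grad z)) else 0.

Lemma psi_ge0 k z : 0 <= psi k z.
Proof. by rewrite /psi; case: asboolP => // _; rewrite exprz_ge0// ltW// q_gt0. Qed.

Lemma psi_invariant k : ball_invariant (k - r%:Z) k (psi k).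
Proof.
move=> z d zk dk; rewrite /psi.
have dk1 : mball (k - 1) d by apply: mballW dk; rewrite /r; lia.
have degE : mdeg k (z + d) <-> mdeg k z.
  split=> [zd|zd]; last exact: mdegD.
  by rewrite -(addrK d z); apply: mdegD => //; exact: mballN.
have [zd|zd] := pselect (mdeg k z); last first.
  by rewrite !asboolF//; tauto.
have [D zD _] := grad_mdeg zd.
rewrite (vdegE zD) (vdegE (grad_mdeg_shift zd dk zD)).
congr (if _ then _ else _); apply/asboolP/asboolP.
  by move=> [_ /(qf_shift_equiv zd dk zD)].
by move=> [_ /(qf_shift_equiv zd dk zD)] H; split=> //; exact/degE.
Qed.

(** Scaling by [f] multiplies the gradient by q^k and [Q] by q^(2k), so the condition in [psi] is
    preserved. This homogeneity makes the density an exact multiple of [q ^ ((n - 2) * k)]. *)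
Lemma psi_scale (k : int) (f : K) z : is_ldeg f k -> mball 0 z ->
  psi k (f *: z) = q ^ (- (k + k)) * psi 0 z.
Proof.
move=> fk z0; rewrite /psi.
have degE : mdeg k (f *: z) <-> mdeg 0 z.
  split=> [H|]; last by move/(mdegZ fk); rewrite addr0.
  have := mdegZ (is_ldegV fk) H.
  by rewrite addNr scalerA mulVf ?scale1r// (is_ldeg_neq0 fk).
have [zd|zd] := pselect (mdeg 0 z); last first.
  by rewrite !asboolF ?mulr0//; tauto.
have [D zD _] := grad_mdeg zd.
have fzD : mdeg (k + D) (grad (f *: z)) by rewrite gradZ; exact: mdegZ.
rewrite (vdegE zD) (vdegE fzD).
have QE : lbounded (Q (f *: z)) (k + D + k - r%:Z) <-> lbounded (Q z) (D + 0 - r%:Z).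
  have f2 : is_ldeg (f ^+ 2) (k + k) by rewrite expr2; exact: is_ldegM.
  rewrite qfZ//; split=> H.
    by apply: (lboundedMK f2); apply: lboundedW H; lia.
  by apply: lboundedW (lboundedM f2.2 H); lia.
have -> : `[< mdeg k (f *: z) /\ lbounded (Q (f *: z)) (k + D + k - r%:Z) >]
        = `[< mdeg 0 z /\ lbounded (Q z) (D + 0 - r%:Z) >].
  by apply/asboolP/asboolP => -[H1 H2]; split; tauto.
case: ifP => _; last by rewrite mulr0.
by rewrite -expfzDr ?q_neq0//; congr (_ ^ _); lia.
Qed.

(** As [psi] is constant on balls of degree [k - r], the sum is [q ^ ((k + 1) * n)] times an average
    at resolution [r], which scaling brings back to the unit ball; the exponent is
    [(k + 1) n - 2 k = n + (n - 2) k]. *)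
Lemma sum_psi (k : nat) : (r <= k.+1)%N -> (2 <= n)%N ->
  \sum_(x : 'M['rV[F]_k.+1]_(n, 1)) psi k%:Z (pvec x)
  = q ^+ n * avg r 0 (psi 0) * q ^+ ((n - 2) * k).
Proof.
move=> rk n2.
have -> : \sum_(x : 'M['rV[F]_k.+1]_(n, 1)) psi k%:Z (pvec x) =
    q ^+ (k.+1 * n) * avg k.+1 k%:Z (psi k%:Z).
  by rewrite /avg muln1 mulrC mulfVK// qX_neq0.
rewrite (avg_resolution rk); last exact: psi_invariant.
have [f fk] := is_ldeg_ex_deg F k%:Z.
have <- : avg r 0 (fun z => psi k%:Z (f *: z)) = avg r k%:Z (psi k%:Z).
  apply: (avg_isometry (h := fun z => f *: z)).
  - by move=> A A0; rewrite -[k%:Z]addr0; apply: mballZ fk.2 A0.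
  - move=> A A' _ _; rewrite -scalerBr => /(mballZ (is_ldegV fk).2).
    rewrite scalerA mulVf ?scale1r ?(is_ldeg_neq0 fk)//.
    by apply: mballW; lia.
  - exact: psi_invariant.
rewrite (@eq_avg _ _ _ _ _ 0 _ (fun z => q ^ (- (k%:Z + k%:Z)) * psi 0 z)); last first.
  by move=> z z0; exact: psi_scale.
rewrite avgZl mulrA [RHS]mulrAC; congr (_ * _).
rewrite !exprnP -!expfzDr ?q_neq0//; congr (_ ^ _).
have -> : ((n - 2) * k)%:Z = n%:Z * k%:Z - 2 * k%:Z.
  by rewrite PoszM -subzn// mulrBl.
by rewrite PoszM; lia.
Qed.

Lemma sphere_sum_density N (M L : int) (k : nat) (J : set K) : (2 <= n)%N ->
  (0 < r <= k)%N -> M + r%:Z + c0%:Z <= k%:Z + k%:Z ->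
  J `<=` lball F M -> linvariant L J -> k%:Z + k%:Z + c%:Z <= L + N%:Z ->
  sphere_sum N k (fun z => (Q z \in J)%:R : R)
  = q ^+ n * avg r 0 (psi 0) * q ^+ ((n - 2) * k) * fine (mK J).
Proof.
move=> n2 rk Mk JM JL NL; have /andP[r0 rk'] := rk.
rewrite (sphere_sum_fine (N' := N) rk); last 2 first.
- by apply: (qf_ball_invariant JL); lia.
- by apply: (qf_ball_invariant JL); lia.
rewrite -sum_psi//; last exact: leqW.
rewrite mulr_suml big_mkcond; apply: eq_bigr => x _.
case: (boolP (onsphere x)) => [/onsphereP xk|/onsphereP xk]; last first.
  by rewrite /psi asboolF ?mul0r//; tauto.
have [D xD /andP[kD Dk]] := grad_mdeg xk.
rewrite (local_mean (M := M) (L := L) xk xD)//; last by lia.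
rewrite /psi (vdegE xD); case: asboolP => H.
  by rewrite asboolT// mulrC.
by rewrite asboolF ?mul0r//; tauto.
Qed.

(** An isotropic vector rescaled to norm 1 satisfies the condition in [psi], and by invariance its
    cell contributes a positive term. *)
Lemma avg_psi_gt0 : qf_isotropic Q -> 0 < avg r 0 (psi 0).
Proof.
move=> [v v0 Qv0]; have [d [vd _]] := mdeg_exP v0.
have [f fd] := is_ldeg_ex_deg F (- d).
have := mdegZ fd vd; rewrite addNr; set z := f *: v => z0.
have Qz : Q z = 0 by rewrite qfZ// Qv0 mulr0.
have [D zD _] := grad_mdeg z0.
have pz : 0 < psi 0 z.
  rewrite /psi asboolT ?exprz_gt0 ?q_gt0//; split=> //.
  by rewrite Qz.
rewrite divr_gt0 ?qX_gt0//.
pose x := mtail r 0 z.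
have px : psi 0 (mpart 0 x) = psi 0 z.
  rewrite -(subrK (mpart 0 x) z) addrC psi_invariant//; first exact: mpart_ball.
  by apply: mtailK; exact: z0.1.
rewrite (bigD1 x)//= px ltr_wpDr// sumr_ge0// => y _; exact: psi_ge0.
Qed.

End MeanFormula.

(** * The density constant of a form *)

Section Density.
Variables (R : realType) (F : finFieldType).
Local Notation K := (laurent F).
Local Notation q := (#|F|%:R : R).
Variable mK : {measure set (borel K) -> \bar R}.
Hypothesis mK_haar : haar_measure K +%R mK.
Hypothesis mK1 : mK (laurent_integers F) = 1%E.
Variables (n : nat).
Implicit Types (Q : 'cV[K]_n -> K).

(* [c q^((n-2)k)] is the density near 0 of the image under Q of the
   (suitably normalised) Haar measure on the sphere of radius q^k. *)
Definition has_density Q (c : R) := 0 < c /\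
  forall M : nat, exists k0 : nat, forall k, (k0 <= k)%N ->
  forall (L : int) (J : set K), J `<=` lball F M -> linvariant L J ->
  exists N0 : nat, forall N, (N0 <= N)%N ->
    sphere_sum N k (fun z => (Q z \in J)%:R : R) = c * q ^+ ((n - 2) * k) * fine (mK J).

Lemma has_density_ex Q : (2 <= n)%N -> quadratic_form Q -> qf_nondegenerate Q ->
  qf_isotropic Q -> exists c, has_density Q c.
Proof.
move=> n2 Qf Qn Qi; have [c [Qc Bc]] := qf_bounded Qf.
have [c0 Bc0] := qf_lower Qf Qn.
exists (q ^+ n * avg (c + c0).+1 0 (psi R Q c c0 0)); split.
  by rewrite mulr_gt0 ?qX_gt0//; exact: avg_psi_gt0.
move=> M; exists (M + (c + c0).+1 + c0)%N => k k0 L J JM JL.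
exists (k + k + c + absz L)%N => N NN.
by apply: (sphere_sum_density mK_haar mK1 Qf Qc Bc Bc0 n2 _ _ JM JL); lia.
Qed.

Lemma has_density_uniq Q a b : has_density Q a -> has_density Q b -> a = b.
Proof.
move=> [_ /(_ 0%N)[k1 H1]] [_ /(_ 0%N)[k2 H2]].
pose k := maxn k1 k2.
have O0 : linvariant 0 (lball F 0) by exact: linvariant_lball.
have [N1 E1] := H1 k (leq_maxl _ _) _ _ (@subset_refl _ _) O0.
have [N2 E2] := H2 k (leq_maxr _ _) _ _ (@subset_refl _ _) O0.
have := E2 _ (leq_maxr N1 N2); rewrite (E1 _ (leq_maxl N1 N2)).
rewrite (mK_lball mK_haar mK1) expr0z /= !mulr1 => H.
by apply: (mulIf (qX_neq0 R F ((n - 2) * k))).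
Qed.

(** [1 + E] permutes the unit cells of every sphere and preserves volumes, so all forms coming from
    one coset share the same constant. *)
Lemma has_density_1E Q c (E : 'M[K]_n) : quadratic_form Q -> mball (-1) E ->
  has_density Q c -> has_density (fun v => Q (v + E *m v)) c.
Proof.
move=> Qf E1 [c_gt0 H]; split=> // M; have [k0 {}H] := H M.
exists k0 => k kk0 L J JM JL; have [N0 {}H] := H k kk0 L J JM JL.
have [b [Qb Bb]] := qf_bounded Qf.
exists (N0 + k + k + b + absz L)%N => N NN; rewrite -(H N); last by lia.
have inv : ball_invariant (-1 - N%:Z) k%:Z (fun z => (Q z \in J)%:R : R).
  by apply: (qf_ball_invariant R Qb Bb JL); lia.
rewrite -(sphere_sum_1E E1 inv); apply: eq_bigr => x _.
rewrite -[RHS](avg_isometry (r := -1) (h := fun h => h + E *m h)).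
- by apply: eq_avg => h _; rewrite mulmxDr addrACA.
- by move=> A A1; exact: mball_1E.
- by move=> A A' _ _; rewrite opprD addrACA -mulmxBr; exact: mball_isometry.
move=> A D A1 D1; rewrite addrA; apply: inv => //.
apply: mballD; last by apply: mballW A1; lia.
by apply: mball_1E => //; exact: pvec_ball.
Qed.

End Density.

(** * Variance of the counting function *)

Section Translations.
Variables (F : finFieldType) (n : nat).
Local Notation K := (laurent F).
Implicit Types (v w z : 'cV[K]_n).

Lemma outer_mul (a : 'cV[K]_n) i v : (a *m delta_mx 0 i) *m v = v i 0 *: a.
Proof.
rewrite -mulmxA (_ : delta_mx 0 i *m v = (v i 0)%:M).
  by rewrite mul_mx_scalar.
by apply/matrixP => a' b'; rewrite !ord1 -rowE !mxE eqxx mulr1n.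
Qed.

Lemma outer_ball r (a : 'cV[K]_n) (i : 'I_n) : mball r a -> mball r (a *m delta_mx 0 i : 'M[K]_n).
Proof.
move=> ar i' j'; rewrite mxE big_ord1 !mxE.
by case: (_ && _); rewrite ?mulr1 ?mulr0.
Qed.

(** A rank one matrix suffices; dividing by a coordinate of degree [k] puts its entries in the
    maximal ideal. *)
Lemma single_translate (k : int) v i z : is_ldeg (v i 0) k -> mball (k - 1) z ->
  exists2 E : 'M[K]_n, mball (-1) E & E *m v = z.
Proof.
move=> vi zk; exists (((v i 0)^-1 *: z) *m delta_mx 0 i).
  by apply: outer_ball; apply: mballW (mballZ (is_ldegV vi).2 zk); lia.
by rewrite outer_mul scalerA mulfV ?scale1r ?(is_ldeg_neq0 vi).
Qed.

(** Since [w] vanishes in coordinate [i], the term in column [i] does not act on [w]: [a] is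
    dictated by [w], and [b] then corrects what [a] does to [v]. *)
Lemma pair_translate (k l : int) v w i j z z' :
  mball k v -> is_ldeg (v i 0) k -> w i 0 = 0 -> is_ldeg (w j 0) l ->
  mball (k - 1) z -> mball (l - 1) z' ->
  exists2 E : 'M[K]_n, mball (-1) E & E *m v = z /\ E *m w = z'.
Proof.
move=> vk vi wi wj zk zl.
have v0 := is_ldeg_neq0 vi; have w0 := is_ldeg_neq0 wj.
pose a := (w j 0)^-1 *: z'; pose b := (v i 0)^-1 *: (z - v j 0 *: a).
have a1 : mball (-1) a by apply: mballW (mballZ (is_ldegV wj).2 zl); lia.
have b1 : mball (-1) b.
  apply: (@mballW _ _ _ (- k + (k - 1))); first by lia.
  apply: mballZ (is_ldegV vi).2 _; apply: mballB => //.
  exact: mballZ (vk j 0) a1.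
exists (b *m delta_mx 0 i + a *m delta_mx 0 j).
  by apply: mballD; exact: outer_ball.
rewrite !mulmxDl !outer_mul wi scale0r add0r /b /a !scalerA !mulfV// !scale1r.
by rewrite subrK.
Qed.

(* Component of w orthogonal (in the ultrametric sense) to v, when the i-th
   coordinate of v is the largest one. *)
Definition residual v w i := w - (w i 0 / v i 0) *: v.

Lemma residual0 v w i : v i 0 != 0 -> residual v w i i 0 = 0.
Proof. by move=> v0; rewrite /residual !mxE divfK ?subrr. Qed.

(** For polynomial vectors the right-hand side is a 2 x 2 minor: small residuals become small
    polynomial determinants. *)
Lemma residual_mulE v w i i' : v i 0 != 0 ->
  residual v w i i' 0 * v i 0 = w i' 0 * v i 0 - w i 0 * v i' 0.
Proof.
move=> v0; rewrite /residual !mxE mulrBl; congr (_ - _).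
by rewrite mulrAC divfK.
Qed.

End Translations.

(** * Second moment of the count on a sphere *)

Section Variance.
Variables (R : realType) (F : finFieldType) (n : nat).
Local Notation K := (laurent F).
Local Notation q := (#|F|%:R : R).
Variables (k N : nat) (f : 'cV[K]_n -> R).
Hypothesis f_ge0 : forall v, 0 <= f v.
(** A change of [E] in degree [-1 - N] moves [E *m pvec x] in degree [k - 1 - N]. *)
Hypothesis f_inv : ball_invariant (k%:Z - 1 - N%:Z) k%:Z f.
Local Notation V := 'M['rV[F]_k.+1]_(n, 1).

Definition bad (x y : V) :=
  [exists i, (x i 0 0 ord_max != 0) && `[< mball (-1) (residual (pvec x) (pvec y) i) >]].

Definition rotated_sum (E : 'M[K]_n) : R :=
  \sum_(x : V | onsphere x) f (pvec x + E *m pvec x).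

(** Averaging over a unit cell around the rotated vector makes the sum over [x] independent of
    [E]. *)
Let g (E : 'M[K]_n) (x : V) : R :=
  avg N (-1) (fun h => f (pvec x + E *m pvec x + h)).

Lemma f_inv1 : ball_invariant (-1 - N%:Z) k%:Z f.
Proof. by apply: ball_invariantW f_inv => //; lia. Qed.

Lemma sum_g E : mball (-1) E -> \sum_(x | onsphere x) g E x = sphere_sum N k f.
Proof. by move=> E1; apply: sphere_sum_1E E1 f_inv1. Qed.

Lemma rotated_inv (x : V) : ball_invariant (-1 - N%:Z) (-1)
  (fun E : 'M[K]_n => f (pvec x + E *m pvec x)).
Proof.
move=> E D E1 DN; rewrite mulmxDl addrA; apply: f_inv.
  by apply: mball_1E => //; exact: pvec_ball.
by apply: mballW (mballM DN (pvec_ball x)); lia.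
Qed.

Lemma avg_rotated (x : V) : onsphere x ->
  avg N (-1) (fun E : 'M[K]_n => f (pvec x + E *m pvec x)) =
  avg N (-1) (fun E : 'M[K]_n => g E x).
Proof.
move=> /onsphereP xk; have [i xi] := mdeg_is_ldeg xk.
rewrite /g avg_exchange -[LHS](avg_cst F n 1 N (-1)); apply: eq_avg => h h1.
have [|D D1 Dx] := @single_translate _ _ _ _ _ h xi.
  by apply: mballW h1; lia.
rewrite -(avg_translate D1) => [|A B A1 BN]; last exact: rotated_inv.
by apply: eq_avg => E _; rewrite mulmxDl Dx addrA.
Qed.

Lemma mean_rotated_sum : avg N (-1) rotated_sum = sphere_sum N k f.
Proof.
rewrite avg_sum (eq_bigr _ avg_rotated) -avg_sum.
rewrite -[RHS](avg_cst F n n N (-1)); apply: eq_avg => E E1; exact: sum_g.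
Qed.

(** The residual has degree [l >= 0], so for all [h] and [h'] in m^n [pair_translate] yields a
    matrix moving the two rotated vectors by exactly [h] and [h']. Independent averages over [h] and
    [h'] can therefore be inserted. *)
Lemma good_pair (x y : V) : onsphere x -> onsphere y -> ~~ bad x y ->
  avg N (-1) (fun E : 'M[K]_n => f (pvec x + E *m pvec x) * f (pvec y + E *m pvec y)) =
  avg N (-1) (fun E : 'M[K]_n => g E x * g E y).
Proof.
move=> /onsphereP xk /onsphereP yk xy.
have [i xi] : exists i, x i 0 0 ord_max != 0.
  by have [i xi] := xk.2; exists i; rewrite -pvec_lead.
have vi : is_ldeg (pvec x i 0) k by split; [rewrite pvec_lead|exact: pvec_ball].
pose e := residual (pvec x) (pvec y) i.
have eb : ~ mball (-1) e.
  by move: xy => /existsPn/(_ i); rewrite xi /= => /asboolP.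
have e0 : e != 0 by apply/eqP => e0; apply: eb; rewrite e0; exact: mball0.
have [l [[el _] [j ej]]] := mdeg_exP e0.
have l0 : 0 <= l.
  by rewrite leNgt; apply/negP => l0; apply: eb; apply: mballW el; lia.
have ei : e i 0 = 0.
  by apply: residual0; exact: is_ldeg_neq0 vi.
have th0 : lbounded (pvec y i 0 / pvec x i 0) 0.
  by rewrite -(subrr k%:Z); apply: lbounded_div vi; exact: pvec_ball.
have trans h h' : mball (-1) h -> mball (-1) h' ->
    exists2 D : 'M[K]_n, mball (-1) D & D *m pvec x = h /\ D *m pvec y = h'.
  move=> h1 h1'.
  have [||D D1 [Dx De]] := @pair_translate _ _ k l (pvec x) e i j h
      (h' - (pvec y i 0 / pvec x i 0) *: h) xk.1 vi ei ej.
  - by apply: mballW h1; lia.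
  - apply: (@mballW _ _ _ (-1)); first lia.
    by apply: mballB => //; apply: mballW (mballZ th0 h1); lia.
  exists D => //; split=> //.
  have -> : pvec y = e + (pvec y i 0 / pvec x i 0) *: pvec x by rewrite /e /residual subrK.
  by rewrite mulmxDr -scalemxAr Dx De subrK.
transitivity (avg N (-1) (fun h : 'cV[K]_n => avg N (-1) (fun h' : 'cV[K]_n =>
    avg N (-1) (fun E : 'M[K]_n => f (pvec x + E *m pvec x + h) * f (pvec y + E *m pvec y + h'))))).
  rewrite -[LHS](avg_cst F n 1 N (-1)); apply: eq_avg => h h1.
  rewrite -[LHS](avg_cst F n 1 N (-1)); apply: eq_avg => h' h1'.
  have [D D1 [Dx Dy]] := trans h h' h1 h1'.
  rewrite -(avg_translate D1) => [|A B A1 BN]; last by congr (_ * _); exact: rotated_inv.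
  by apply: eq_avg => E _; rewrite !mulmxDl Dx Dy !addrA.
transitivity (avg N (-1) (fun h : 'cV[K]_n => avg N (-1) (fun E : 'M[K]_n =>
    f (pvec x + E *m pvec x + h) * g E y))).
  apply: eq_avg => h _; rewrite avg_exchange; apply: eq_avg => E _.
  by rewrite avgZl.
by rewrite avg_exchange; apply: eq_avg => E _; rewrite avgZr.
Qed.

Lemma g_ge0 E (x : V) : 0 <= g E x.
Proof. exact: avg_ge0. Qed.

(** The squared mean is expanded as the average of the square of the sum of the [g E x]. Good pairs
    then cancel against the second moment, and for bad pairs the nonnegative subtracted term is
    dropped. *)
Lemma variance_rotated_sum :
  avg N (-1) (fun E => (rotated_sum E - sphere_sum N k f) ^+ 2) <=
  \sum_(x : V | onsphere x) \sum_(y : V | onsphere y && bad x y)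
    avg N (-1) (fun E : 'M[K]_n => f (pvec x + E *m pvec x) * f (pvec y + E *m pvec y)).
Proof.
set S := sphere_sum N k f.
have -> : avg N (-1) (fun E => (rotated_sum E - S) ^+ 2) =
    avg N (-1) (fun E => rotated_sum E * rotated_sum E) - S ^+ 2.
  rewrite (@eq_avg _ _ _ _ _ (-1) _
    (fun E => (rotated_sum E * rotated_sum E - (2 * S) * rotated_sum E) + S ^+ 2)).
    by rewrite avgD avgB avgZl mean_rotated_sum avg_cst -/S; ring.
  by move=> E _; ring.
have -> : avg N (-1) (fun E => rotated_sum E * rotated_sum E) =
    \sum_(x : V | onsphere x) \sum_(y : V | onsphere y)
    avg N (-1) (fun E : 'M[K]_n => f (pvec x + E *m pvec x) * f (pvec y + E *m pvec y)).
  rewrite (@eq_avg _ _ _ _ _ (-1) _ (fun E => \sum_(x : V | onsphere x) \sum_(y : V | onsphere y)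
      f (pvec x + E *m pvec x) * f (pvec y + E *m pvec y))).
    by rewrite avg_sum; apply: eq_bigr => x _; rewrite avg_sum.
  by move=> E _; rewrite mulr_suml; apply: eq_bigr => x _; rewrite mulr_sumr.
have -> : S ^+ 2 = \sum_(x : V | onsphere x) \sum_(y : V | onsphere y)
    avg N (-1) (fun E : 'M[K]_n => g E x * g E y).
  rewrite -[LHS](avg_cst F n n N (-1)).
  rewrite (@eq_avg _ _ _ _ _ (-1) _ (fun E => \sum_(x : V | onsphere x) \sum_(y : V | onsphere y)
      g E x * g E y)).
    by rewrite avg_sum; apply: eq_bigr => x _; rewrite avg_sum.
  move=> E E1; rewrite /S -(sum_g E1) expr2 mulr_suml; apply: eq_bigr => x _.
  by rewrite mulr_sumr.
rewrite -sumrB; apply: ler_sum => x xk.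
rewrite -sumrB (bigID (bad x)) /=.
rewrite [X in _ + X]big1 ?addr0 => [|y /andP[yk xy]]; last first.
  by rewrite good_pair// subrr.
apply: ler_sum => y _; rewrite lerBlDr lerDl.
by apply: avg_ge0 => E _; rewrite mulr_ge0 ?g_ge0.
Qed.

End Variance.

(** * Probability of small values at one vector and at a pair *)

Section SmallValues.
Variables (R : realType) (F : finFieldType).
Local Notation K := (laurent F).
Local Notation q := (#|F|%:R : R).
Variables (n : nat) (Q : 'cV[K]_n -> K).
Hypothesis Qf : quadratic_form Q.
Local Notation B := (polar_form Q).
Local Notation e i := (delta_mx i 0 : 'cV[K]_n).
Variables c c0 : nat.
Hypothesis Qc : forall k v, mball k v -> lbounded (Q v) (k + k + c%:Z).
Hypothesis Bc : forall k l u v, mball k u -> mball l v -> lbounded (B u v) (k + l + c%:Z).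
Hypothesis Bc0 : forall k v, mdeg k v ->
  exists i, exists2 d, k - c0%:Z <= d & is_ldeg (B v (e i)) d.
Let r : nat := (c + c0).+1.
Variables k M : nat.

Definition steep i (a : 'cV[K]_n) := `[< ~ lbounded (B a (e i)) (k%:Z - c0%:Z - 1) >].

Definition small (a : 'cV[K]_n) := Q a \in lball F M%:Z.

Lemma not_lboundedP (f : K) (d : int) : ~ lbounded f d -> exists2 d', d < d' & is_ldeg f d'.
Proof.
move=> fd; have f0 : f != 0 by apply/eqP => f0; apply: fd; rewrite f0.
exists (ldeg f); last exact: ldegP.
by rewrite ltNge; apply/negP => df; apply: fd; apply: lboundedW df (ldegP f0).2.
Qed.

(** The increment of [Q] is [t] times a factor that keeps the degree of [B a (e i)], because [t] has
    degree at most [k - r]. *)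
Lemma steep_diam i a (t : K) : steep i a -> lbounded t (k%:Z - r%:Z) ->
  lbounded (Q (a + t *: e i) - Q a) M%:Z -> lbounded t (M%:Z - k%:Z + c0%:Z).
Proof.
move=> /asboolP /not_lboundedP[d kd Bd] tk.
have -> : Q (a + t *: e i) - Q a = (B a (e i) + t * Q (e i)) * t.
  by rewrite qfD qfZ// polarZr//; ring.
have H : is_ldeg (B a (e i) + t * Q (e i)) d.
  apply: is_ldegD => //; apply: lboundedW (lboundedM tk (Qc (e_ball F i))).
  by rewrite /r; lia.
move=> tM; apply: (@lboundedMK _ _ _ _ _ H); apply: lboundedW tM; lia.
Qed.

Lemma small_inv N (a d : 'cV[K]_n) : mball k%:Z a -> mball (k%:Z - 1 - N%:Z) d ->
  (k + k + c <= N)%N -> small (a + d) = small a.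
Proof.
move=> ak dk NN; rewrite /small qfD -addrA.
apply: (linvariant_mem _ (linvariant_lball (lexx _))).
apply: lboundedD; first by apply: lboundedW (Qc dk); lia.
by apply: lboundedW (Bc ak dk); lia.
Qed.

Lemma steep_inv N i (a d : 'cV[K]_n) : mball (k%:Z - 1 - N%:Z) d ->
  (c + c0 <= N)%N -> steep i (a + d) = steep i a.
Proof.
move=> dk NN; have Bd : lbounded (B d (e i)) (k%:Z - c0%:Z - 1).
  by apply: lboundedW (Bc dk (e_ball F i)); lia.
apply/asboolP/asboolP => H H'; apply: H.
  by rewrite polarDl//; exact: lboundedD.
by rewrite -(addrK (B d (e i)) (B a (e i))) -polarDl//; exact: lboundedB.
Qed.

Lemma steep_ex a : mdeg k%:Z a -> exists i, steep i a.
Proof.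
move=> /Bc0[i [d kd Bd]]; exists i; apply/asboolP => H.
by have := lbounded_ldeg Bd H; lia.
Qed.

(* For each point a, the line a + K e_i meets the set of small values in a set of
   small diameter as soon as the derivative of Q along e_i is large at a. *)
Lemma line_bound N i a : (k + k <= N)%N ->
  avg N (k%:Z - r%:Z) (fun s : 'M[K]_1 =>
    (small (a + s 0 0 *: e i) && steep i (a + s 0 0 *: e i))%:R : R)
  <= q ^ (M%:Z + c0%:Z + r%:Z - k%:Z - k%:Z).
Proof.
move=> NN.
pose S (s : K) := small (a + s *: e i) && steep i (a + s *: e i).
have -> : M%:Z + c0%:Z + r%:Z - k%:Z - k%:Z = (M%:Z - k%:Z + c0%:Z) - (k%:Z - r%:Z) by lia.
apply: (@avg_diam R _ N _ _ S); first by lia.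
move=> s s' sk sk' /andP[/set_mem s1 s2] /andP[/set_mem s1' s2'].
apply: (steep_diam s2').
  exact: lboundedB.
rewrite -addrA -scalerDl subrKC; exact: lboundedB.
Qed.

(** A union bound over the [n] directions: each rotated vector is steep in at least one, and
    translations of [E] move it along the corresponding line. *)
Lemma single_bound N v : mdeg k%:Z v -> (k + k + c + c0 <= N)%N ->
  avg N (-1) (fun E : 'M[K]_n => (small (v + E *m v))%:R : R)
  <= n%:R * q ^ (M%:Z + c0%:Z + r%:Z - k%:Z - k%:Z).
Proof.
move=> vk NN; have [i0 vi0] := mdeg_is_ldeg vk.
pose phi i (a : 'cV[K]_n) : R := (small a && steep i a)%:R.
apply: (@le_trans _ _ (\sum_i avg N (-1) (fun E : 'M[K]_n => phi i (v + E *m v)))).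
  rewrite -avg_sum; apply: le_avg => E E1.
  have [i ai] := steep_ex (mdeg_1E E1 vk).
  by rewrite (bigD1 i)//= /phi ai andbT lerDl sumr_ge0.
rewrite mulr_natl -[n in leRHS]card_ord -sumr_const; apply: ler_sum => i _.
have -> : avg N (-1) (fun E : 'M[K]_n => phi i (v + E *m v)) =
    avg N (-1) (fun E : 'M[K]_n => avg N (k%:Z - r%:Z)
      (fun s : 'M[K]_1 => phi i (v + E *m v + s 0 0 *: e i))).
  rewrite avg_exchange -[LHS](avg_cst F 1 1 N (k%:Z - r%:Z)); apply: eq_avg => s sk.
  have [|D D1 Dv] := @single_translate _ _ _ _ _ (s 0 0 *: e i) vi0.
    by apply: mball_delta; apply: lboundedW (sk 0 0); rewrite /r; lia.
  rewrite -(avg_translate D1) => [|A A' A1 AN].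
    by apply: eq_avg => E _; rewrite mulmxDl Dv addrA.
  rewrite mulmxDl addrA /phi.
  have A'v : mball (k%:Z - 1 - N%:Z) (A' *m v) by apply: mballW (mballM AN vk.1); lia.
  rewrite (small_inv _ A'v) ?(steep_inv _ _ A'v)//; try lia.
  exact: mball_1E A1 vk.1.
rewrite -[leRHS](avg_cst F n n N (-1)); apply: le_avg => E E1.
by apply: line_bound; lia.
Qed.

(** The two vectors are moved independently along the same [e i]. With the first fixed at a steep
    point [a], the polar form of [a] and the second is affine in [s'] with slope of degree at least
    [k - c0], so its small values occur for a set of [s'] of diameter at most [q ^ (M - k + c0)] in
    a ball of degree [l - 1]. *)
Lemma pair_bound (N : nat) (l : int) (v w : 'cV[K]_n) i0 j0 : mball k%:Z v -> is_ldeg (v i0 0) k%:Z ->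
  w i0 0 = 0 -> mball l w -> is_ldeg (w j0 0) l -> l <= -1 -> - k%:Z <= l ->
  (k + k + k + c + c0 <= N)%N ->
  avg N (-1) (fun E : 'M[K]_n => (small (v + E *m v) &&
    `[< lbounded (B (v + E *m v) (w + E *m w)) M%:Z >])%:R : R)
  <= n%:R * q ^ (M%:Z + c0%:Z + r%:Z - k%:Z - k%:Z) * q ^ (M%:Z - k%:Z + c0%:Z - (l - 1)).
Proof.
move=> vk vi0 wi0 wl wj0 l1 kl NN.
have vmk : mdeg k%:Z v by split=> //; exists i0; exact: vi0.1.
pose sm (a b : 'cV[K]_n) := `[< lbounded (B a b) M%:Z >].
pose phi i (a b : 'cV[K]_n) : R := (small a && steep i a && sm a b)%:R.
apply: (@le_trans _ _ (\sum_i avg N (-1) (fun E : 'M[K]_n => phi i (v + E *m v) (w + E *m w)))).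
  rewrite -avg_sum; apply: le_avg => E E1.
  have [i ai] := steep_ex (mdeg_1E E1 vmk).
  by rewrite (bigD1 i)//= /phi ai andbT lerDl sumr_ge0.
rewrite -mulrA mulr_natl -[n in leRHS]card_ord -sumr_const; apply: ler_sum => i _.
have -> : avg N (-1) (fun E : 'M[K]_n => phi i (v + E *m v) (w + E *m w)) =
    avg N (-1) (fun E : 'M[K]_n => avg N (k%:Z - r%:Z) (fun s : 'M[K]_1 =>
      avg N (l - 1) (fun s' : 'M[K]_1 =>
        phi i (v + E *m v + s 0 0 *: e i) (w + E *m w + s' 0 0 *: e i)))).
  rewrite avg_exchange -[LHS](avg_cst F 1 1 N (k%:Z - r%:Z)); apply: eq_avg => s sk.
  rewrite avg_exchange -[LHS](avg_cst F 1 1 N (l - 1)); apply: eq_avg => s' sl.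
  have [||D D1 [Dv Dw]] := @pair_translate _ _ k%:Z l v w i0 j0 (s 0 0 *: e i) (s' 0 0 *: e i)
    vk vi0 wi0 wj0.
  - by apply: mball_delta; apply: lboundedW (sk 0 0); rewrite /r; lia.
  - exact: mball_delta.
  rewrite -(avg_translate D1) => [|A A' A1 AN].
    by apply: eq_avg => E _; rewrite !mulmxDl Dv Dw !addrA.
  rewrite !mulmxDl !addrA /phi.
  have A'v : mball (k%:Z - 1 - N%:Z) (A' *m v) by apply: mballW (mballM AN vk); lia.
  have A'w : mball (k%:Z - 1 - N%:Z) (A' *m w) by apply: mballW (mballM AN wl); lia.
  have Av : mball k%:Z (v + A *m v) by exact: mball_1E.
  have Aw : mball k%:Z (w + A *m w).
    by apply: (@mballW _ _ _ l); [lia|exact: mball_1E].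
  rewrite (small_inv Av A'v) ?(steep_inv _ _ A'v)//; try lia.
  congr (nat_of_bool (_ && _))%:R.
  have H : lbounded (B (v + A *m v) (A' *m w) + B (A' *m v) (w + A *m w + A' *m w)) M%:Z.
    apply: lboundedD; first by apply: lboundedW (Bc Av A'w); lia.
    have Aw' : mball k%:Z (w + A *m w + A' *m w).
      by apply: mballD => //; apply: mballW A'w; lia.
    by apply: lboundedW (Bc A'v Aw'); lia.
  have BE : B (v + A *m v + A' *m v) (w + A *m w + A' *m w) = B (v + A *m v) (w + A *m w)
      + (B (v + A *m v) (A' *m w) + B (A' *m v) (w + A *m w + A' *m w)).
    rewrite (polarDl Qf _ (v + A *m v)) (polarDr Qf (v + A *m v)).
    exact: esym (addrA _ _ _).
  rewrite /sm BE; apply/asboolP/asboolP => H1; last exact: lboundedD.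
  by have := lboundedB H1 H; rewrite addrK.
rewrite -[leRHS](avg_cst F n n N (-1)); apply: le_avg => E E1.
apply: (@le_trans _ _ (avg N (k%:Z - r%:Z) (fun s : 'M[K]_1 =>
    (small (v + E *m v + s 0 0 *: e i) && steep i (v + E *m v + s 0 0 *: e i))%:R
    * q ^ (M%:Z - k%:Z + c0%:Z - (l - 1))))).
  apply: le_avg => s sk; rewrite /phi; set a := v + E *m v + _.
  case: (boolP (small a && steep i a)) => [/andP[_ ai]|_] /=; last first.
    by rewrite avg_cst mul0r.
  rewrite mul1r.
  pose S (s' : K) := sm a (w + E *m w + s' *: e i).
  apply: (@avg_diam R _ N _ _ S); first by lia.
  move=> x y _ _ /asboolP Sx /asboolP Sy.
  move/asboolP/not_lboundedP : ai => [d kd Bd].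
  have : lbounded (B a (e i) * (x - y)) M%:Z.
    rewrite (_ : _ * _ = B a (w + E *m w + x *: e i) - B a (w + E *m w + y *: e i)).
      exact: lboundedB.
    by rewrite !(polarDr Qf a (w + _)) !(polarZr Qf); ring.
  by move=> xyM; apply: (lboundedMK Bd); apply: lboundedW xyM; lia.
rewrite avgZr; apply: ler_wpM2r; first by rewrite exprz_ge0// ltW// q_gt0.
by apply: line_bound; lia.
Qed.

End SmallValues.

(** * Polynomial 2 x 2 matrices with small determinant *)

Section PolynomialCounting.
Variable F : finFieldType.
Local Notation q := #|F|.

Lemma poly_rV_inj d (p p' : {poly F}) : (size p <= d)%N -> (size p' <= d)%N ->
  poly_rV p = poly_rV p' :> 'rV[F]_d -> p = p'.
Proof.
by move=> pd pd' E; rewrite -(poly_rV_K pd) E poly_rV_K.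
Qed.

Lemma card_rV d : #|{: 'rV[F]_d}| = (q ^ d)%N.
Proof. by rewrite card_mx mul1n. Qed.

Variables k j : nat.
Hypothesis jk : (j <= k.+1)%N.
Local Notation T := 'rV[F]_k.+1.

(** [s] and [y] stand for two coordinates of the first vector of a pair, [p] and [z] for the same
    coordinates of the second. *)
Definition det_small (t : T * T * T * T) :=
  let: (s, y, p, z) := t in
  (size (rVpoly s) == k.+1) &&
  (size (rVpoly z * rVpoly s - rVpoly p * rVpoly y)%R <= k.+1 - j)%N.

(* The quadruple is recovered from h = gcd(s, y), s / h, y / h, (zs - py) / h and
   the quotient of p by s / h: the remainder is determined, because s / h divides
   the difference of any two solutions p. *)
Lemma card_det_small_slice a : (a <= k)%N ->
  (#|[set t : T * T * T * T | det_small t &&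
     (size (gcdp (rVpoly t.1.1.1) (rVpoly t.1.1.2)) == a.+1)]%SET|
   <= q ^ (3 * k + 5 - j))%N.
Proof.
move=> ak; set A := finset _.
pose H (t : T * T * T * T) := gcdp (rVpoly t.1.1.1) (rVpoly t.1.1.2).
pose S1 (t : T * T * T * T) := rVpoly t.1.1.1 %/ H t.
pose Y1 (t : T * T * T * T) := rVpoly t.1.1.2 %/ H t.
pose D (t : T * T * T * T) :=
  (rVpoly t.2 * rVpoly t.1.1.1 - rVpoly t.1.2 * rVpoly t.1.1.2).
pose f (t : T * T * T * T) :
    'rV[F]_a.+1 * 'rV[F]_(k.+1 - a) * 'rV[F]_(k.+1 - a) *
    'rV[F]_(k.+1 - j - a) * 'rV[F]_a.+1 :=
  (poly_rV (H t), poly_rV (S1 t), poly_rV (Y1 t), poly_rV (D t %/ H t),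
   poly_rV (rVpoly t.1.2 %/ S1 t)).
have AP t : t \in A -> [/\ size (rVpoly t.1.1.1) = k.+1, size (H t) = a.+1,
    (size (D t) <= k.+1 - j)%N & H t != 0].
  case: t => [[[s y] p] z]; rewrite inE /= => /andP[/andP[/eqP sk Ds] /eqP ha].
  by split=> //; rewrite -size_poly_eq0 ha.
have S1k t : t \in A -> size (S1 t) = (k.+1 - a)%N.
  by move=> /AP[sk ha _ h0]; rewrite size_divp// ha sk.
have fi : {in A &, injective f}.
  move=> t t' tA t'A [] Ef1 Ef2 Ef3 Ef4 Ef5.
  have [sk ha Dk h0] := AP t tA; have [sk' ha' Dk' h0'] := AP t' t'A.
  have S1t := S1k t tA; have S1t' := S1k t' t'A.
  have HH : H t = H t' by apply: poly_rV_inj Ef1; rewrite ?ha ?ha'.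
  have SS1 : S1 t = S1 t' by apply: poly_rV_inj Ef2; rewrite ?S1t ?S1t'.
  have Yb (u : T * T * T * T) : u \in A -> (size (Y1 u) <= k.+1 - a)%N.
    by move=> /AP[_ hu _ hu0]; rewrite size_divp// hu leq_sub2r// size_poly.
  have YY1 : Y1 t = Y1 t' by apply: poly_rV_inj Ef3; exact: Yb.
  have Db (u : T * T * T * T) : u \in A -> (size (D u %/ H u)%R <= k.+1 - j - a)%N.
    by move=> /AP[_ hu Du hu0]; rewrite size_divp// hu leq_sub2r.
  have DD1 : D t %/ H t = D t' %/ H t' by apply: poly_rV_inj Ef4; exact: Db.
  have Pb (u : T * T * T * T) : u \in A -> (size (rVpoly u.1.2 %/ S1 u)%R <= a.+1)%N.
    move=> uA; have Su := S1k u uA.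
    rewrite size_divp -?size_poly_gt0 Su; last by rewrite subn_gt0 ltnS.
    by rewrite (leq_trans (leq_sub2r _ (size_poly _ _)))//; lia.
  have PP : rVpoly t.1.2 %/ S1 t = rVpoly t'.1.2 %/ S1 t' by apply: poly_rV_inj Ef5; exact: Pb.
  have SE (u : T * T * T * T) : rVpoly u.1.1.1 = S1 u * H u by rewrite divpK// dvdp_gcdl.
  have YE (u : T * T * T * T) : rVpoly u.1.1.2 = Y1 u * H u by rewrite divpK// dvdp_gcdr.
  have DE (u : T * T * T * T) : D u = D u %/ H u * H u.
    rewrite divpK// /D; apply: dvdp_sub; apply: dvdp_mull.
      exact: dvdp_gcdl.
    exact: dvdp_gcdr.
  have sE : t.1.1.1 = t'.1.1.1.
    by apply: (can_inj (@rVpolyK _ _)); rewrite !SE SS1 HH.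
  have yE : t.1.1.2 = t'.1.1.2.
    by apply: (can_inj (@rVpolyK _ _)); rewrite !YE YY1 HH.
  have DD : D t = D t' by rewrite DE DD1 HH -DE.
  have s0 : rVpoly t.1.1.1 != 0 by rewrite -size_poly_gt0 sk.
  have key : (rVpoly t.2 - rVpoly t'.2) * rVpoly t.1.1.1 =
             (rVpoly t.1.2 - rVpoly t'.1.2) * rVpoly t.1.1.2.
    apply/eqP; rewrite -subr_eq0 -[X in _ == X](subrr (D t)) {2}DD /D -sE -yE.
    by apply/eqP; ring.
  have S1dvd : S1 t %| rVpoly t.1.2 - rVpoly t'.1.2.
    have : S1 t %| (rVpoly t.1.2 - rVpoly t'.1.2) * Y1 t.
      have -> : (rVpoly t.1.2 - rVpoly t'.1.2) * Y1 t = (rVpoly t.2 - rVpoly t'.2) * S1 t.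
        apply: (mulIf h0); rewrite -!mulrA -SE -YE.
        by rewrite key.
      exact: dvdp_mull.
    rewrite Gauss_dvdpl//; apply: coprimep_div_gcd.
    by apply/orP; left.
  have pE : t.1.2 = t'.1.2.
    apply: (can_inj (@rVpolyK _ _)); apply/eqP; rewrite -subr_eq0.
    by rewrite -(divpK S1dvd) divpD divpN {2}SS1 -PP subrr mul0r.
  have zE : t.2 = t'.2.
    apply: (can_inj (@rVpolyK _ _)); apply/eqP; rewrite -subr_eq0.
    by apply/eqP/(mulIf s0); rewrite key pE subrr !mul0r.
  by move: sE yE pE zE; case: (t) => [[[? ?] ?] ?]; case: (t') => [[[? ?] ?] ?] /= -> -> -> ->.
rewrite -(card_in_imset fi) (leq_trans (max_card _))//.
rewrite !card_prod !card_rV -!expnD leq_exp2l; last exact: card_finNzRing_gt1.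
(* The exponents add up to [3 k + 5 - j - a], or to [2 k + 4] when [k.+1 - j - a] is truncated at 0;
   [jk] covers the second case. *)
lia.
Qed.

(** The factor [k.+1] counts the possible degrees of the gcd; it is one of the two factors [k.+1] in
    the variance bound. *)
Lemma card_det_small : (#|[set t | det_small t]%SET| <= k.+1 * q ^ (3 * k + 5 - j))%N.
Proof.
pose h (t : T * T * T * T) := gcdp (rVpoly t.1.1.1) (rVpoly t.1.1.2).
have hk t : det_small t -> (0 < size (h t) <= k.+1)%N.
  case: t => [[[s y] p] z] /andP[/eqP sk _]; rewrite /h /=.
  have s0 : rVpoly s != 0 by rewrite -size_poly_gt0 sk.
  rewrite size_poly_gt0 gcdp_eq0 negb_and s0 /= -[X in (_ <= X)%N]sk.
  by apply: dvdp_leq => //; exact: dvdp_gcdl.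
rewrite -sum1_card (partition_big (fun t => inord (size (h t)).-1 : 'I_k.+1) xpredT)//=.
rewrite -[k.+1 in leqRHS]card_ord -sum_nat_const; apply: leq_sum => a _.
rewrite sum1_card.
have ak : (a <= k)%N by rewrite -ltnS.
apply: leq_trans (card_det_small_slice ak); apply: subset_leq_card.
apply/fintype.subsetP => t; rewrite !inE => /andP[td /eqP ta].
rewrite inE in td; rewrite td /=; have /andP[h0 hk1] := hk t td.
have hlt : ((size (h t)).-1 < k.+1)%N by rewrite prednK.
by rewrite -/(h t) -ta inordK// prednK.
Qed.

End PolynomialCounting.

(** * Number of bad pairs *)

Section BadPairs.
Variable F : finFieldType.
Local Notation K := (laurent F).
Local Notation q := #|F|.

Lemma lpolyM (p1 p2 : {poly F}) : lpoly p1 * lpoly p2 = lpoly (p1 * p2).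
Proof.
apply: laurentP => -[m|m] /=; last first.
  rewrite /lconv fsbig1// => -[i|i] _; rewrite ?mul0r//.
  by rewrite (_ : Negz m - Posz i = Negz (m + i)) ?mulr0//; lia.
rewrite coefM /lconv (@fsbigE _ _ _ _ _ [seq (i : nat)%:Z | i <- iota 0 m.+1]).
- rewrite (eq_bigl xpredT) => [|i]; last exact: classical_sets.in_setT.
  rewrite big_map -[X in iota _ X]subn0 -/(index_iota 0 m.+1) big_mkord.
  apply: eq_bigr => i _; have im := ltn_ord i.
  by rewrite (_ : m%:Z - i%:Z = (m - i)%N :> int)//; lia.
- by rewrite map_inj_uniq ?iota_uniq// => ? ? [].
- by [].
- move=> [i|i] _ im; last by rewrite mul0r.
  case E: (m%:Z - i%:Z) => [l|l]; last by rewrite mulr0.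
  by move: im; rewrite mem_map => [|? ? []//]; rewrite mem_iota; lia.
Qed.

Lemma lpolyB (p1 p2 : {poly F}) : lpoly p1 - lpoly p2 = lpoly (p1 - p2).
Proof. by apply: laurentP => -[m|m] /=; rewrite ?coefB ?subrr. Qed.

Lemma lpoly_bounded (p : {poly F}) (d : nat) : lbounded (lpoly p) (d%:Z - 1) -> (size p <= d)%N.
Proof.
move=> pd; apply/leq_sizeP => i di; apply: (pd i%:Z); lia.
Qed.

Variables (n k : nat).
Local Notation V := 'M['rV[F]_k.+1]_(n, 1).

Lemma pvec_poly (x : V) i : pvec x i 0 = lpoly (rVpoly (x i 0)).
Proof.
apply: laurentP => m; rewrite /pvec mxE /=.
by congr (lpoly _ _); lia.
Qed.

Definition bad_at (j : nat) i (x y : V) :=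
  (x i 0 0 ord_max != 0) && `[< mball (- j%:Z) (residual (pvec x) (pvec y) i) >].

Lemma bad_at_size j i x y i' : (j <= k.+1)%N -> bad_at j i x y ->
  size (rVpoly (x i 0)) = k.+1 /\
  (size (rVpoly (y i' 0) * rVpoly (x i 0) - rVpoly (y i 0) * rVpoly (x i' 0))%R
    <= k.+1 - j)%N.
Proof.
move=> jk /andP[xi /asboolP res]; split.
  apply/eqP; rewrite eqn_leq size_poly /= ltnNge; apply/negP => sz.
  move/eqP: xi; apply; rewrite -coef_rVpoly_ord /=.
  exact: nth_default.
have vi : is_ldeg (pvec x i 0) k by split; [rewrite pvec_lead|exact: pvec_ball].
apply: lpoly_bounded; rewrite -lpolyB -!lpolyM -!pvec_poly.
have := lboundedM (res i' 0) vi.2.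
rewrite (residual_mulE _ _ (is_ldeg_neq0 vi)).
by apply: lboundedW; lia.
Qed.

(** Coordinates [i] and [i1] of both vectors form a quadruple with small determinant, and the other
    [n - 2] coordinates of [x] are free. The other coordinates of [y] are then determined: two
    choices would differ by a nonzero polynomial whose product with the coordinate [x i 0], of
    degree [k], has degree at most [k - j], which [0 < j] forbids. *)
Lemma card_bad_at j i : (2 <= n)%N -> (0 < j <= k.+1)%N ->
  (#|[set xy : V * V | bad_at j i xy.1 xy.2]%SET|
   <= k.+1 * q ^ (3 * k + 5 - j) * q ^ (k.+1 * (n - 2)))%N.
Proof.
move=> n2 /andP[j0 jk].
have [i1 ii1] : exists i1 : 'I_n, i1 != i.
  have n0 : (0 < n)%N by lia.
  case: (eqVneq i (Ordinal n0)) => [->|]; last by exists (Ordinal n0); rewrite eq_sym.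
  by exists (Ordinal n2); rewrite -val_eqE.
pose I' := {i' : 'I_n | (i' != i) && (i' != i1)}.
pose T := 'rV[F]_k.+1.
pose f (xy : V * V) : (T * T * T * T) * {ffun I' -> T} :=
  ((xy.1 i 0, xy.1 i1 0, xy.2 i 0, xy.2 i1 0), [ffun i' => xy.1 (val i') 0]).
set A := finset _.
have fi : {in A &, injective f}.
  move=> [x y] [x' y']; rewrite !inE /= => b b' [xi xi1 yi yi1 /ffunP rest].
  have xx : x = x'.
    apply/matrixP => i' j'; rewrite ord1.
    have [->//|i'i] := eqVneq i' i; have [->//|i'i1] := eqVneq i' i1.
    have i'P : (i' != i) && (i' != i1) by rewrite i'i.
    by have := rest (exist _ i' i'P); rewrite !ffunE.
  congr (_, _) => //; apply/matrixP => i' j'; rewrite ord1.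
  apply: (can_inj (@rVpolyK _ _)); apply/eqP; rewrite -subr_eq0; apply/eqP.
  have [sx s1] := bad_at_size i' jk b; have [_ s2] := bad_at_size i' jk b'.
  have x0 : rVpoly (x i 0) != 0 by rewrite -size_poly_gt0 sx.
  apply/eqP; apply: contraT => d0.
  have : (size ((rVpoly (y i' 0) - rVpoly (y' i' 0)) * rVpoly (x i 0))%R <= k.+1 - j)%N.
    rewrite (_ : _ * _ = (rVpoly (y i' 0) * rVpoly (x i 0) - rVpoly (y i 0) * rVpoly (x i' 0))
      - (rVpoly (y' i' 0) * rVpoly (x' i 0) - rVpoly (y' i 0) * rVpoly (x' i' 0))).
      by rewrite (leq_trans (size_polyD _ _))// size_polyN geq_max s1.
    by rewrite -xx -yi; ring.
  have : (0 < size (rVpoly (y i' 0) - rVpoly (y' i' 0))%R)%N by rewrite size_poly_gt0.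
  rewrite size_mul// sx => h1 h2; move: h1 h2 j0 jk; clear; move: (size _) => m.
  lia.
rewrite -(card_in_imset fi).
have sub : f @: A \subset finset.setX [set t | det_small j t]%SET [set: {ffun I' -> T}]%SET.
  apply/fintype.subsetP => _ /imsetP[[x y] +  ->]; rewrite !inE /= => b.
  rewrite andbT /det_small.
  have [sx s1] := bad_at_size i1 jk b.
  by rewrite sx eqxx.
apply: leq_trans (subset_leq_card sub) _; rewrite cardsX leq_mul//.
  exact: card_det_small.
rewrite cardsT card_ffun card_rV -expnM leq_exp2l; last exact: card_finNzRing_gt1.
rewrite leq_mul2l card_sig; apply/orP; right.
have := cardC (pred2 i i1); rewrite card2 eq_sym ii1 card_ord => nE.
rewrite (eq_card (B := predC (pred2 i i1))); first by rewrite leq_subRL// nE.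
by move=> l; rewrite !inE negb_or.
Qed.

End BadPairs.

(** * Bound for the variance *)

Section VarianceBound.
Variables (R : realType) (F : finFieldType).
Local Notation K := (laurent F).
Local Notation q := (#|F|%:R : R).
Variables (n : nat) (Q : 'cV[K]_n -> K).
Hypothesis n2 : (2 <= n)%N.
Hypothesis Qf : quadratic_form Q.
Local Notation B := (polar_form Q).
Local Notation e i := (delta_mx i 0 : 'cV[K]_n).
Variables c c0 : nat.
Hypothesis Qc : forall k v, mball k v -> lbounded (Q v) (k + k + c%:Z).
Hypothesis Bc : forall k l u v, mball k u -> mball l v -> lbounded (B u v) (k + l + c%:Z).
Hypothesis Bc0 : forall k v, mdeg k v ->
  exists i, exists2 d, k - c0%:Z <= d & is_ldeg (B v (e i)) d.
Let r : nat := (c + c0).+1.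
Variables (M : nat) (J : set K).
Hypothesis cM : (c <= M)%N.
Hypothesis JM : J `<=` lball F M%:Z.

Let f (z : 'cV[K]_n) : R := (Q z \in J)%:R.

Section Fixed.
Variable k : nat.
Local Notation V := 'M['rV[F]_k.+1]_(n, 1).

(** The bound of [pair_bound] for a residual of degree [l = -j]. *)
Definition bad_weight (j : nat) : R :=
  n%:R * q ^ (M%:Z + c0%:Z + r%:Z - k%:Z - k%:Z) * q ^ (M%:Z - k%:Z + c0%:Z + j%:Z + 1).

Lemma bad_weight_ge0 j : 0 <= bad_weight j.
Proof. by rewrite !mulr_ge0// exprz_ge0// ltW// q_gt0. Qed.

(** Multiplied by the coordinate of degree [k], the residual becomes a polynomial minor, which has
    no coefficient at a negative exponent. *)
Lemma residual_deg (x y : V) i i' l : x i 0 0 ord_max != 0 ->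
  is_ldeg (residual (pvec x) (pvec y) i i' 0) l -> - k%:Z <= l.
Proof.
move=> xi rl; have vi : is_ldeg (pvec x i 0) k by split; [rewrite pvec_lead|exact: pvec_ball].
have := is_ldegM rl vi.
rewrite (residual_mulE _ _ (is_ldeg_neq0 vi)).
rewrite !pvec_poly !lpolyM lpolyB => -[+ _].
by case E: (l + k%:Z) => [m|m]; [lia|rewrite /= eqxx].
Qed.

Lemma bad_pair_le N (x y : V) : (k + k + k + c + c0 <= N)%N -> onsphere x ->
  onsphere y -> bad x y ->
  avg N (-1) (fun E : 'M[K]_n => f (pvec x + E *m pvec x) * f (pvec y + E *m pvec y))
  <= \sum_(j < k.+1) \sum_i (bad_at j.+1 i x y)%:R * bad_weight j.+1.
Proof.
move=> NN /onsphereP xk /onsphereP yk /existsP[i /andP[xi /asboolP eb]].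
have vi : is_ldeg (pvec x i 0) k by split; [rewrite pvec_lead|exact: pvec_ball].
set v := pvec x in eb vi xk *; set w := pvec y in eb yk *; pose th := w i 0 / v i 0.
have sumge (j : 'I_k.+1) : bad_at j.+1 i x y ->
    bad_weight j.+1 <= \sum_(j < k.+1) \sum_i (bad_at j.+1 i x y)%:R * bad_weight j.+1.
  move=> b; rewrite (bigD1 j)//= (bigD1 i)//= b mul1r -addrA lerDl addr_ge0//.
    by apply: sumr_ge0 => i' _; rewrite mulr_ge0// bad_weight_ge0.
  apply: sumr_ge0 => j' _; apply: sumr_ge0 => i' _.
  by rewrite mulr_ge0// bad_weight_ge0.
have fJ z : 0 <= f z <= (small Q M z)%:R.
  rewrite /f ler0n ler_nat /small; case: (boolP (Q z \in J)) => // /set_mem/JM H.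
  by rewrite mem_set.
(* For proportional vectors only the first condition is used: [single_bound] is enough, because the
   last factor of the weight at [j = k.+1] is at least 1. *)
have [e0|e0] := eqVneq (residual v w i) 0.
  have b : bad_at (@ord_max k).+1 i x y.
    by rewrite /bad_at xi; apply/asboolP; rewrite -/v -/w e0; exact: mball0.
  apply: le_trans (sumge _ b).
  apply: (@le_trans _ _ (avg N (-1) (fun E : 'M[K]_n => (small Q M (v + E *m v))%:R))).
    apply: le_avg => E E1; have /andP[f1 f1'] := fJ (v + E *m v).
    have /andP[f2 f2'] := fJ (w + E *m w).
    rewrite -[leRHS]mulr1 ler_pM//; apply: le_trans f2' _.
    by case: (small _ _ _).
  apply: le_trans (single_bound R Qf Qc Bc Bc0 _ xk _) _; first by lia.
  rewrite /bad_weight ler_peMr ?mulr_ge0 ?exprz_ge0 ?(ltW (q_gt0 R F))//.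
  by rewrite -(expr0z q) ler_eXz2l ?q_gt1// /=; lia.
have [l [[el _] [i' ri']]] := mdeg_exP e0.
have l1 : l <= -1.
  by apply: lbounded_ldeg ri' _; exact: eb.
have lk : - k%:Z <= l := residual_deg xi ri'.
have jk : ((absz l).-1 < k.+1)%N by lia.
have jE : (Ordinal jk).+1%:Z = - l by rewrite /=; lia.
have b : bad_at (Ordinal jk).+1 i x y.
  rewrite /bad_at xi; apply/asboolP; rewrite jE opprK; exact: el.
apply: le_trans (sumge _ b).
have v0 := is_ldeg_neq0 vi.
have th0 : lbounded th 0.
  by rewrite -(subrr k%:Z); apply: lbounded_div vi; exact: yk.1.
have wE : w = th *: v + residual v w i by rewrite /residual addrC subrK.
(* Both vectors have degree [k] and the residual is smaller, so [th] is a unit. *)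
have thd : is_ldeg th 0.
  split=> //; apply/eqP => th00.
  have th1 : lbounded th (-1) by rewrite -(sub0r 1); exact: lbounded_lead.
  have [_ [i2 /eqP wi2]] := yk; apply: wi2.
  suff : mball (k%:Z - 1) w by move=> /(_ i2 0 k%:Z) ->//; lia.
  rewrite wE; apply: mballD.
    by apply: mballW (mballZ th1 xk.1); lia.
  by apply: mballW el; lia.
have := pair_bound R Qf Qc Bc Bc0 M xk.1 vi (residual0 w v0) el ri' l1 lk NN.
rewrite /bad_weight jE (_ : M%:Z - k%:Z + c0%:Z + - l + 1 = M%:Z - k%:Z + c0%:Z - (l - 1)); last by lia.
apply: le_trans; apply: le_avg => E E1; rewrite /f -natrM ler_nat.
case: (boolP (Q (v + E *m v) \in J)) => // /set_mem/JM Qv; rewrite mul1n.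
case: (boolP (Q (w + E *m w) \in J)) => // /set_mem/JM Qw.
rewrite /small mem_set// asboolT//.
set a := v + E *m v in Qv *; set b' := residual v w i + E *m residual v w i.
have bb : mball (-1) b' by apply: mball_1E => //; apply: mballW el; lia.
have wab : w + E *m w = th *: a + b'.
  by rewrite {1 2}wE mulmxDr -scalemxAr /a /b' scalerDr addrACA.
apply: (lboundedMK thd).
(* Two smallness conditions on [Q] thus give one that is linear in the residual; [cM] takes care of
   [Q b']. *)
have -> : th * B a b' = Q (w + E *m w) - th * (th * Q a) - Q b'.
  by rewrite wab (qfD Q (th *: a) b') (qfZ Qf) (polarZl Qf); ring.
apply: lboundedB; last by apply: lboundedW (Qc bb); lia.
apply: lboundedB; first by apply: lboundedW Qw; lia.
by apply: lboundedW (lboundedM th0 (lboundedM th0 Qv)); lia.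
Qed.

(** The bound on the number of bad pairs times the weight does not depend on [j]. The sum over [j]
    and the degrees of the gcd give the square of [k.+1]; the index [i] and the union bound over
    directions give that of [n]. *)
Lemma sum_bad_le : \sum_(x : V) \sum_(y : V)
    \sum_(j < k.+1) \sum_i (bad_at j.+1 i x y)%:R * bad_weight j.+1
  <= n%:R ^+ 2 * q ^+ (2 * M + 2 * c0 + r + n + 4) * (k.+1)%:R ^+ 2 * q ^+ ((n - 2) * k).
Proof.
have -> : \sum_(x : V) \sum_(y : V)
    \sum_(j < k.+1) \sum_i (bad_at j.+1 i x y)%:R * bad_weight j.+1 =
  \sum_(j < k.+1) \sum_i #|[set xy : V * V | bad_at j.+1 i xy.1 xy.2]%SET|%:R * bad_weight j.+1.
  rewrite pair_big exchange_big; apply: eq_bigr => j _; rewrite exchange_big.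
  apply: eq_bigr => i _; rewrite -mulr_suml -natr_sum -sum1_card; congr (_%:R * _).
  by rewrite [RHS]big_mkcond; apply: eq_bigr => -[x y] _; rewrite inE.
apply: (@le_trans _ _ (\sum_(j < k.+1) \sum_(i < n)
    n%:R * q ^+ (2 * M + 2 * c0 + r + n + 4) * (k.+1)%:R * q ^+ ((n - 2) * k))).
  apply: ler_sum => j _; apply: ler_sum => i _.
  have jk : (0 < j.+1 <= k.+1)%N by rewrite /= ltn_ord.
  have := card_bad_at F i n2 jk; rewrite -(ler_nat R) => H.
  apply: le_trans (ler_wpM2r (bad_weight_ge0 _) H) _.
  rewrite !natrM !natrX /bad_weight.
  rewrite le_eqVlt; apply/orP; left; apply/eqP.
  set a1 := q ^+ _; set a2 := q ^+ _; set a3 := q ^ _; set a4 := q ^ _.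
  set a5 := q ^+ _; set a6 := q ^+ _.
  transitivity (n%:R * k.+1%:R * (a5 * a6 * a3 * a4)); first by ring.
  transitivity (n%:R * k.+1%:R * (a1 * a2)); last by ring.
  rewrite /a1 /a2 /a3 /a4 /a5 /a6.
  congr (_ * _); rewrite !exprnP -!expfzDr ?q_neq0//; congr (_ ^ _).
  have jk' := ltn_ord j.
  have -> : ((n - 2) * k)%:Z = n%:Z * k%:Z - 2 * k%:Z.
    by rewrite PoszM -subzn// mulrBl.
  have -> : (k.+1 * (n - 2))%:Z = n%:Z * k%:Z - 2 * k%:Z + n%:Z - 2.
    by rewrite PoszM -subzn//; lia.
  by lia.
rewrite sumr_const card_ord sumr_const card_ord -[leLHS]mulr_natl -[X in _ * X <= _]mulr_natl.
by rewrite le_eqVlt; apply/orP; left; apply/eqP; ring.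
Qed.

End Fixed.

Lemma variance_le N (k : nat) (L : int) : linvariant L J ->
  k%:Z + k%:Z + k%:Z + c%:Z + c0%:Z <= N%:Z + L -> (k + k + k + c + c0 <= N)%N ->
  avg N (-1) (fun E => (rotated_sum k f E - sphere_sum N k f) ^+ 2) <=
  n%:R ^+ 2 * q ^+ (2 * M + 2 * c0 + r + n + 4) * (k.+1)%:R ^+ 2 * q ^+ ((n - 2) * k).
Proof.
move=> JL NL NN; apply: le_trans (sum_bad_le k).
apply: (le_trans (variance_rotated_sum _ _)).
- by move=> z.
- by apply: (qf_ball_invariant R Qc Bc JL); lia.
have ge0 (x y : 'M['rV[F]_k.+1]_(n, 1)) : 0 <= \sum_(j < k.+1) \sum_i (bad_at j.+1 i x y)%:R * bad_weight k j.+1.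
  apply: sumr_ge0 => j _; apply: sumr_ge0 => i _.
  by rewrite mulr_ge0// bad_weight_ge0.
rewrite big_mkcond; apply: ler_sum => x _; case: ifP => xk; last exact: sumr_ge0.
rewrite big_mkcond; apply: ler_sum => y _; case: ifP => // /andP[yk xy].
exact: bad_pair_le.
Qed.

End VarianceBound.

(** * Regularity of the Haar measure *)

Section Regularity.
Variables (R : realType) (F : finFieldType).
Local Notation K := (laurent F).
Variable mK : {measure set (borel K) -> \bar R}.
Hypothesis mK_haar : haar_measure K +%R mK.
Hypothesis mK1 : mK (laurent_integers F) = 1%E.

Lemma le_mK (A B : set K) : measurable (A : set (borel K)) ->
  measurable (B : set (borel K)) -> A `<=` B -> (mK A <= mK B)%E.
Proof. by move=> mA mB AB; apply: le_measure => //; rewrite inE. Qed.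

Lemma mK_bounded_fin (M : int) (A : set K) : measurable (A : set (borel K)) ->
  A `<=` lball F M -> (mK A < +oo)%E.
Proof.
move=> mA AM; apply: (@le_lt_trans _ _ (mK (lball F M))).
  by apply: le_mK => //; exact: linvariant_borel (linvariant_lball (lexx _)).
by rewrite (mK_lball mK_haar mK1) ltry.
Qed.

Lemma increasing_approx (M : int) (J : (set K)^nat) (eps : R) : 0 < eps ->
  (forall n, exists L, linvariant L (J n)) -> {homo J : n m / (n <= m)%N >-> n `<=` m} ->
  (forall n, J n `<=` lball F M) ->
  exists n, open (\bigcup_i J i `\` J n) /\ (mK (\bigcup_i J i `\` J n) <= eps%:E)%E.
Proof.
move=> e0 JL Jinc JM; set U := \bigcup_i J i.
have Uo : open U by apply: bigcup_open => i _; have [L /linvariant_open] := JL i.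
have Do n : open (U `\` J n).
  have [L Ln] := JL n; rewrite setDE; apply: openI => //.
  exact: linvariant_open (linvariantC Ln).
have UM : U `<=` lball F M by move=> y [i _ /JM].
have cv : (mK \o (fun n => U `\` J n)) x @[x --> \oo] --> mK (\bigcap_n (U `\` J n)).
  apply: nonincreasing_cvg_mu.
  - by apply: (@mK_bounded_fin M); [exact: open_borel|move=> y [/UM]].
  - by move=> n; exact: open_borel.
  - by apply: bigcapT_measurable => n; exact: open_borel.
  - by move=> n m nm; apply/subsetPset => y [Uy Jy]; split=> // /(Jinc _ _ nm).
have cap0 : \bigcap_n (U `\` J n) = set0.
  apply/seteqP; split=> // y H; have [[i _ Jy] _] := H 0%N I.
  by have [_] := H i I.
rewrite cap0 measure0 in cv.
have /cv [n _ Hn] : nbhs (0%E : \bar R) [set x | (x < eps%:E)%E].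
  by apply: open_ereal_lt'; rewrite lte_fin.
by exists n; split=> //; apply/ltW/(Hn n) => /=.
Qed.

(** [W] is required to be open so that it can be exhausted by sets invariant under a ball, for which
    the counting averages are available. *)
Definition clopen_approx (M : int) (eps : R) (A J W : set K) :=
  [/\ exists L, linvariant L J, J `<=` lball F M, open W, (mK W <= eps%:E)%E
    & forall y, lball F M y -> W y \/ (A y <-> J y)].

Definition approximable (A : set K) := forall (M : int) (eps : R), 0 < eps ->
  exists J W, clopen_approx M eps A J W.

Lemma open_exhaustion (M : int) (A : set K) : open A ->
  exists J : (set K)^nat, [/\ forall n, exists L, linvariant L (J n),
    {homo J : n m / (n <= m)%N >-> n `<=` m}, forall n, J n `<=` lball F M &
    \bigcup_n J n = A `&` lball F M].
Proof.
move=> Ao.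
pose J n : set K := [set y | lball F M y /\ forall d : K, lbounded d (- n%:Z) -> A (y + d)].
have JL n : linvariant (Num.min (- n%:Z) M) (J n).
  move=> y d [yM yA] dL; split.
    by apply: lboundedD => //; apply: lboundedW dL; rewrite ge_min lexx orbT.
  move=> d' dn; rewrite -addrA; apply: yA; apply: lboundedD => //.
  by apply: lboundedW dL; rewrite ge_min lexx.
exists J; split.
- by move=> n; exists (Num.min (- n%:Z) M).
- move=> n m nm y [yM yA]; split=> // d dm; apply: yA; apply: lboundedW dm; lia.
- by move=> n y [].
apply/seteqP; split=> [y [n _ [yM yA]]|y [Ay yM]].
  by split=> //; rewrite -[y]addr0; apply: yA.
have [L LA] : exists L : int, forall z : K, lbounded (z - y) L -> A z.
  by apply/nbhs_lbounded; exact: open_nbhs_nbhs.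
exists (absz L) => //; split=> // d dL; apply: LA; rewrite addrC addKr.
by apply: lboundedW dL; lia.
Qed.

Lemma open_approximable A : open A -> approximable A.
Proof.
move=> Ao M eps e0; have [J [JL Jinc JM JE]] := open_exhaustion M Ao.
have [n [Wo We]] := increasing_approx e0 JL Jinc JM.
exists (J n), (\bigcup_i J i `\` J n); split=> //.
move=> y yM; have [Jy|Jy] := pselect (J n y).
  right; split=> // _.
  by have [] : (A `&` lball F M) y by rewrite -JE; exists n.
have [Ay|Ay] := pselect (A y); last by right; split.
by left; split=> //; rewrite JE.
Qed.

(** In a countable union the set of index [i] is approximated within [eps / 2 ^ (i + 2)]; the
    remaining [eps / 2] pays for stopping the union of the approximations at a finite stage, where
    it is still invariant under some ball. *)
Lemma approximable_sigma_algebra : sigma_algebra setT approximable.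
Proof.
split.
- move=> M eps e0; exists set0, set0; split.
  + by exists 0.
  + exact: sub0set.
  + exact: open0.
  + by rewrite measure0 lee_fin ltW.
  + by move=> y _; right.
- move=> A AA M eps e0; have [J [W [[L JL] JM Wo We AJ]]] := AA M eps e0.
  exists (lball F M `\` J), W; split=> //; last 1 first.
  + move=> y yM; have [?|AJy] := AJ y yM; [by left|right].
    by split=> [[_ Ay]|[_ Jy]]; split=> //; tauto.
  + exists (Num.min L M); rewrite setDE; apply: linvariantI.
      by apply: linvariant_lball; rewrite ge_min lexx orbT.
    by apply: linvariantW (linvariantC JL); rewrite ge_min lexx.
- move=> A AA M eps e0.
  have e4 n : 0 < eps / 2 / (2 ^ n.+1)%:R.
    by rewrite divr_gt0// ?divr_gt0// ltr0n expn_gt0.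
  have /choice[JW HJW] : forall n, exists JW : set K * set K,
      clopen_approx M (eps / 2 / (2 ^ n.+1)%:R) (A n) JW.1 JW.2.
    by move=> n; have [J [W H]] := AA n M _ (e4 n); exists (J, W).
  pose J n := (JW n).1; pose W n := (JW n).2.
  pose U n := \bigcup_(i in `I_n) J i.
  have UL n : exists L, linvariant L (U n).
    elim: n => [|n [L IH]]; first by exists 0; rewrite /U II0 bigcup_set0.
    have [[L' JL'] _ _ _ _] := HJW n; exists (Num.min L L').
    rewrite /U IIS bigcup_setU bigcup_set1; apply: linvariantU.
      by apply: linvariantW IH; rewrite ge_min lexx.
    by apply: linvariantW JL'; rewrite ge_min lexx orbT.
  have UM n : U n `<=` lball F M by move=> y [i _]; have [_ JM _ _ _] := HJW i; exact: JM.
  have UE : \bigcup_i U i = \bigcup_i J i.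
    apply/seteqP; split=> y; first by move=> [n _ [i _ Ji]]; exists i.
    by move=> [i _ Ji]; exists i.+1 => //; exists i => /=.
  have [|||n [Wo We]] := @increasing_approx M U (eps / 2) _ UL.
  + by rewrite divr_gt0.
  + by move=> n m nm y [i /= im Ji]; exists i => //=; exact: leq_trans im nm.
  + exact: UM.
  have Wio i : open (W i) by have [_ _ ? _ _] := HJW i.
  have Wuo : open (\bigcup_i W i) by apply: bigcup_open => i _; exact: Wio.
  exists (U n), (\bigcup_i W i `|` (\bigcup_i U i `\` U n)); split=> //.
  + exact: openU.
  + apply: (@le_trans _ _ (mK (\bigcup_i W i) + mK (\bigcup_i U i `\` U n))%E).
      by apply: measureU2; exact: open_borel.
    rewrite [eps]splitr EFinD; apply: leeD => //.
    apply: (@le_trans _ _ (\sum_(0 <= i <oo) mK (W i))%E).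
      apply: measure_sigma_subadditive => //.
      * by move=> i; exact: open_borel.
      * exact: open_borel.
    apply: le_trans (epsilon_trick0 xpredT _); last by rewrite ltW// divr_gt0.
    by apply: lee_nneseries => // i _; have [_ _ _ ? _] := HJW i.
  + move=> y yM; have [[i Wi]|nW] := pselect (exists i, W i y).
      by left; left; exists i.
    have AJ i : A i y <-> J i y.
      have [_ _ _ _ H] := HJW i; have [Wy|//] := H y yM.
      by exfalso; apply: nW; exists i.
    have [Uy|Uy] := pselect (U n y).
      right; split=> // _; have [i _ Ji] := Uy; exists i => //; exact/AJ.
    have [[i Ji]|nJ] := pselect (exists i, J i y).
      by left; right; split=> //; rewrite UE; exists i.
    by right; split=> // -[i _ /AJ Ji]; exfalso; apply: nJ; exists i.
Qed.

Lemma borel_approximable (A : set K) : measurable (A : set (borel K)) -> approximable A.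
Proof.
apply: smallest_sub; first exact: approximable_sigma_algebra.
exact: open_approximable.
Qed.

Local Notation mKext := (@completed_measure_extension _ _ R mK).

Lemma mKextE (A : set K) : measurable (A : set (borel K)) -> mKext A = mK A.
Proof. exact: measurable_mu_extE. Qed.

Lemma completed_approx (M : int) (eps : R) (I : set K) : 0 < eps ->
  completed_algebra_gen mK I -> I `<=` lball F M ->
  exists J W, clopen_approx M eps I J W /\
    `|fine (mK J) - fine (mKext I)| <= eps.
Proof.
move=> e0 [A mA [N [Z [mZ Z0 NZ]]]] IE IM.
have e3 : 0 < eps / 3 by rewrite divr_gt0.
have [J [W [[L JL] JM Wo We AJ]]] := borel_approximable mA M e3.
(* The null set [Z] is approximated as well: [J'] then has measure at most [eps / 3] and can join
   the exceptional open set. *)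
have [J' [W' [[L' JL'] JM' Wo' We' AJ']]] := borel_approximable mZ M e3.
have Jo := linvariant_open JL; have Jo' := linvariant_open JL'.
have J'e : (mK J' <= (eps / 3)%:E)%E.
  apply: (@le_trans _ _ (mK (Z `|` W'))).
    apply: le_mK; [exact: open_borel|apply: measurableU => //; exact: open_borel|].
    move=> y Jy; have [|ZJ] := AJ' y (JM' _ Jy); first by right.
    by left; exact/ZJ.
  apply: (@le_trans _ _ (mK Z + mK W')%E).
    by apply: measureU2 => //; exact: open_borel.
  by rewrite Z0 add0e.
pose V := W `|` J' `|` W'.
have Vo : open V by do 2 apply: openU => //.
have Ve : (mK V <= eps%:E)%E.
  rewrite (_ : eps%:E = ((eps / 3)%:E + (eps / 3)%:E + (eps / 3)%:E)%E); last first.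
    by rewrite -!EFinD; congr EFin; field.
  apply: (@le_trans _ _ (mK (W `|` J') + mK W')%E).
    by apply: measureU2; apply: open_borel => //; exact: openU.
  apply: leeD => //; apply: (@le_trans _ _ (mK W + mK J')%E).
    by apply: measureU2; exact: open_borel.
  exact: leeD.
have IJ y : lball F M y -> V y \/ (I y <-> J y).
  move=> yM; have [Wy|AJy] := AJ y yM; first by left; left; left.
  have [Wy|ZJy] := AJ' y yM; first by left; right.
  have [Jy|Jy] := pselect (J' y); first by left; left; right.
  right; rewrite -IE -AJy; split=> [[//|/NZ]|]; last by left.
  by move=> /ZJy.
have Jm := open_borel Jo; have Vm := open_borel Vo.
exists J, V; split; first by split=> //; exists L.
have Jfin : mK J \is a fin_num by rewrite ge0_fin_numE//; exact: mK_bounded_fin JM.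
have Vfin : mK V \is a fin_num.
  by rewrite ge0_fin_numE//; apply: le_lt_trans Ve _; exact: ltry.
have le1 : (mK J <= mKext I + mK V)%E.
  rewrite -!mKextE//; apply: le_trans (outer_measureU2 _ _ _).
  apply: le_mu_ext => y Jy; have [Vy|IJy] := IJ y (JM _ Jy); first by right.
  by left; exact/IJy.
have le2 : (mKext I <= mK J + mK V)%E.
  rewrite -!mKextE//; apply: le_trans (outer_measureU2 _ _ _).
  apply: le_mu_ext => y Iy; have [Vy|IJy] := IJ y (IM _ Iy); first by right.
  by left; exact/IJy.
have Ifin : mKext I \is a fin_num.
  rewrite ge0_fin_numE; last exact: mu_ext_ge0.
  by apply: le_lt_trans le2 _; rewrite -ge0_fin_numE ?adde_ge0// fin_numD Jfin.
move: le1 le2 Ve; rewrite -(fineK Jfin) -(fineK Vfin) -(fineK Ifin) -!EFinD !lee_fin /=.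
by move=> h1 h2 h3; rewrite ler_distl; apply/andP; split; lra.
Qed.

End Regularity.

(** * The group and its Haar measure *)

Section PrincipalUnits.
Variables (F : finFieldType) (n : nat).
Local Notation K := (laurent F).
Local Notation G := (absdet1_group F n).

(** In the Leibniz expansion the identity contributes a product of units, and every other
    permutation involves an off-diagonal entry of degree at most -1. *)
Lemma is_ldeg_det_1E (E : 'M[K]_n) : mball (-1) E -> is_ldeg (\det (1%:M + E)) 0.
Proof.
move=> E1; have E0 : mball 0 (1%:M + E).
  apply: mballD; last by apply: mballW E1; lia.
  by move=> i j; rewrite mxE; case: (_ == _); [exact: (is_ldeg1 F).2|].
have diag i : is_ldeg ((1%:M + E) i i) 0.
  by rewrite !mxE eqxx; apply: is_ldegD => //; exact: is_ldeg1.
rewrite /determinant (bigD1 (1%g : 'S_n))//=; apply: is_ldegD.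
  rewrite odd_perm1 expr0 mul1r.
  apply: (big_ind (fun f : K => is_ldeg f 0)) => [|f g f0 g0|i _].
  - exact: is_ldeg1.
  - by have := is_ldegM f0 g0.
  - by rewrite perm1.
apply: lbounded_sum => s s1.
have [i si] : exists i, s i != i.
  apply: contrapT => /forallNP H; move/eqP: s1; apply; apply/permP => i.
  by rewrite perm1; have /negP/negPn/eqP := H i.
have sgn : lbounded ((-1) ^+ s : K) 0.
  case: (odd_perm s); last exact: (is_ldeg1 F).2.
  by apply: lboundedN; exact: (is_ldeg1 F).2.
have H : lbounded (\prod_(j | j != i) (1%:M + E) j (s j)) 0.
  apply: (big_ind (fun f : K => lbounded f 0)) => [|f g f0 g0|j _].
  - exact: (is_ldeg1 F).2.
  - by have := lboundedM f0 g0.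
  - exact: E0.
rewrite (bigD1 i)//=; apply: lboundedW (lboundedM sgn (lboundedM (b := 0) (a := -1) _ H)) => //.
by rewrite !mxE eq_sym (negbTE si) add0r; exact: E1.
Qed.

Lemma labs1P (f : K) : labs f = 1 <-> is_ldeg f 0.
Proof.
split=> [f1|f0]; last by rewrite /labs (negbTE (is_ldeg_neq0 f0)) (ldegE f0) expr0z.
have f0 : f != 0 by rewrite -labs_eq0 f1 oner_neq0.
have fd := ldegP f0; suff <- : ldeg f = 0 by [].
apply/eqP; move: f1; rewrite /labs (negbTE f0) => /eqP.
rewrite -(expr0z #|F|%:R) => /eqP /ieexprIz -> //; last by rewrite gt_eqF// card_gt1.
by rewrite Defs.card_gt0.
Qed.

Lemma absdet1_1E (E : 'M[K]_n) : mball (-1) E -> absdet1 (1%:M + E).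
Proof. by move=> E1; apply/labs1P/is_ldeg_det_1E. Qed.

Lemma absdet1_unitmx (A : 'M[K]_n) : absdet1 A -> A \in unitmx.
Proof. by move=> /labs1P /is_ldeg_neq0; rewrite unitmxE unitfE. Qed.

Definition mkG (A : 'M[K]_n) (AP : absdet1 A) : G :=
  @exist 'M[K]_n (fun A => A \in @absdet1 F n) A (mem_set AP).

Lemma absdet1_val (g : G) : absdet1 (val g).
Proof. exact: set_mem (valP g). Qed.

Lemma absdet1M (A A' : 'M[K]_n) : absdet1 A -> absdet1 A' -> absdet1 (A *m A').
Proof. by rewrite /absdet1 /= det_mulmx labsM => -> ->; rewrite mulr1. Qed.

Lemma inv_1E (E : 'M[K]_n) : mball (-1) E ->
  exists2 E', mball (-1) E' & (1%:M + E) *m (1%:M + E') = 1%:M.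
Proof.
move=> E1; have U := absdet1_unitmx (absdet1_1E E1).
exists (invmx (1%:M + E) - 1%:M); last by rewrite subrKC mulmxV.
(* [1 + E] maps this matrix to [- E]. *)
apply: (mball_isometry E1).
rewrite -{1}[_ - _]mul1mx -mulmxDl mulmxBr mulmxV// mulmx1.
by rewrite opprD addrA subrr sub0r; exact: mballN.
Qed.

Definition event (g0 : G) (Phi : set 'M[K]_n) : set G :=
  [set g | exists2 E, mball (-1) E /\ Phi E & val g = val g0 *m (1%:M + E)].

Lemma eventE g0 Phi (E : 'M[K]_n) g : mball (-1) E -> val g = val g0 *m (1%:M + E) ->
  event g0 Phi g <-> Phi E.
Proof.
move=> E1 gE; split=> [[E' [E1' PE'] gE']|PE]; last by exists E.
suff -> : E = E' by [].
have := congr1 (mulmx (invmx (val g0))) (etrans (esym gE) gE').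
by rewrite !(mulKmx (absdet1_unitmx (absdet1_val g0))) => /addrI.
Qed.

Lemma event_open g0 (s : int) (Phi : set 'M[K]_n) : s <= -1 ->
  ball_invariant s (-1) Phi -> open (event g0 Phi).
Proof.
move=> s1 Phis.
pose B : set 'M[K]_n := [set A | exists2 E, mball (-1) E /\ Phi E & A = val g0 *m (1%:M + E)].
exists B; last first.
  by apply/seteqP; split=> g.
rewrite openE => A [E [E1 PE] AE]; apply/nbhs_mball.
have [c cg] := mball_ex (invmx (val g0)).
exists (s - c%:Z) => A' A'A.
have D1 : mball s (invmx (val g0) *m (A' - A)).
  by apply: mballW (mballM cg A'A); lia.
exists (E + invmx (val g0) *m (A' - A)).
  split; last by rewrite Phis.
  by apply: mballD => //; apply: mballW D1.
rewrite addrA mulmxDr -AE (mulKVmx (absdet1_unitmx (absdet1_val g0))).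
by rewrite addrC subrK.
Qed.

Lemma event_cover (g : G) : exists (r N : nat) (x : 'M['rV[F]_N]_n) (g0 : G),
  val g0 = mpart r%:Z x /\ event g0 setT g.
Proof.
have U := absdet1_unitmx (absdet1_val g).
have [c cg] := mball_ex (invmx (val g)); have [r rg] := mball_ex (val g).
(* The truncation error has degree [r - N = -1 - c]; after multiplication by [invmx (val g)], of
   degree at most [c], it lies in the maximal ideal. *)
pose N := (r + 1 + c)%N; pose x := mtail N r%:Z (val g).
have Db := mtailK (N := N) rg; set D := _ - mpart _ _ in Db.
pose E := - (invmx (val g) *m D).
have E1 : mball (-1) E.
  by apply: mballN; apply: mballW (mballM cg Db); rewrite /N; lia.
have g0E : mpart r%:Z x = val g *m (1%:M + E).
  by rewrite mulmxDr mulmx1 /E mulmxN mulKVmx// /D subKr.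
have g0P : absdet1 (mpart r%:Z x).
  by rewrite g0E; apply: absdet1M; [exact: absdet1_val|exact: absdet1_1E].
exists r, N, x, (mkG g0P); split=> //.
have [E' E1' EE'] := inv_1E E1; exists E' => //=.
by rewrite g0E -mulmxA EE' mulmx1.
Qed.

Lemma ultra_finite (T : Type) (I : finType) (U : set_system T) (f : T -> I) :
  UltraFilter U -> exists a, U [set t | f t = a].
Proof.
move=> UU; apply: contrapT => /forallNP H.
have UC a : \forall t \near U, f t <> a.
  by have [//|] := in_ultra_setVsetC [set t | f t = a] UU; have := H a.
have /filter_ex [t] : \forall t \near U, forall a, f t <> a by exact: filter_forall.
by move=> /(_ (f t)).
Qed.

(** Along an ultrafilter each coefficient of each entry, having finitely many possible values, is
    eventually constant, and these constants form the limit. A neighbourhood tests only finitely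
    many of them, since those of nonnegative exponent are fixed by the identity matrix. *)
Lemma event_compact : compact (event (absdet1_one F n) setT).
Proof.
rewrite compact_ultra => U UU UE.
have /choice[a aP] : forall ijm : 'I_n * 'I_n * int, exists a : F,
    U [set g : G | (val g) ijm.1.1 ijm.1.2 ijm.2 = a].
  by move=> ijm; exact: ultra_finite.
have a_out i j (m : int) : -1 < m -> a (i, j, m) = (1%:M : 'M[K]_n) i j m.
  move=> m0.
  have /filter_ex [g /= [ga [E [E1 _] gE]]] :
      U ([set g : G | (val g) i j m = a (i, j, m)] `&` event (absdet1_one F n) setT).
    by apply: filterI; [exact: (aP (i, j, m))|].
  by rewrite -ga gE mul1mx mxE /= (E1 i j m m0) addr0.
have a_bounded i j : exists b, lbounded (fun m => a (i, j, m)) b.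
  exists 0 => m m0; rewrite a_out; last by lia.
  by rewrite mxE; case: (_ == _) => //=; rewrite gt_eqF.
pose A : 'M[K]_n := \matrix_(i, j) mk_laurent (a_bounded i j).
have A1 : mball (-1) (A - 1%:M).
  move=> i j m m1; rewrite !mxE /= a_out// !mxE.
  by rewrite subrr.
have AP : absdet1 A by rewrite -(subrKC 1%:M A); exact: absdet1_1E.
exists (mkG AP); split.
  by exists (A - 1%:M) => //=; rewrite mul1mx subrKC.
move=> S /=; rewrite nbhsE => -[S' [[B Bo BS'] S'A] S'S].
rewrite nbhs_filterE; apply: (filterS S'S); rewrite -BS'.
have /nbhs_mball[L LB] : nbhs A B.
  by apply: open_nbhs_nbhs; split=> //; move: S'A; rewrite -BS'.
have near_coef : U [set g : G | forall i j (l : 'I_(absz L)), (val g) i j (- l%:Z) = A i j (- l%:Z)].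
  apply: filter_forall => i; apply: filter_forall => j; apply: filter_forall => l.
  by apply: filterS (aP (i, j, - l%:Z)) => g /=; rewrite mxE.
apply: filterS2 near_coef UE => g gA [E [E1 _] gE] /=.
apply: LB; change (mball L (val g - A)) => i j m Lm; rewrite !mxE /=.
have [m0|m0] := ltP (-1) m.
  rewrite a_out// gE mul1mx mxE /= (E1 i j m m0) addr0.
  by rewrite subrr.
have lm : (absz m < absz L)%N by lia.
have mE : m = - (Ordinal lm)%:Z by rewrite /=; lia.
by rewrite mE gA mxE subrr.
Qed.

End PrincipalUnits.

(** * Haar measure on a coset as a finite average *)

Section HaarGroup.
Variables (R : realType) (F : finFieldType) (n : nat).
Local Notation K := (laurent F).
Local Notation G := (absdet1_group F n).
Variable mG : {measure set (borel G) -> \bar R}.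
Hypothesis mG_haar : haar_measure G (@absdet1_mul F n) mG.
Local Notation one := (absdet1_one F n).

Lemma mG_event g0 (s : int) (Phi : set 'M[K]_n) : s <= -1 ->
  ball_invariant s (-1) Phi -> mG (event g0 Phi) = mG (event one Phi).
Proof.
move=> s1 Phis; case: mG_haar => inv _ _.
rewrite -(inv g0 (event one Phi)); last by apply: open_borel; exact: event_open s1 Phis.
congr (mG _); apply/seteqP; split=> [g [E [E1 PE] gE]|_ [h [E [E1 PE] hE] <-]].
  exists (mkG (absdet1_1E E1)).
    by exists E => //=; rewrite mul1mx.
  by apply: val_inj; rewrite /= gE.
by exists E => //=; rewrite hE mul1mx.
Qed.

Definition vol1 : R := fine (mG (event one setT)).

Lemma vol1E : mG (event one setT) = vol1%:E.
Proof.
rewrite /vol1 fineK// ge0_fin_numE//.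
by case: mG_haar => _ + _; apply; exact: event_compact.
Qed.

(** The coset is partitioned into left translates of the small congruence subgroup [event one c],
    all of the same measure. The event is a union of some of these pieces, and their total number
    [q ^ (N * (n * n))] fixes the measure of each. *)
Lemma mG_avg g0 N (Phi : set 'M[K]_n) : ball_invariant (-1 - N%:Z) (-1) Phi ->
  mG (event g0 Phi) = (avg N (-1) (fun E => (E \in Phi)%:R : R) * vol1)%:E.
Proof.
move=> PhiN.
pose c : set 'M[K]_n := [set E | mball (-1 - N%:Z) E].
have c_inv : ball_invariant (-1 - N%:Z) (-1) c.
  move=> A D _ DN; apply/propext; split; last by move=> AN; exact: mballD.
  by move=> ADN; rewrite -(addrK D A); exact: mballB.
have part (Psi : set 'M[K]_n) : ball_invariant (-1 - N%:Z) (-1) Psi ->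
    mG (event g0 Psi) = ((\sum_(x : 'M['rV[F]_N]_n) (mpart (-1) x \in Psi)%:R : R)%:E
      * mG (event one c))%E.
  move=> PsiN.
  pose C (x : 'M['rV[F]_N]_n) : set (borel G) :=
    event (absdet1_mul g0 (mkG (absdet1_1E (mpart_ball (r := -1) x)))) c.
  rewrite -(measure_equal_pieces (mu := mG) (C := C)).
  - congr (mG _); apply/seteqP; split=> [g [E [E1 PE] gE]|g [x /= Px [E [E1 Ec] gE]]].
      pose x := mtail N (-1) E.
      have xE : mball (-1 - N%:Z) (E - mpart (-1) x) by exact: mtailK.
      have [E' E1' EE'] := inv_1E (mpart_ball (r := -1) x).
      exists x => /=; last first.
        exists ((1%:M + E') *m (E - mpart (-1) x)); first split.
        + apply: (@mballW _ _ _ (-1 - N%:Z)); first lia.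
          by rewrite mulmxDl mul1mx; exact: mball_1E.
        + by rewrite /c /= mulmxDl mul1mx; exact: mball_1E.
        rewrite /= gE -[RHS]mulmxA; congr (_ *m _).
        by rewrite [RHS]mulmxDr mulmx1 [X in _ = _ + X]mulmxA EE' mul1mx -addrA subrKC.
      apply/mem_set; rewrite -(PsiN (mpart (-1) x) _ _ xE) ?subrKC//.
      exact: mpart_ball.
    have HE : mball (-1 - N%:Z) ((1%:M + mpart (-1) x) *m E).
      by rewrite mulmxDl mul1mx; apply: mball_1E => //; exact: mpart_ball.
    exists (mpart (-1) x + (1%:M + mpart (-1) x) *m E); last first.
      rewrite gE /= -mulmxA; congr (_ *m _).
      by rewrite [LHS]mulmxDr mulmx1 addrA.
    split; first by apply: mballD; [exact: mpart_ball|apply: mballW HE; lia].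
    by rewrite PsiN//; [exact/set_mem|exact: mpart_ball].
  - by move=> x _; apply: open_borel; apply: event_open c_inv; lia.
  - by move=> x _; apply: mG_event c_inv; lia.
  - move=> x y _ _ [g [[E [E1 Ec] gE] [E' [E1' Ec'] gE']]].
    have := etrans (esym gE) gE'; rewrite /= -!mulmxA.
    move=> /(congr1 (mulmx (invmx (val g0)))).
    rewrite !(mulKmx (absdet1_unitmx (absdet1_val g0))) => H.
    rewrite -(mpartK (-1) x) -(mpartK (-1) y); apply: mtail_eq.
    have e1 (z : 'M['rV[F]_N]_n) (D : 'M[K]_n) : c D ->
        mball (-1 - N%:Z) ((1%:M + mpart (-1) z) *m (1%:M + D) - (1%:M + mpart (-1) z)).
      move=> cD; rewrite mulmxDr mulmx1 addrAC subrr add0r mulmxDl mul1mx.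
      by apply: mball_1E => //; exact: mpart_ball.
    have -> : mpart (-1) x - mpart (-1) y = (1%:M + mpart (-1) x) - (1%:M + mpart (-1) y).
      by rewrite opprD addrACA subrr add0r.
    apply: mball_trans (mballBC (e1 x E Ec)) _; rewrite H; exact: e1.
have cT : ball_invariant (-1 - N%:Z) (-1) (setT : set 'M[K]_n) by [].
have := part setT cT; rewrite (mG_event g0 (s := -1))// vol1E.
rewrite (eq_bigr (fun=> 1)) => [|x _]; last by rewrite mem_set.
rewrite sumr_const [X in _ *+ X](_ : _ = #|{: 'M['rV[F]_N]_n}|)// card_mx_rV.
rewrite (part _ PhiN).
have : (0 <= mG (event one c))%E by exact: measure_ge0.
case: (mG (event one c)) => [z _|_|//].
  rewrite -!EFinM => -[->]; congr EFin; rewrite /avg; field.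
  by rewrite qX_neq0.
by rewrite gt0_muley// lte_fin qX_gt0.
Qed.

End HaarGroup.

(** * Counting lattice points *)

Section Counting.
Variables (F : finFieldType) (n : nat).
Local Notation K := (laurent F).

Lemma vnormP (v : 'cV[K]_n) (t : nat) : vnorm v <= #|F|%:R ^+ t <-> mball t%:Z v.
Proof.
rewrite exprnP; split=> [vt i j|vt].
  rewrite ord1; apply/labs_le; apply: le_trans vt.
  by rewrite /vnorm (bigD1 i)//= le_max lexx.
apply: (big_ind (fun x : rat => x <= #|F|%:R ^ t%:Z)) => [|x y xt yt|i _].
- by rewrite exprz_ge0// ltW// Defs.card_gt0.
- by rewrite ge_max xt.
- exact/labs_le.
Qed.

Lemma lattice_pointsS (Q : 'cV[K]_n -> K) (I : set K) (t : nat) :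
  #|` fset_set (lattice_points Q I t.+1)| =
  (#|` fset_set (lattice_points Q I t)| +
   #|[set x : 'M['rV[F]_t.+2]_(n, 1) | onsphere x && (Q (pvec x) \in I)]%SET|)%N.
Proof.
pose f (x : 'M['rV[F]_t.+2]_(n, 1)) : 'cV[{poly F}]_n := map_mx rVpoly x.
have fE x : map_mx (@lpoly F) (f x) = pvec x.
  by apply/matrixP => i j; rewrite ord1 pvec_poly !mxE.
set P := finset _.
have fi : injective f.
  by move=> x y /matrixP xy; apply/matrixP => i j; apply: (can_inj (@rVpolyK _ _));
    have := xy i j; rewrite !mxE.
have -> : lattice_points Q I t.+1 = lattice_points Q I t `|` (f @` [set` P]).
  apply/seteqP; split=> [v [Iv vt]|v [[Iv vt]|[x /= + <-]]].
  - have [/vnormP vt'|vt'] := pselect (mball t%:Z (map_mx (@lpoly F) v)); first by left.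
    right; move/vnormP : vt => vt.
    pose x : 'M['rV[F]_t.+2]_(n, 1) := map_mx poly_rV v.
    have fx : f x = v.
      apply/matrixP => i j; rewrite !mxE poly_rV_K// ord1.
      apply: lpoly_bounded; have := vt i 0; rewrite mxE; apply: lboundedW; lia.
    exists x => //=; rewrite inE -(fE x) fx mem_set// andbT.
    apply/onsphereP; rewrite -fE fx; split=> //.
    apply: contrapT => /forallNP H; apply: vt' => i j; rewrite ord1.
    have /negP/negPn/eqP Hi := H i.
    have := lbounded_lead (vt i 0) Hi; apply: lboundedW; lia.
  - split=> //; apply/vnormP; move/vnormP : vt; apply: mballW; lia.
  - rewrite inE => /andP[_ /set_mem Ix]; split; first by rewrite fE.
    by apply/vnormP; rewrite fE; exact: pvec_ball.
have finP : finite_set (f @` [set` P]) by apply: finite_image; exact: finite_finset.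
rewrite fset_setU//; last exact: finite_lattice_points.
have fP : fset_set (f @` [set` P]) = [fset f x | x in P]%fset.
  apply/fsetP => v; rewrite in_fset_set//; apply/idP/imfsetP => /=.
    by move=> /set_mem[x xP <-]; exists x.
  by move=> [x xP ->]; apply/mem_set; exists x.
have disj : (fset_set (lattice_points Q I t) `&` fset_set (f @` [set` P]) = fset0)%fset.
  apply/eqP; rewrite -fset_setI//; last exact: finite_lattice_points.
  rewrite (_ : _ `&` _ = set0) ?fset_set0//.
  apply/seteqP; split=> // v [[_ /vnormP vt] [x /= xP fx]].
  move: xP vt; rewrite inE => /andP[/onsphereP [_ [i /eqP xi]] _] /(_ i 0 t.+1%:Z).
  by rewrite -fx fE => /(_ _)/xi; apply; lia.
rewrite cardfsU disj cardfs0 subn0 fP; congr (_ + _)%N.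
by rewrite card_imfset//= -cardE.
Qed.

End Counting.

(** * Geometric estimates for real sequences *)

Section RealSequences.
Variable R : realType.

(** Bernoulli's inequality for the powers of [tau^-1 = 1 + h]. *)
Lemma linear_geometric_bounded (tau : R) : 0 < tau < 1 ->
  exists2 C, 0 < C & forall k : nat, k.+1%:R * tau ^+ k <= C.
Proof.
move=> /andP[t0 t1]; pose h := tau^-1 - 1.
have h0 : 0 < h by rewrite subr_gt0 invf_gt1.
have bern (k : nat) : 1 + k%:R * h <= tau^-1 ^+ k.
  elim: k => [|k IH]; first by rewrite mul0r addr0.
  rewrite exprS -{1}[tau^-1](subrK 1) -/h.
  apply: (@le_trans _ _ ((h + 1) * (1 + k%:R * h))).
    have : 0 <= k%:R * h * h by rewrite !mulr_ge0// ltW.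
    by rewrite -natr1; nra.
  by apply: ler_wpM2l => //; rewrite addr_ge0// ltW.
exists (1 + h^-1) => [|k]; first by rewrite addr_gt0 ?invr_gt0.
have tk : 0 < tau ^+ k by rewrite exprn_gt0.
rewrite -ler_pdivlMr// -exprVn.
apply: (@le_trans _ _ ((1 + h^-1) * (1 + k%:R * h))).
  have -> : (1 + h^-1) * (1 + k%:R * h) = 1 + k%:R * h + h^-1 + k%:R.
    by field; rewrite gt_eqF.
  have : 0 <= k%:R * h by rewrite mulr_ge0// ltW.
  have : 0 < h^-1 by rewrite invr_gt0.
  by rewrite -natr1; lra.
by apply: ler_wpM2l => //; rewrite addr_ge0// invr_ge0 ltW.
Qed.

Lemma sum_geometric_le (a : R) (t : nat) : 1 < a ->
  \sum_(k < t.+1) a ^+ k <= a / (a - 1) * a ^+ t.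
Proof.
move=> a1; have a10 : 0 < a - 1 by rewrite subr_gt0.
have := subrX1 a t.+1; rewrite mulrC => E.
rewrite mulrAC ler_pdivlMr// -E exprS; lra.
Qed.

Lemma nneseries_geometric_fin (u : nat -> \bar R) (C rho : R) : 0 < rho < 1 -> 0 <= C ->
  (forall k, 0 <= u k <= (C * rho ^+ k)%:E)%E ->
  (\sum_(k <oo) u k < +oo)%E.
Proof.
move=> /andP[r0 r1] C0 uC.
apply: (@le_lt_trans _ _ (C / (1 - rho))%:E); last exact: ltry.
apply: lime_le; first by apply: is_cvg_nneseries => k _ _; have /andP[] := uC k.
apply: nearW => m.
apply: (@le_trans _ _ (\sum_(0 <= k < m) (C * rho ^+ k)%:E)%E).
  by apply: lee_sum => k _; have /andP[] := uC k.
rewrite sumEFin lee_fin -mulr_sumr; apply: ler_wpM2l => //.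
have r10 : 0 < 1 - rho by rewrite subr_gt0.
rewrite -[leRHS]mul1r ler_pdivlMr// big_mkord.
have rm : 0 <= rho ^+ m by rewrite exprn_ge0// ltW.
rewrite -opprB mulrN mulrC -subrX1; lra.
Qed.

(** The main terms form a geometric sum with leading coefficient [a / (a - 1)]; the errors for
    [k < k1] go into the constant, as [L ^+ k >= 1]. *)
Lemma counting_bigO (cnt0 : nat) (Nk cnt : nat -> nat) (c m a L : R) (D : R) (k1 : nat) :
  1 < a -> 1 < L ->
  cnt 0%N = cnt0 -> (forall t, cnt t.+1 = (cnt t + Nk t.+1)%N) ->
  (forall k, (k1 <= k)%N -> `|(Nk k)%:R - c * a ^+ k * m| <= D * L ^+ k) ->
  exists2 B, 0 < B & forall t, `|(cnt t)%:R - c * (a / (a - 1)) * a ^+ t * m| <= B * L ^+ t.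
Proof.
move=> a1 L1 c0 cS Hk.
have a10 : 0 < a - 1 by rewrite subr_gt0.
have L10 : 0 < L - 1 by rewrite subr_gt0.
have L0 : 0 < L by lra.
have L1k (k : nat) : 1 <= L ^+ k by rewrite exprn_ege1// ltW.
pose err k : R := (Nk k)%:R - c * a ^+ k * m.
pose D' := \sum_(k < k1) `|err k| + `|D|.
have D'0 : 0 <= D' by rewrite addr_ge0// sumr_ge0.
have errD (k : nat) : `|err k| <= D' * L ^+ k.
  have [kk|kk] := leqP k1 k.
    apply: (le_trans (Hk k kk)); apply: ler_wpM2r; first by rewrite exprn_ge0// ltW.
    by rewrite (le_trans (ler_norm D))// lerDr sumr_ge0.
  rewrite -[leLHS]mulr1; apply: ler_pM => //.
  rewrite /D' (bigD1 (Ordinal kk))//= -addrA lerDl addr_ge0// sumr_ge0//.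
(* [cnt 0] is not governed by [Nk 0], hence the subtraction of [err 0]. *)
have cntE t : (cnt t)%:R - c * (a / (a - 1)) * a ^+ t * m =
    cnt0%:R - c * (a / (a - 1)) * m - err 0%N + \sum_(k < t.+1) err k.
  elim: t => [|t IH]; first by rewrite c0 big_ord1 expr0; ring.
  rewrite big_ord_recr /= addrA -IH cS natrD /err exprS.
  by field; rewrite gt_eqF.
exists (`|cnt0%:R - c * (a / (a - 1)) * m - err 0%N| + D' * (L / (L - 1)) + 1) => [|t].
  by rewrite ltr_wpDl// addr_ge0// !mulr_ge0// ?invr_ge0 ltW.
rewrite cntE; apply: (le_trans (ler_normD _ _)).
have split3 (x y z : R) : (x + y + 1) * z = x * z + (y * z + z) by ring.
rewrite split3; apply: lerD; first by rewrite ler_peMr.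
rewrite -[leLHS]addr0; apply: lerD; last by rewrite (le_trans _ (L1k t)).
apply: (le_trans (ler_norm_sum _ _ _)).
apply: (@le_trans _ _ (\sum_(k < t.+1) D' * L ^+ k)); first exact: ler_sum.
by rewrite -mulr_sumr -mulrA; apply: ler_wpM2l => //; exact: sum_geometric_le.
Qed.

End RealSequences.

(** * Almost every form *)

Section AlmostEverywhere.
Variables (R : realType) (F : finFieldType) (n : nat).
Local Notation K := (laurent F).
Local Notation q := (#|F|%:R : R).
Local Notation G := (absdet1_group F n).
Variable mK : {measure set (borel K) -> \bar R}.
Hypothesis mK_haar : haar_measure K +%R mK.
Hypothesis mK1 : mK (laurent_integers F) = 1%E.
Variable mG : {measure set (borel G) -> \bar R}.
Hypothesis mG_haar : haar_measure G (@absdet1_mul F n) mG.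
Variable Q : 'cV[K]_n -> K.
Hypothesis Qf : quadratic_form Q.
Variable g0 : G.

Definition indicator_form (J : set K) (z : 'cV[K]_n) : R := (Q z \in J)%:R.

Lemma vol1_ge0 : 0 <= vol1 mG.
Proof. by rewrite fine_ge0. Qed.

Lemma rotated_sum_inv k N (f : 'cV[K]_n -> R) :
  ball_invariant (k%:Z - 1 - N%:Z) k%:Z f ->
  ball_invariant (-1 - N%:Z) (-1) (rotated_sum k f).
Proof.
move=> fi A D A1 DN; apply: eq_bigr => x _.
exact: rotated_inv fi x A D A1 DN.
Qed.

Lemma indicator_form_inv k L (J : set K) : linvariant L J ->
  exists N0 : nat, forall N, (N0 <= N)%N ->
    ball_invariant (k%:Z - 1 - N%:Z) k%:Z (indicator_form J).
Proof.
move=> JL; have [b [Qb Bb]] := qf_bounded Qf.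
exists (k + k + b + absz L)%N => N NN.
by apply: (qf_ball_invariant R Qb Bb JL); lia.
Qed.

Definition deviation (k : nat) (J : set K) (s lam : R) : set 'M[K]_n :=
  [set E | lam < `|rotated_sum k (indicator_form J) E - s|].

(** The event depends on finitely many digits of [E], so it is open and its measure is an average,
    to which Chebyshev's inequality applies. *)
Lemma deviation_bound (L : int) k (J : set K) (V s lam : R) : linvariant L J -> 0 < lam ->
  (exists N0 : nat, forall N, (N0 <= N)%N ->
    sphere_sum N k (indicator_form J) = s /\
    avg N (-1) (fun E => (rotated_sum k (indicator_form J) E - s) ^+ 2) <= V) ->
  measurable (event g0 (deviation k J s lam) : set (borel G)) /\
  (mG (event g0 (deviation k J s lam)) <= (V / lam ^+ 2 * vol1 mG)%:E)%E.
Proof.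
move=> JL l0 [N0 HN]; have [N1 Ninv] := indicator_form_inv k JL.
pose N := maxn N0 N1; have [_ HV] := HN N (leq_maxl _ _).
have fi := Ninv N (leq_maxr _ _).
have dev_inv : ball_invariant (-1 - N%:Z) (-1) (deviation k J s lam).
  by move=> A D A1 DN; rewrite /deviation /= (rotated_sum_inv fi).
split; first by apply: open_borel; apply: event_open dev_inv; lia.
rewrite (mG_avg mG_haar g0 dev_inv) lee_fin; apply: ler_wpM2r; first exact: vol1_ge0.
rewrite ler_pdivlMr ?exprn_gt0// -avgZr; apply: le_trans HV.
apply: le_avg => E _; case: (boolP (E \in _)) => [/set_mem H|_]; last by rewrite mul0r sqr_ge0.
rewrite mul1r -[leRHS]real_normK ?num_real//.
by apply: lerXn2r; rewrite ?nnegrE ?(ltW l0)//; exact: ltW H.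
Qed.

Definition hits (k : nat) (U : set K) : set 'M[K]_n :=
  [set E | exists2 x : 'M['rV[F]_k.+1]_(n, 1), onsphere x & U (Q (pvec x + E *m pvec x))].

(** On this event [rotated_sum] is at least 1, so Markov's inequality bounds its measure by the mean
    number of hits. *)
Lemma hits_bound_clopen k L (U : set K) (s : R) : linvariant L U ->
  (exists N0 : nat, forall N, (N0 <= N)%N -> sphere_sum N k (indicator_form U) = s) ->
  measurable (event g0 (hits k U) : set (borel G)) /\
  (mG (event g0 (hits k U)) <= (s * vol1 mG)%:E)%E.
Proof.
move=> UL [N0 HN]; have [N1 Ninv] := indicator_form_inv k UL.
pose N := maxn N0 N1; have fi := Ninv N (leq_maxr _ _).
have hitsE E : hits k U E <-> exists2 x : 'M['rV[F]_k.+1]_(n, 1), onsphere x &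
    0 < indicator_form U (pvec x + E *m pvec x).
  split=> -[x xk H]; exists x => //.
    by rewrite /indicator_form mem_set.
  by apply/set_mem; move: H; rewrite /indicator_form; case: (_ \in _) => //; rewrite ltxx.
have hits_inv : ball_invariant (-1 - N%:Z) (-1) (hits k U).
  move=> A D A1 DN; apply/propext; split=> /hitsE [x xk H]; apply/hitsE; exists x => //;
    by move: H; rewrite (rotated_inv fi x A1 DN).
split; first by apply: open_borel; apply: event_open hits_inv; lia.
rewrite (mG_avg mG_haar g0 hits_inv) lee_fin; apply: ler_wpM2r; first exact: vol1_ge0.
rewrite -(HN N (leq_maxl _ _)) -(mean_rotated_sum fi).
apply: le_avg => E _; case: (boolP (E \in _)) => [/set_mem [x xk H]|_]; last by apply: sumr_ge0.
rewrite /rotated_sum (bigD1 x)//= {1}/indicator_form mem_set// lerDl.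
exact: sumr_ge0.
Qed.

Variable dc : R.
Hypothesis Qd : has_density mK Q dc.
Hypothesis n2 : (2 <= n)%N.

(** The threshold [k0] has to serve all [W], because another [W] is used for each [k]. Resolutions
    are needed only for the exhausting sets, and continuity from below passes to [W]. *)
Lemma hits_bound_open (M : nat) : exists k0 : nat, forall k, (k0 <= k)%N ->
  forall (W : set K) (eps : R), open W -> (mK W <= eps%:E)%E ->
  measurable (event g0 (hits k (W `&` lball F M%:Z)) : set (borel G)) /\
  (mG (event g0 (hits k (W `&` lball F M%:Z))) <=
    (dc * q ^+ ((n - 2) * k) * eps * vol1 mG)%:E)%E.
Proof.
have [dc0 /(_ M) [k0 Hk0]] := Qd; exists k0 => k kk W eps Wo We.
have [J [JL Jinc JM JE]] := open_exhaustion M%:Z Wo.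
have bnd i : measurable (event g0 (hits k (J i)) : set (borel G)) /\
    (mG (event g0 (hits k (J i))) <= (dc * q ^+ ((n - 2) * k) * eps * vol1 mG)%:E)%E.
  have [L JiL] := JL i; have [N0 HN] := Hk0 k kk L (J i) (JM i) JiL.
  have [mH bH] := hits_bound_clopen JiL (ex_intro _ N0 HN).
  split=> //; apply: (le_trans bH); rewrite lee_fin.
  apply: ler_wpM2r; first exact: vol1_ge0.
  apply: ler_wpM2l; first by rewrite mulr_ge0// ?(ltW dc0)// ltW// qX_gt0.
  have Jfin : mK (J i) \is a fin_num.
    rewrite ge0_fin_numE//; apply: (mK_bounded_fin mK_haar mK1 (M := M%:Z)) => //.
    exact: linvariant_borel JiL.
  rewrite -lee_fin fineK//; apply: le_trans We; apply: le_mK.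
  - exact: linvariant_borel JiL.
  - exact: open_borel.
  - by move=> y Jy; have [] : (W `&` lball F M%:Z) y by rewrite -JE; exists i.
have E : event g0 (hits k (W `&` lball F M%:Z)) = \bigcup_i event g0 (hits k (J i)).
  rewrite -JE; apply/seteqP; split=> g.
    by move=> [E [E1 [x xk [i _ Jx]]] gE]; exists i => //; exists E => //; split=> //; exists x.
  by move=> [i _ [E [E1 [x xk Jx]] gE]]; exists E => //; split=> //; exists x => //; exists i.
have mU : measurable (\bigcup_i event g0 (hits k (J i)) : set (borel G)).
  by apply: bigcup_measurable => i _; exact: (bnd i).1.
rewrite E; split=> //.
have cv : (mG \o (fun i => event g0 (hits k (J i)))) i @[i --> \oo] -->
    mG (\bigcup_i event g0 (hits k (J i))).
  apply: nondecreasing_cvg_mu => //; first by move=> i; exact: (bnd i).1.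
  move=> i j ij; apply/subsetPset => g [A [A1 [x xk Jx]] gA].
  by exists A => //; split=> //; exists x => //; exact: Jinc ij _ Jx.
rewrite -(cvg_lim _ cv)//; apply: lime_le; first by apply/cvg_ex; eexists; exact: cv.
by apply: nearW => i /=; exact: (bnd i).2.
Qed.

Hypothesis Qn : qf_nondegenerate Q.

Lemma variance_density (M : nat) : exists (A : R) (M' k0 : nat), [/\ 0 <= A, (M <= M')%N &
  forall k, (k0 <= k)%N -> forall (L : int) (J : set K), linvariant L J ->
  J `<=` lball F M'%:Z -> exists N0 : nat, forall N, (N0 <= N)%N ->
    sphere_sum N k (indicator_form J) = dc * q ^+ ((n - 2) * k) * fine (mK J) /\
    avg N (-1) (fun E => (rotated_sum k (indicator_form J) E -
      dc * q ^+ ((n - 2) * k) * fine (mK J)) ^+ 2) <= A * k.+1%:R ^+ 2 * q ^+ ((n - 2) * k)].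
Proof.
have [c [Qc Bc]] := qf_bounded Qf; have [c0 Bc0] := qf_lower Qf Qn.
(* The enlargement gives [c <= M'], with which the variance bound controls [Q] at the residual. *)
pose M' := (M + c)%N; have [dc0 /(_ M') [k0 Hk0]] := Qd.
exists (n%:R ^+ 2 * q ^+ (2 * M' + 2 * c0 + (c + c0).+1 + n + 4)), M', k0; split.
- by rewrite mulr_ge0// ?exprn_ge0.
- exact: leq_addr.
move=> k kk L J JL JM; have [N0 HN] := Hk0 k kk L J JM JL.
exists (N0 + k + k + k + c + c0 + absz L)%N => N NN.
have sE : sphere_sum N k (indicator_form J) = dc * q ^+ ((n - 2) * k) * fine (mK J).
  by apply: HN; lia.
split=> //; rewrite -sE.
have cM' : (c <= M')%N by exact: leq_addl.
by apply: (variance_le R n2 Qf Qc Bc Bc0 cM' JM JL); lia.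
Qed.

Variable I : set K.
Hypothesis Ib : laurent_bounded_set I.
Hypothesis Im : completed_algebra_gen mK I.
Variable delta : R.
Hypothesis delta12 : 1 / 2 < delta < 1.
Hypothesis n3 : (3 <= n)%N.

Definition lam : R := q `^ (delta * (n - 2)%:R).

Lemma powR_gt1 (s : R) : 0 < s -> 1 < q `^ s.
Proof.
move=> s0; rewrite -[ltLHS](congr1 (fun f => f s) (powR1 R)).
by apply: gt0_ltr_powR => //; rewrite ?nnegrE ?ltW ?q_gt0// q_gt1.
Qed.

Lemma n2_gt0 : 0 < (n - 2)%:R :> R.
Proof. by rewrite ltr0n subn_gt0. Qed.

Lemma lam_gt1 : 1 < lam.
Proof.
have /andP[d1 d2] := delta12.
by apply: powR_gt1; rewrite mulr_gt0 ?n2_gt0//; lra.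
Qed.

(** This is where [1 / 2 < delta] is decisive. Chebyshev's inequality leaves [(k + 1)^2 tau^(4 k)]:
    half of the power absorbs the square, the other half is summable. *)
Lemma tau_ex : exists2 tau : R, 0 < tau < 1 & tau ^+ 4 * lam ^+ 2 = q ^+ (n - 2).
Proof.
have /andP[d1 d2] := delta12; have q0 := q_gt0 R F.
pose s := (2 * delta - 1) * (n - 2)%:R / 4.
have s0 : 0 < s by rewrite divr_gt0// mulr_gt0 ?n2_gt0//; lra.
exists (q `^ (- s)).
  by rewrite powR_gt0// powRN invf_lt1 ?powR_gt0 ?powR_gt1.
rewrite -!powR_mulrn ?powR_ge0 ?(ltW q0)// /lam -!powRrM -powRD.
  by congr (_ `^ _); rewrite /s; field.
by rewrite q_neq0 implybT.
Qed.

Lemma bounded_lball : exists M : nat, I `<=` lball F M%:Z.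
Proof.
have [B IB] := Ib; pose M := Num.bound `|B|.
exists M => y /IB yB; apply/labs_le; apply: (le_trans yB).
apply: (le_trans (ler_norm B)); apply: (@le_trans _ _ M%:R).
  by apply/ltW/archi_boundP.
by rewrite -exprnP -natrX ler_nat ltnW// ltn_expl// card_finNzRing_gt1.
Qed.

Lemma almost_every_coset : exists2 Z : set (borel G), mG.-negligible Z &
  forall (g : G) (E : 'M[K]_n), mball (-1) E -> val g = val g0 *m (1%:M + E) -> ~ Z g ->
  exists (k1 : nat) (D : R), forall k, (k1 <= k)%N ->
    `|rotated_sum k (indicator_form I) E -
      dc * (q ^+ (n - 2)) ^+ k * fine (@completed_measure_extension _ _ R mK I)| <= D * lam ^+ k.
Proof.
have [M0 IM0] := bounded_lball.
have [A [M [k1 [A0 M0M HA]]]] := variance_density M0.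
have [k2 HB] := hits_bound_open M.
have IM : I `<=` lball F M%:Z.
  by move=> y /IM0; apply: lboundedW; rewrite lez_nat.
have [tau /andP[t0 t1] tauE] := tau_ex.
have lam0 : 0 < lam := lt_trans ltr01 lam_gt1.
have dc0 : 0 < dc := Qd.1.
(* With this choice [q ^ ((n - 2) * k) * eps k] is at most [q ^ (- k)]: it controls both the hits of
   the exceptional set and the error from replacing m(I) by m(J). *)
pose eps k : R := (q ^+ (n * k))^-1.
have eps0 k : 0 < eps k by rewrite invr_gt0 qX_gt0.
have /choice[JW HJW] : forall k, exists JW : set K * set K,
    clopen_approx mK M%:Z (eps k) I JW.1 JW.2 /\
    `|fine (mK JW.1) - fine (@completed_measure_extension _ _ R mK I)| <= eps k.
  move=> k; have [J [W H]] := completed_approx mK_haar mK1 (eps0 k) Im IM.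
  by exists (J, W).
pose s k : R := dc * q ^+ ((n - 2) * k) * fine (mK (JW k).1).
(* Small [k], for which no bound is available, get the empty set; the upper limit is unaffected. *)
pose D k : set (borel G) := if (maxn k1 k2 <= k)%N then
  event g0 (deviation k (JW k).1 (s k) (lam ^+ k)) `|`
  event g0 (hits k ((JW k).2 `&` lball F M%:Z)) else set0.
have [C C0 HC] : exists2 C, 0 < C & forall k : nat, k.+1%:R * tau ^+ k <= C.
  by apply: linear_geometric_bounded; rewrite t0.
(* The two rates of decay: [tau ^+ 2] for the deviations, [q^-1] for the hits. *)
pose rho := Num.max (tau ^+ 2) (q^-1).
have rho01 : 0 < rho < 1.
  rewrite lt_max exprn_gt0//= gt_max exprn_ilt1 ?(ltW t0)//=.
  by rewrite invf_lt1 ?q_gt0 ?q_gt1.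
have rho0 : 0 <= rho by rewrite ltW//; case/andP: rho01.
pose C' := (A * C ^+ 2 + dc) * vol1 mG.
have AC0 : 0 <= A * C ^+ 2 by rewrite mulr_ge0// sqr_ge0.
have C'0 : 0 <= C' by rewrite mulr_ge0 ?vol1_ge0// addr_ge0// ltW.
have q2k k : q ^+ ((n - 2) * k) * eps k <= rho ^+ k.
  apply: (@le_trans _ _ (q^-1 ^+ k)); last first.
    apply: lerXn2r; rewrite ?nnegrE ?invr_ge0 ?(ltW (q_gt0 R F))//.
    by rewrite le_max lexx orbT.
  rewrite exprVn /eps ler_pdivrMr ?qX_gt0// ler_pdivlMl ?qX_gt0//.
  rewrite -exprD ler_weXn2l ?(ltW (q_gt1 R F))//.
  have -> : (n * k = 2 * k + (n - 2) * k)%N by rewrite -mulnDl subnKC.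
  by rewrite leq_add2r leq_pmull.
have Dbound k : measurable (D k) /\ (0 <= mG (D k) <= (C' * rho ^+ k)%:E)%E.
  rewrite measure_ge0 /=.
  have rk0 : 0 <= rho ^+ k by rewrite exprn_ge0.
  rewrite /D; case: leqP => kk; last first.
    by rewrite measure0 lee_fin; split=> //; rewrite mulr_ge0.
  have [[[L JL] JM Wo We _] _] := HJW k.
  have kk1 : (k1 <= k)%N by apply: leq_trans kk; exact: leq_maxl.
  have kk2 : (k2 <= k)%N by apply: leq_trans kk; exact: leq_maxr.
  have lk0 : 0 < lam ^+ k by rewrite exprn_gt0.
  have [mA bA] := deviation_bound JL lk0 (HA k kk1 L _ JL JM).
  have [mB bB] := HB k kk2 _ _ Wo We.
  split; first exact: measurableU.
  apply: le_trans (measureU2 mG mA mB) _.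
  apply: le_trans (leeD bA bB) _; rewrite -EFinD lee_fin -mulrDl /C' [leRHS]mulrAC.
  apply: ler_wpM2r; first exact: vol1_ge0.
  rewrite mulrDl; apply: lerD; last first.
    by rewrite -mulrA; apply: ler_wpM2l; [exact: ltW|exact: q2k].
  apply: (@le_trans _ _ (A * (k.+1%:R * tau ^+ k) ^+ 2 * (tau ^+ 2) ^+ k)).
    rewrite ler_pdivrMr ?exprn_gt0// exprM -tauE exprMn.
    rewrite (exprAC tau 4 k) (exprAC lam 2 k) (exprAC tau 2 k).
    by rewrite le_eqVlt; apply/orP; left; apply/eqP; ring.
  apply: ler_pM.
  - by rewrite mulr_ge0// sqr_ge0.
  - by rewrite -exprM exprn_ge0// ltW.
  - apply: ler_wpM2l => //; apply: lerXn2r => //.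
      by rewrite nnegrE mulr_ge0// exprn_ge0// ltW.
    by rewrite nnegrE ltW.
  - apply: lerXn2r; rewrite ?nnegrE ?exprn_ge0 ?(ltW t0)//.
    by rewrite le_max lexx.
have mD k : measurable (D k) := (Dbound k).1.
have Z0 : mG (lim_sup_set D) = 0%E.
  apply: lim_sup_set_cvg0 => //.
  by apply: (nneseries_geometric_fin rho01 C'0) => k; exact: (Dbound k).2.
exists (lim_sup_set D).
  apply/negligibleP => //.
  by apply: bigcap_measurable => // k _; exact: bigcup_measurable.
move=> g E E1 gE nZ.
have [k3 Hk3] : exists k3, forall k, (k3 <= k)%N -> ~ D k g.
  apply: contrapT => /forallNP H; apply: nZ => k _.
  by have /existsNP[j /not_implyP[kj /contrapT Dj]] := H k; exists j.
exists (maxn k3 (maxn k1 k2)), (1 + dc) => k.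
rewrite geq_max => /andP[kk3 kk].
have := Hk3 k kk3; rewrite /D kk => nD.
have [[[L JL] JM Wo We IJ] mJI] := HJW k.
have ndev : `|rotated_sum k (indicator_form (JW k).1) E - s k| <= lam ^+ k.
  rewrite leNgt; apply/negP => H; apply: nD; left.
  by apply/(eventE _ E1 gE).
have nhit : ~ hits k ((JW k).2 `&` lball F M%:Z) E.
  by move=> H; apply: nD; right; apply/(eventE _ E1 gE).
(* No rotated vector has its value in the exceptional set, so [I] and its approximation count the
   same vectors. *)
have rsE : rotated_sum k (indicator_form I) E = rotated_sum k (indicator_form (JW k).1) E.
  apply: eq_bigr => x xk; rewrite /indicator_form; congr (nat_of_bool _)%:R.
  set y := Q _.
  have [yM|yM] := pselect (lball F M%:Z y); last first.
    by rewrite !memNset// => [/JM|/IM].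
  have [Wy|IJy] := IJ y yM; first by exfalso; apply: nhit; exists x.
  by apply/idP/idP => /set_mem/IJy/mem_set.
rewrite rsE -exprM.
set m := fine (@completed_measure_extension _ _ R mK I) in mJI *.
have lk1 : 1 <= lam ^+ k by rewrite exprn_ege1// ltW// lam_gt1.
rewrite -(subrKA (s k)); apply: (le_trans (ler_normD _ _)).
rewrite mulrDl mul1r; apply: lerD => //.
rewrite /s -mulrBr normrM (ger0_norm (x := dc * _)); last first.
  by rewrite mulr_ge0// ?(ltW dc0)// ltW// qX_gt0.
rewrite -mulrA; apply: ler_wpM2l; first exact: ltW.
apply: le_trans lk1.
apply: (@le_trans _ _ (q ^+ ((n - 2) * k) * eps k)).
  by apply: ler_wpM2l => //; rewrite ltW// qX_gt0.
apply: (le_trans (q2k k)); apply: exprn_ile1 => //.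
by rewrite ltW//; case/andP: rho01.
Qed.

End AlmostEverywhere.

(** * Linear changes of variable in a form *)

Section Composition.
Variables (F : finFieldType) (n : nat).
Local Notation K := (laurent F).
Variables (Q : 'cV[K]_n -> K) (A : 'M[K]_n).

Lemma quadratic_form_comp : quadratic_form Q -> quadratic_form (fun v => Q (A *m v)).
Proof.
move=> [Q1 Q2]; split=> [a v|u a v w]; first by rewrite -scalemxAr Q1.
have polE x y : polar_form (fun v => Q (A *m v)) x y = polar_form Q (A *m x) (A *m y).
  by rewrite /polar_form mulmxDr.
by rewrite !polE mulmxDr -scalemxAr Q2.
Qed.

Lemma qf_nondegenerate_comp : A \in unitmx -> qf_nondegenerate Q ->
  qf_nondegenerate (fun v => Q (A *m v)).
Proof.
move=> AU Qn u Hu; rewrite -(mulKmx AU u) (Qn (A *m u)) ?mulmx0// => v.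
by rewrite -(mulKVmx AU v) -[RHS](Hu (invmx A *m v)) /polar_form mulmxDr.
Qed.

Lemma qf_isotropic_comp : A \in unitmx -> qf_isotropic Q ->
  qf_isotropic (fun v => Q (A *m v)).
Proof.
move=> AU [v v0 Qv]; exists (invmx A *m v); last by rewrite mulKVmx.
by apply: contra v0 => /eqP v0; rewrite -(mulKVmx AU v) v0 mulmx0.
Qed.

End Composition.

Theorem theorem1p1 (R : realType) (F : finFieldType) (n : nat)
    (mK : {measure set (borel (laurent F)) -> \bar R})
    (mG : {measure set (borel (absdet1_group F n)) -> \bar R}) :
  odd #|F| -> (3 <= n)%N ->
  haar_measure (laurent F) +%R mK -> mK (laurent_integers F) = 1%E ->
  haar_measure (absdet1_group F n) (@absdet1_mul F n) mG ->
  exists C : ('cV[laurent F]_n -> laurent F) -> R,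
    (forall Q, quadratic_form Q -> qf_nondegenerate Q -> qf_isotropic Q -> 0 < C Q) /\
    forall I : set (laurent F),
      laurent_bounded_set I -> completed_algebra_gen mK I ->
    forall delta : R, 1 / 2 < delta < 1 ->
    forall Q0 : 'cV[laurent F]_n -> laurent F,
      quadratic_form Q0 -> qf_nondegenerate Q0 -> qf_isotropic Q0 ->
    {ae mG, forall g : borel (absdet1_group F n),
      let Q := fun v => Q0 (\val g *m v) in
      (fun t : nat => #|` fset_set (lattice_points Q I t)|%:R
         - C Q * #|F|%:R ^+ ((n - 2) * t) * fine (@completed_measure_extension _ _ R mK I)
         : R^o)
      =O_\oo (fun t : nat => #|F|%:R `^ (delta * t%:R * (n - 2)%:R) : R^o)}.
Proof.
move=> _ n3 mK_haar mK1 mG_haar.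
have n2 : (2 <= n)%N by apply: leq_trans n3.
(* The value 1 is a default; for the forms considered the density exists and is unique. *)
pose dc (Q : 'cV[laurent F]_n -> laurent F) : R := xget 1 [set c | has_density mK Q c].
have dcE Q c : has_density mK Q c -> dc Q = c.
  move=> Qc; apply: (has_density_uniq mK_haar mK1) (Qc).
  exact: (@xgetPex _ 1 [set c | has_density mK Q c] (ex_intro _ c Qc)).
pose a : R := #|F|%:R ^+ (n - 2).
have a1 : 1 < a by rewrite exprn_egt1 ?q_gt1// -lt0n subn_gt0.
exists (fun Q => dc Q * (a / (a - 1))); split=> [Q Qf Qn Qi|].
  have [c Qc] := has_density_ex mK_haar mK1 n2 Qf Qn Qi.
  by rewrite (dcE _ _ Qc) mulr_gt0 ?divr_gt0 ?subr_gt0 ?(lt_trans ltr01 a1)//; case: Qc.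
move=> I Ib Im delta delta12 Q0 Q0f Q0n Q0i.
(* Centres are matrices with finitely many digits, hence countably many; one that lies outside the
   group is given the empty null set. *)
pose idx : countType := (nat * {N : nat & 'M['rV[F]_N]_n})%type.
pose center (i : idx) : 'M[laurent F]_n := mpart i.1%:Z (tagged i.2).
pose Q1 (g0 : absdet1_group F n) (v : 'cV[laurent F]_n) := Q0 (val g0 *m v).
have g0U (g0 : absdet1_group F n) : val g0 \in unitmx.
  by apply: absdet1_unitmx; exact: absdet1_val.
have Q1f g0 : quadratic_form (Q1 g0) by exact: quadratic_form_comp.
have Q1n g0 : qf_nondegenerate (Q1 g0) by exact: qf_nondegenerate_comp.
have Q1d g0 : has_density mK (Q1 g0) (dc (Q1 g0)).
  have Q1i : qf_isotropic (Q1 g0) by exact: qf_isotropic_comp.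
  have [c Qc] := has_density_ex mK_haar mK1 n2 (Q1f g0) (Q1n g0) Q1i.
  by rewrite (dcE _ _ Qc).
pose m := fine (@completed_measure_extension _ _ R mK I).
have /choice[Z HZ] : forall i : idx, exists Z : set (borel (absdet1_group F n)),
    mG.-negligible Z /\ forall g0 : absdet1_group F n, val g0 = center i ->
    forall (g : absdet1_group F n) (E : 'M[laurent F]_n), mball (-1) E ->
      val g = val g0 *m (1%:M + E) -> ~ Z g ->
    exists (k1 : nat) (D : R), forall k, (k1 <= k)%N ->
      `|rotated_sum k (indicator_form R (Q1 g0) I) E - dc (Q1 g0) * a ^+ k * m|
        <= D * lam F n delta ^+ k.
  move=> i; have [[g0 g0i]|ng0] := pselect (exists g0 : absdet1_group F n, val g0 = center i).
    have [Z negZ HZ] := almost_every_coset mK_haar mK1 mG_haar (Q1f g0) g0 (Q1d g0) n2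
      (Q1n g0) Ib Im delta12 n3.
    exists Z; split=> // g0' g0'i; suff -> : g0' = g0 by [].
    by apply: val_inj; rewrite g0'i g0i.
  exists set0; split; first exact: negligible_set0.
  by move=> g0 g0i; exfalso; apply: ng0; exists g0.
pose ZZ : set (borel (absdet1_group F n)) :=
  \bigcup_j oapp Z set0 (@choice.unpickle idx j).
have negZZ : mG.-negligible ZZ.
  apply: negligible_bigcup => j; case: (choice.unpickle j) => [i|] /=; first by case: (HZ i).
  exact: negligible_set0.
apply: (negligibleS _ negZZ) => g; apply: contra_notP => nZ /=.
have [r [N [x [g0 [g0E [E [E1 _] gE]]]]]] := event_cover g.
pose i : idx := (r, Tagged (fun N => 'M['rV[F]_N]_n) x).
have nZi : ~ Z i g by move=> Zi; apply: nZ; exists (choice.pickle i) => //; rewrite choice.pickleK.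
have [k1 [D HD]] := (HZ i).2 g0 g0E g E E1 gE nZi.
pose Q (v : 'cV[laurent F]_n) := Q0 (val g *m v).
have QE : Q = fun v => Q1 g0 (v + E *m v).
  by apply/funext => v; rewrite /Q /Q1 gE -mulmxA mulmxDl mul1mx.
have dcQ : dc Q = dc (Q1 g0).
  by apply: dcE; rewrite QE; exact: has_density_1E.
pose Nk k := #|[set x : 'M['rV[F]_k.+1]_(n, 1) | onsphere x && (Q (pvec x) \in I)]%SET|.
have NkE k : (Nk k)%:R = rotated_sum k (indicator_form R (Q1 g0) I) E :> R.
  rewrite /Nk -sum1_card natr_sum /rotated_sum.
  rewrite big_mkcond [RHS]big_mkcond; apply: eq_bigr => y _.
  rewrite inE QE /indicator_form; case: (onsphere y) => //=.
  by case: (_ \in I).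
have HNk k : (k1 <= k)%N ->
    `|(Nk k)%:R - dc (Q1 g0) * a ^+ k * m| <= D * lam F n delta ^+ k.
  by move=> kk; rewrite NkE; exact: HD.
have [B B0 HB] := @counting_bigO R _ Nk (fun t => #|` fset_set (lattice_points Q I t)|)
  (dc (Q1 g0)) m a (lam F n delta) D k1 a1 (lam_gt1 F delta12 n3) erefl
  (fun t => lattice_pointsS Q I t) HNk.
apply/eqO_exP; exists B => //; apply: nearW => t.
rewrite -/Q dcQ exprM.
have -> : #|F|%:R `^ (delta * t%:R * (n - 2)%:R) = lam F n delta ^+ t.
  by rewrite mulrAC powRrM powR_mulrn ?powR_ge0.
by rewrite (ger0_norm (x := lam F n delta ^+ t)) ?exprn_ge0 ?powR_ge0.
Qed.
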